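(* Assume that there exists a function $$\varphi\in H_0^1((T-\sigma,T);L^2(0,l))\cap L^2((T-\sigma,T);\mathscr H^1(0,l))$$ such that the source condition $F(q^* )\varphi=\nabla^*\nabla q^*$ holds in the weak sense, i.e. for any $p\in H^1(0,l)$, $$\langle F(q^* )\varphi,p\rangle=\langle\nabla^*\nabla q^*,p\rangle=\langle\nabla q^*,\nabla p\rangle .$$ Furthermore, assume that $$\nabla\cdot(a\nabla\varphi)\in L^2((T-\sigma,T);L^2(0,l))$$ and that $q_N^\delta$ satisfies $q_N^\delta(0)=q^*(0)$, $q_N^\delta(l)=q^*(l)$, where $q_N^\delta$ is a minimizer of $$J_\sigma^\delta(q)=\frac1{2\sigma}\int_{T-\sigma}^T\int_0^l|u(x,t;q)-g^\delta(x)|^2\,dxdt+\frac N2\int_0^l|\nabla q|^2\,dx$$ over $\mathcal A$. Then, with $N\sim\delta$, we have $$\int_0^l|q_N^\delta-q^*|^2\,dx\le C\delta$$ and $$\frac1\sigma\int_{T-\sigma}^T\int_0^l|u(q_N^\delta)-u(q^* )|^2\,dxdt\le C\delta^2,$$ where $C$ is a positive constant independent of $\delta$, $N$ and $T$.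
   Context: Let $l,T>0$, $0<\sigma<T$, $Q=(0,l)\times(0,T]$, and let $\nabla$ denote $\partial/\partial x$. Assumptions on the given data: $a\in C^1[0,l]$, $a(0)=a(l)=0$, $a(x)>0$ for $x\in(0,l)$; $\phi$ is a given smooth function with $\phi\ge0$, $\phi\not\equiv0$ on $(0,l)$; $N$ is the (positive) regularization parameter; $\alpha,\beta$ are two given positive constants, and $\mathcal A=\{q:\ 0<\alpha\le q\le\beta,\ \|q\|_{H^1(0,l)}<\infty\}$. $\mathscr H^1(0,l)$ is the closure of $C_0^\infty(0,l)$ under the norm $\|v\|_{\mathscr H^1}^2=\int_0^l a(x)(|v|^2+|\nabla v|^2)\,dx$. For a coefficient $q$, $u(q)=u(\cdot,\cdot;q)$ is the weak solution of $u_t-(au_x)_x+qu=0$ in $Q$, $u|_{t=0}=\phi$ (no boundary condition at $x=0,l$), that is: $u\in H^1((0,T);L^2(0,l))\cap L^2((0,T);\mathscr H^1(0,l))$, $u(x,0)=\phi(x)$, and for a.e. $t\in(0,T]$ $$\int_0^l u_t\psi\,dx+\int_0^l a\nabla u\cdot\nabla\psi\,dx+\int_0^l qu\psi\,dx=0\qquad\forall\psi\in L^2(0,l)\cap\mathscr H^1(0,l).$$ Exact solution and noisy data: the exact data $g\in L^\infty(0,l)$ is attainable, i.e. there exists $q^*\in H^1(0,l)$ (the real solution) such that $u(x,T;q^* )=g(x)$; $g^\delta$ is the noisy observation, and the noise level $\delta>0$ is known in the sense that $$\frac1{2\sigma}\int_{T-\sigma}^T\int_0^l|u(x,t;q^*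 )-g^\delta(x)|^2\,dxdt\le\frac12\delta^2.$$ The linear operator $F(q):L^2((0,T);L^2(0,l))\to L^2(0,l)$ is $F(q)\Phi=-\frac1\sigma\int_{T-\sigma}^T u(q)\Phi\,dt$ (only the values of $\Phi$ on $(T-\sigma,T)$ matter); $\langle\cdot,\cdot\rangle$ is the scalar product of $L^2(0,l)$. The adjoint $\nabla^*$ is defined by $\langle\nabla^*\omega,\psi\rangle=\langle\omega,\nabla\psi\rangle$ for all $\omega,\psi\in H^1(0,l)$, and only the weak form of $\nabla^*\nabla$ written in the claim is needed. $H_0^1((T-\sigma,T);L^2(0,l))$ denotes the $H^1$ functions of $t$ with values in $L^2(0,l)$ vanishing at $t=T-\sigma$ and $t=T$. $N\sim\delta$ means that $N$ is chosen of the same order as $\delta$.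
   Formalization: The real solution q* is assumed to lie in the admissible set A (α ≤ q* ≤ β), not merely in H^1(0,l); without this the claim fails, e.g. when α=β and a sign-changing q* equal to α near the endpoints makes φ stationary. *)

(* Defs.v *)
From HB Require Import structures.
From mathcomp Require Import all_boot all_order all_algebra.
From mathcomp Require Import all_classical all_reals all_analysis.

Set Implicit Arguments.
Unset Strict Implicit.
Unset Printing Implicit Defensive.

Import Order.TTheory GRing.Theory Num.Theory.
Import numFieldNormedType.Exports.

Local Open Scope classical_set_scope.
Local Open Scope ring_scope.

(* Functions of space are [v : R -> R], of which only the values on (0,l)
   matter.  A time-dependent function, seen as a curve of functions of space, is
   [u : R -> R -> R] with the TIME argument first: [u t x] is u(x,t) and [u t]
   is the function u(.,t). *)

Section Spaces.
Context {R : realType}.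
Local Notation mu := (@lebesgue_measure R).

Definition smooth_at (f : R -> R) (x : R) : Prop :=
  forall n : nat, derivable (derive1n n f) x 1.

(* C_0^oo(s,t) *)
Definition test_fun (s t : R) (f : R -> R) : Prop :=
  (forall x, smooth_at f x) /\
  exists c d : R, [/\ s < c, d < t & forall x, x \notin `[c, d] -> f x = 0].

(* C^1[0,l] *)
Definition C1 (l : R) (f : R -> R) : Prop :=
  {within `[0, l], continuous f} /\
  exists df : R -> R, {within `[0, l], continuous df} /\
    forall x, x \in `]0, l[ -> is_derive x 1 f (df x).

(* L^2(0,l) *)
Definition L2 (l : R) (v : R -> R) : Prop :=
  measurable_fun `]0, l[ v /\
  (\int[mu]_(x in `]0%R, l[) ((v x) ^+ 2)%:E < +oo)%E.

(* L^oo(0,l) *)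
Definition Linfty (l : R) (v : R -> R) : Prop :=
  measurable_fun `]0, l[ v /\
  exists K : R, {ae mu, forall x, x \in `]0, l[ -> `|v x| <= K}.

(* L^2((t0,t1); L^2(0,l)) *)
Definition L2L2 (l t0 t1 : R) (u : R -> R -> R) : Prop :=
  measurable_fun (`]t0, t1[ `*` `]0, l[) (fun z : R * R => u z.1 z.2) /\
  (\int[mu]_(t in `]t0, t1[) \int[mu]_(x in `]0%R, l[) ((u t x) ^+ 2)%:E
     < +oo)%E.

(* w is a weak derivative of v on (0,l) *)
Definition weak_deriv (l : R) (v w : R -> R) : Prop :=
  [/\ locally_integrable `]0, l[ v, locally_integrable `]0, l[ w &
   forall psi : R -> R, test_fun 0 l psi ->
     \int[mu]_(x in `]0, l[) (v x * derive1 psi x) =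
     - \int[mu]_(x in `]0, l[) (w x * psi x)].

(* Weak derivatives are unique up to a null set; [grad] selects one, and is
   meaningless when there is none. *)
Definition grad (l : R) (v : R -> R) : R -> R :=
  xget (fun _ => 0) [set w | weak_deriv l v w].

(* H^1(0,l).  Its elements are represented by their continuous version on
   [0,l], so that the boundary values are pointwise ones. *)
Definition H1 (l : R) (v : R -> R) : Prop :=
  [/\ {within `[0, l], continuous v}, L2 l v,
      weak_deriv l v (grad l v) & L2 l (grad l v)].

(* The weighted space: closure of C_0^oo(0,l) for the norm
   (int_0^l a (|v|^2 + |v'|^2))^(1/2).  As a > 0 inside (0,l), convergence in
   this norm implies convergence of v and v' in L^2_loc(0,l), so the limits of
   Cauchy sequences are functions having a weak derivative. *)
Definition Ha (l : R) (a v : R -> R) : Prop :=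
  weak_deriv l v (grad l v) /\
  exists v_ : nat -> R -> R, (forall n, test_fun 0 l (v_ n)) /\
    (fun n => \int[mu]_(x in `]0%R, l[)
       (a x * ((v_ n x - v x) ^+ 2 + (derive1 (v_ n) x - grad l v x) ^+ 2))%:E)%E
      @ \oo --> 0%E.

(* L^2((t0,t1); Ha) *)
Definition L2Ha (l : R) (a : R -> R) (t0 t1 : R) (u : R -> R -> R) : Prop :=
  measurable_fun (`]t0, t1[ `*` `]0, l[) (fun z : R * R => u z.1 z.2) /\
  exists du : R -> R -> R,
  [/\ measurable_fun (`]t0, t1[ `*` `]0, l[) (fun z : R * R => du z.1 z.2),
      {ae mu, forall t, t \in `]t0, t1[ -> Ha l a (u t) /\
         {ae mu, forall x, x \in `]0, l[ -> du t x = grad l (u t) x}} &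
      (\int[mu]_(t in `]t0, t1[) \int[mu]_(x in `]0%R, l[)
         (a x * ((u t x) ^+ 2 + (du t x) ^+ 2))%:E < +oo)%E].

(* w in L^2((t0,t1); L^2(0,l)) is the weak derivative of t |-> u t: the
   L^2(0,l)-valued integrals of theta' u and of - theta w agree. *)
Definition weak_dt (l t0 t1 : R) (u w : R -> R -> R) : Prop :=
  L2L2 l t0 t1 w /\
  forall theta : R -> R, test_fun t0 t1 theta ->
    {ae mu, forall x, x \in `]0, l[ ->
      \int[mu]_(t in `]t0, t1[) (u t x * derive1 theta t) =
      - \int[mu]_(t in `]t0, t1[) (w t x * theta t)}.

Definition dt (l t0 t1 : R) (u : R -> R -> R) : R -> R -> R :=
  xget (fun _ _ => 0) [set w | weak_dt l t0 t1 u w].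

(* H^1((t0,t1); L^2(0,l)).  Its elements are represented by their version
   in C([t0,t1]; L^2(0,l)), so that traces at fixed times make sense. *)
Definition H1L2 (l t0 t1 : R) (u : R -> R -> R) : Prop :=
  [/\ L2L2 l t0 t1 u, weak_dt l t0 t1 u (dt l t0 t1 u),
      (forall t, t \in `[t0, t1] -> L2 l (u t)) &
      forall t, t \in `[t0, t1] ->
        (fun s => \int[mu]_(x in `]0%R, l[) ((u s x - u t x) ^+ 2)%:E)%E
          @ within `[t0, t1] (nbhs t) --> 0%E].

Definition H10L2 (l t0 t1 : R) (u : R -> R -> R) : Prop :=
  [/\ H1L2 l t0 t1 u,
      {ae mu, forall x, x \in `]0, l[ -> u t0 x = 0} &
      {ae mu, forall x, x \in `]0, l[ -> u t1 x = 0}].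

End Spaces.

Section InverseProblem.
Context {R : realType}.
Local Notation mu := (@lebesgue_measure R).

(* u = u(q), weak solution of u_t - (a u_x)_x + q u = 0 on (0,l) x (0,T] with
   initial value phi0 *)
Definition weak_solution (l T : R) (a phi0 q : R -> R) (u : R -> R -> R)
    : Prop :=
  [/\ H1L2 l 0 T u, L2Ha l a 0 T u,
      {ae mu, forall x, x \in `]0, l[ -> u 0 x = phi0 x} &
      {ae mu, forall t, t \in `]0, T] ->
        forall psi : R -> R, L2 l psi -> Ha l a psi ->
          \int[mu]_(x in `]0, l[) (dt l 0 T u t x * psi x)
          + \int[mu]_(x in `]0, l[) (a x * grad l (u t) x * grad l psi x)
          + \int[mu]_(x in `]0, l[) (q x * u t x * psi x) = 0}].

Definition admissible (l alpha beta : R) (q : R -> R) : Prop :=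
  H1 l q /\ forall x, x \in `]0, l[ -> alpha <= q x <= beta.

(* int_{T-sigma}^T int_0^l |u - v|^2 dx dt *)
Definition misfit (l T sigma : R) (u v : R -> R -> R) : \bar R :=
  (\int[mu]_(t in `](T - sigma)%R, T[) \int[mu]_(x in `]0%R, l[)
     ((u t x - v t x) ^+ 2)%:E)%E.

(* J(q), where u stands for u(q) *)
Definition J (l T sigma N : R) (gd q : R -> R) (u : R -> R -> R) : \bar R :=
  (((2 * sigma)^-1)%:E * misfit l T sigma u (fun _ => gd)
   + (N / 2)%:E * \int[mu]_(x in `]0%R, l[) ((grad l q x) ^+ 2)%:E)%E.

Definition minimizer (l T sigma N alpha beta : R) (a phi0 gd qN : R -> R)
    : Prop :=
  admissible l alpha beta qN /\
  forall (q : R -> R) (uN u : R -> R -> R),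
    admissible l alpha beta q ->
    weak_solution l T a phi0 qN uN -> weak_solution l T a phi0 q u ->
    (J l T sigma N gd qN uN <= J l T sigma N gd q u)%E.

(* F(q) Phi, where u stands for u(q) *)
Definition F (T sigma : R) (u Phi : R -> R -> R) : R -> R :=
  fun x => - (sigma^-1 * \int[mu]_(t in `]T - sigma, T[) (u t x * Phi t x)).

End InverseProblem.

(* Main.v *)
Require Import Defs.
From HB Require Import structures.
From mathcomp Require Import all_boot all_order all_algebra.
From mathcomp Require Import all_classical all_reals all_analysis.
From mathcomp Require Import measurable_realfun.
From mathcomp Require Import ring lra.

Import Order.TTheory GRing.Theory Num.Theory.
Import numFieldNormedType.Exports.

Local Open Scope classical_set_scope.
Local Open Scope ring_scope.

(** Write [q_0] for the exact coefficient.  Minimality of [q_N] tested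
    against [q_0] gives, with [w = u(q_N) - u(q_0)],
    [|u(q_N) - g^d|^2 / (2 sigma) + N/2 |q_N' - q_0'|^2
       <= delta^2/2 + N <q_0', q_0' - q_N'>],
    and by the source condition the last pairing is
    [sigma^-1 \int\int u(q_0) phi (q_N - q_0)].  Testing the equation of a solution
    [u(q)] with [phi] and integrating by parts in time ([phi] vanishes at both
    ends) and in space ([a] vanishes at both ends) shows that
    [\int\int u(q) (phi_t + (a phi_x)_x - q phi) = 0].  Subtracting these
    identities for [q_N] and [q_0] rewrites the pairing as [\int\int w z] with
    [z = phi_t + (a phi_x)_x - q_N phi], which Young's inequality absorbs into
    the misfit up to [N^2 |z|^2 = O(delta^2)].  As [q_N - q_0] vanishes at [0],
    Poincare's inequality turns the gradient bound into the [L^2] bound.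
    Both integrations by parts rest on the representation of functions having
    a weak derivative as indefinite integrals, obtained by testing against
    smooth approximations of indicator functions of intervals. *)

(** Estimating the pairing directly through |q_N - q_0| only keeps the gradient of q_N - q_0 bounded
    and gives no rate in delta. It has to be traded for w, on which the misfit has quadratic
    control. The trade is exact: the residuals z built from q_N and from q_0 differ by (q_N - q_0)
    phi, and each solution annihilates the residual of its own coefficient.

    The obstacle is regularity. No boundary condition is imposed, so the boundary terms of the
    integration in space must vanish through the degeneracy of a alone. In time, the derivative
    takes values in L^2 and is known only against scalar test functions. Both product rules are
    obtained from one statement about differentiating a function of two variables along the
    diagonal, applied to B(s,t) = H(s) W(t) in space and to B(s,t) = \int u(s) v(t) in time.

    The final constant is built from l, sigma, beta, c1, c2 and M only: phi enters through its
    norms, and the solutions do not enter at all, whence the independence of T. *)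

Section SmoothStep.
Context {R : realType}.
Implicit Types (f g : R -> R) (x : R) (p : {poly R}).

(** * A smooth step function on the line *)

Lemma scalarE (k : R) (v : R^o) : k *: v = k * v :> R.
Proof. by []. Qed.

(** Differentiability [n] times on the whole line, with the derivatives carried as witnesses. In
    this form an induction on [n] handles products and inverses through their derivative
    formulas. *)
Fixpoint nder n f : Prop := if n is m.+1 then
  exists df : R -> R, (forall x, is_derive x 1 f (df x)) /\ nder m df else True.

Lemma nder_smooth f : (forall n, nder n f) -> forall x, smooth_at f x.
Proof.
move=> fn x n.
suff H m h : nder m.+1 h -> derivable (derive1n m h) x 1 by exact: H.
elim: m h => [h [dh [hd _]]|m IH h [dh [hd hm]]].
  by rewrite derive1n0; case: (hd x).
rewrite derive1Sn (_ : derive1 h = dh); first exact: IH.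
by apply/funext => y; rewrite derive1E; apply: derive_val.
Qed.

Lemma nderW n f : nder n.+1 f -> nder n f.
Proof.
elim: n f => [//|n IH] f [df [hd hn]]; exists df; split => //; exact: IH.
Qed.

Lemma nderD n f g : nder n f -> nder n g -> nder n (f \+ g).
Proof.
elim: n f g => [//|n IH] f g [df [fd fn]] [dg [gd gn]].
exists (df \+ dg); split; last exact: IH.
by move=> x; apply: is_deriveD.
Qed.

Lemma nderM n f g : nder n f -> nder n g -> nder n (f \* g).
Proof.
elim: n f g => [//|n IH] f g fN gN.
case: (fN) => df [fd fn]; case: (gN) => dg [gd gn].
exists ((f \* dg) \+ (df \* g)); split.
  move=> x; have := @is_deriveM R R f g x 1 _ _ (fd x) (gd x).
  by rewrite !scalarE [X in is_derive _ _ _ (_ + X)]mulrC.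
by apply: nderD; apply: IH => //; apply: nderW.
Qed.

Lemma nder_cst n (k : R) : nder n (fun=> k).
Proof.
elim: n k => [//|n IH] k; exists (fun=> 0); split; last exact: IH.
by move=> x; apply: is_derive_cst.
Qed.

Lemma is_derive_aff f (df : R) (c d x : R) :
  is_derive (c * x + d) 1 f df ->
  is_derive x 1 (fun y => f (c * y + d)) (c * df).
Proof.
move=> fd; pose g := fun y : R => c * y + d.
have gd : is_derive x 1 g c.
  have -> : c = c *: (1 : R^o) + 0 by rewrite scalarE mulr1 addr0.
  by apply: is_deriveD; apply: is_deriveZ.
have := @is_derive1_comp R f g x df c fd gd.
by rewrite mulrC.
Qed.

Lemma nder_aff n f (c d : R) : nder n f -> nder n (fun y => f (c * y + d)).
Proof.
elim: n f => [//|n IH] f [df [fd fn]].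
exists (fun y => c * df (c * y + d)); split.
  by move=> x; apply: is_derive_aff.
by apply: (nderM _ (fun=> c) (fun y => df (c * y + d))); [exact: nder_cst|exact: IH].
Qed.

Lemma nderV n f : (forall x, f x != 0) -> nder n f -> nder n (fun x => (f x)^-1).
Proof.
(* Strong induction: the derivative of the inverse contains the inverse itself, at a lower order. *)
move=> f0; elim: n {-2}n (leqnn n) => [[]//|k IH] [//|n] nk fN.
case: (fN) => df [fd fn].
exists ((fun=> -1) \* (df \* ((fun x => (f x)^-1) \* (fun x => (f x)^-1)))).
split.
  move=> x; have := @is_deriveV R f x _ 1 (f0 x) (fd x).
  rewrite scalarE /= (_ : - f x ^- 2 * df x = -1 * (df x * ((f x)^-1 * (f x)^-1)))//.
  by rewrite expr2 invfM; ring.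
have fv : nder n (fun x => (f x)^-1) by apply: IH => //; exact: nderW.
apply: nderM; first exact: nder_cst.
by apply: nderM => //; apply: nderM.
Qed.

(* This family of functions is closed under differentiation. *)
Definition expinv p x : R := if 0 < x then p.[x^-1] * expR (- x^-1) else 0.

Lemma horner_bound p : exists C d, 0 <= C /\
  forall y, 1 <= y -> `|p.[y]| <= C * y ^+ d.
Proof.
elim/poly_ind: p => [|p c [C [d [C0 H]]]].
  by exists 0, 0%N; split=> // y _; rewrite horner0 normr0 mul0r.
exists (C + `|c|), d.+1; split; first by rewrite addr_ge0.
move=> y y1; rewrite hornerMXaddC (le_trans (ler_normD _ _))// normrM mulrDl.
have y0 : 0 <= y by lra.
apply: lerD.
  by rewrite exprSr mulrA (ger0_norm y0) ler_wpM2r// H.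
by rewrite ler_peMr ?exprn_ege1.
Qed.

Lemma is_derive_sq f (C : R) : f 0 = 0 ->
  (forall h, `|h| <= 1 -> `|f h| <= C * h ^+ 2) -> is_derive (0 : R) 1 f 0.
Proof.
move=> f0 fb.
have C0 : 0 <= C.
  have := fb 1; rewrite normr1 lexx expr1n mulr1 => /(_ isT).
  by apply: le_trans; rewrite normr_ge0.
have H : (fun h : R => h^-1 *: ((f \o shift 0) (h *: 1) - f 0)) @ 0^' --> (0 : R).
  apply/cvgrPdist_le => e e0; near=> h.
  rewrite /= f0 subr0 sub0r normrN scaler1 addr0 scalarE normrM normfV.
  have h0 : h != 0 by near: h; exact: nbhs_dnbhs_neq.
  have h1 : `|h| <= 1.
    near: h; apply: nbhs_dnbhs; exists 1 => //= y.
    by rewrite /ball_/= sub0r normrN; apply: ltW.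
  have h2 : `|h| <= e / (C + 1).
    near: h; apply: nbhs_dnbhs; exists (e / (C + 1)) => //=.
      by rewrite divr_gt0// ltr_pwDr.
    by move=> y; rewrite /ball_/= sub0r normrN; apply: ltW.
  rewrite ler_pdivrMl ?normr_gt0// (le_trans (fb _ h1))//.
  rewrite -(real_normK (num_real h)) expr2 mulrCA ler_wpM2l//.
  rewrite ler_pdivlMr in h2; last by lra.
  have := normr_ge0 h; nra.
by apply: DeriveDef; [apply/cvg_ex; exists 0|apply: cvg_lim].
Unshelve. all: by end_near. Qed.

Lemma expinv_bound p : exists C, forall h, `|h| <= 1 -> `|expinv p h| <= C * h ^+ 2.
Proof.
have [C [d [C0 H]]] := horner_bound p.
(* With y = 1/h, exp(y) is at least y^(d+2)/(d+2)!; two powers more than the growth of [p] leave the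
   factor h^2. *)
exists (C * (d.+2)`!%:R) => h h1; rewrite /expinv.
have F0 : 0 < (d.+2)`!%:R :> R by rewrite ltr0n fact_gt0.
case: ifPn => h0; last by rewrite normr0 mulr_ge0 ?sqr_ge0// mulr_ge0// ltW.
have y1 : 1 <= h^-1 by rewrite invf_ge1//; rewrite gtr0_norm in h1.
rewrite normrM (ger0_norm (expR_ge0 _)).
have He : h^-1 ^+ d.+2 / (d.+2)`!%:R <= expR (h^-1).
  by apply: le_trans (expR_ge1Dxn d.+1 _); [rewrite lerDr|lra].
rewrite expRN.
apply: (@le_trans _ _ (C * h^-1 ^+ d * (expR h^-1)^-1)).
  by rewrite ler_wpM2r ?H ?invr_ge0 ?expR_ge0.
rewrite ler_pdivrMr ?expR_gt0//.
have -> : C * (h^-1 ^+ d) = C * (d.+2)`!%:R * h ^+ 2 * (h^-1 ^+ d.+2 / (d.+2)`!%:R).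
  have H2 : h ^+ 2 * h^-1 ^+ 2 = 1 by rewrite exprVn mulfV// expf_neq0// gt_eqF.
  have HF : (d.+2)`!%:R * ((d.+2)`!%:R)^-1 = 1 :> R by rewrite mulfV// gt_eqF.
  rewrite -addn2 exprD -[LHS]mulr1 -[in LHS]H2 -[LHS]mulr1 -[in LHS]HF addn2.
  by ring.
by rewrite ler_wpM2l// mulr_ge0 ?sqr_ge0// mulr_ge0// ltW.
Qed.

Lemma is_derive_inv (x : R) : x != 0 -> is_derive x 1 (fun y : R => y^-1) (- x ^- 2).
Proof.
move=> x0; have := @is_deriveV R (fun y => y) x 1 1 x0 (is_derive_id _ _).
by rewrite scalarE mulr1.
Qed.

(** For x > 0, differentiating p(1/x) exp(-1/x) gives x^(-2) (p - p')(1/x) exp(-1/x), whence the new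
    polynomial. At 0 the two branches are glued by the quadratic bound. *)
Lemma is_derive_expinv p x :
  is_derive x 1 (expinv p) (expinv ('X^2 * (p - p^`())) x).
Proof.
have [x0|x0|->] := ltgtP x 0.
- apply: (@near_eq_is_derive _ _ _ (fun=> 0)).
    near=> y; rewrite /expinv ifF//; apply/negbTE; rewrite -leNgt ltW//.
    by near: y; exact: lt_nbhsl.
  by rewrite /expinv ifF ?ltNge ?ltW//; apply: is_derive_cst.
- pose F0 : R -> R := fun y => p.[y^-1] * expR (- y^-1).
  apply: (@near_eq_is_derive _ _ _ F0).
    near=> y; rewrite /F0 /expinv ifT//; near: y; exact: lt_nbhsr.
  rewrite /expinv x0.
  have xN0 : x != 0 by rewrite gt_eqF.
  have iV := is_derive_inv x xN0.
  have hp : is_derive (x^-1) 1 (horner p) (p^`()).[x^-1].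
    apply: DeriveDef; first exact: derivable_horner.
    by rewrite -derive1E derivE.
  have i1 : is_derive x 1 (fun y => p.[y^-1]) ((p^`()).[x^-1] * (- x ^- 2)).
    exact: (@is_derive1_comp R (horner p) (fun y => y^-1) x _ _ hp iV).
  have he : is_derive (- x^-1) 1 (@expR R) (expR (- x^-1)).
    exact: is_derive_expR.
  have iN : is_derive x 1 (fun y : R => - y^-1) (- - x ^- 2) by exact: is_deriveN.
  have i2 : is_derive x 1 (fun y => expR (- y^-1)) (expR (- x^-1) * (- - x ^- 2)).
    exact: (@is_derive1_comp R expR (fun y => - y^-1) x _ _ he iN).
  have := @is_deriveM R R (fun y => p.[y^-1]) (fun y => expR (- y^-1)) x 1 _ _ i1 i2.
  rewrite !scalarE.
  have -> // : p.[x^-1] * (expR (- x^-1) * - - x ^- 2) + expR (- x^-1) * ((p^`()).[x^-1] * - x ^- 2) = ('X^2 * (p - p^`())).[x^-1] * expR (- x^-1).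
  rewrite hornerM hornerXn hornerD hornerN exprVn; ring.
- have [C H] := expinv_bound p.
  rewrite [in X in is_derive _ _ _ X]/expinv ltxx.
  by apply: (is_derive_sq _ C) => //; rewrite /expinv ltxx.
Unshelve. all: by end_near. Qed.

Lemma nder_expinv n p : nder n (expinv p).
Proof.
elim: n p => [//|n IH] p; exists (expinv ('X^2 * (p - p^`()))); split => //.
exact: is_derive_expinv.
Qed.

Lemma smooth_step : exists S dS : R -> R, [/\ forall n, nder n S,
  (forall x, is_derive x 1 S (dS x)) /\ continuous dS,
  (forall x, x <= 0 -> S x = 0) /\ (forall x, 1 <= x -> S x = 1),
  forall x, (x <= 0) || (1 <= x) -> dS x = 0 &
  (forall x, 0 <= S x <= 1) /\ exists2 K, 0 < K & forall x, `|dS x| <= K].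
Proof.
pose e := expinv 1.
have e_ge0 x : 0 <= e x.
  by rewrite /e /expinv; case: ifP => // _; rewrite hornerE mul1r expR_ge0.
have e_gt0 x : 0 < x -> 0 < e x.
  by move=> x0; rewrite /e /expinv x0 hornerE mul1r expR_gt0.
have e_eq0 x : x <= 0 -> e x = 0 by rewrite leNgt /e /expinv => /negbTE ->.
(* The classical quotient e(x) / (e(x) + e(1 - x)); its denominator never vanishes since x and 1 - x
   are not both nonpositive. *)
pose g x := e x + e ((-1) * x + 1).
have g_gt0 x : 0 < g x.
  rewrite /g; have [x0|x0] := ltP 0 x; first by rewrite ltr_pwDl ?e_gt0.
  by rewrite ltr_wpDl ?e_gt0//; lra.
pose S x := e x * (g x)^-1.
have Sn n : nder n S.
  apply: (nderM _ e (fun x => (g x)^-1)); first exact: nder_expinv.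
  apply: nderV; first by move=> x; rewrite gt_eqF.
  apply: (nderD _ e (fun x => e ((-1) * x + 1))); first exact: nder_expinv.
  by apply: nder_aff; exact: nder_expinv.
(* Two orders are unfolded so that [dS] is itself differentiable, hence continuous. *)
have [dS [SdS [ddS [dSd _]]]] := Sn 2%N.
have dSc : continuous dS.
  move=> x; apply: differentiable_continuous; apply/derivable1_diffP.
  by case: (dSd x).
have S0 x : x <= 0 -> S x = 0 by move=> x0; rewrite /S e_eq0// mul0r.
have S1 x : 1 <= x -> S x = 1.
  move=> x1; rewrite /S /g (e_eq0 (-1 * x + 1)); last lra.
  by rewrite addr0 divff// gt_eqF// e_gt0//; lra.
have S01 x : 0 <= S x <= 1.
  rewrite /S divr_ge0 ?(ltW (g_gt0 _))//= ler_pdivrMr// mul1r.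
  by rewrite /g lerDl e_ge0.
(* The points 0 and 1 are included: [S] attains its minimum at each x <= 0 and its maximum at each x
   >= 1, so the derivative vanishes there. *)
have dS0 x : (x <= 0) || (1 <= x) -> dS x = 0.
  have ab : x - 1 <= x + 1 by lra.
  have xab : x \in `]x - 1, x + 1[ by rewrite in_itv/=; apply/andP; split; lra.
  have dab (t : R) : t \in `]x - 1, x + 1[ -> derivable S t 1 by case: (SdS t).
  rewrite -(@derive_val _ _ _ _ _ _ _ (SdS x)).
  case/orP => hx.
    apply: derive_val; apply: (derive1_at_min ab dab xab) => t _.
    by rewrite S0//; case/andP: (S01 t).
  apply: derive_val; apply: (derive1_at_max ab dab xab) => t _.
  by rewrite (S1 x)//; case/andP: (S01 t).
exists S, dS; split => //; split => //.
have nc : {within `[0, 1], continuous (fun x => `|dS x|)}.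
  apply: continuous_subspaceT => x.
  by apply: continuous_comp; [exact: dSc|exact: norm_continuous].
have [c _ cmax] := EVT_max (@ler01 R) nc.
exists (`|dS c| + 1); first by rewrite ltr_wpDl.
move=> x; have [x01|] := boolP (x \in `[0, 1]).
  by rewrite (le_trans (cmax _ x01))// lerDl.
rewrite in_itv/= negb_and -!ltNge => xN.
rewrite dS0 ?normr0 ?addr_ge0//.
by case/orP: xN => /ltW ->; rewrite ?orbT.
Qed.

End SmoothStep.

Set Implicit Arguments.
Unset Strict Implicit.
Unset Printing Implicit Defensive.

Notation itg mu D f := (mu.-integrable D (EFin \o f)).

(** * Integrability and integrals of real-valued functions, with the Cauchy-Schwarz inequality *)

Section Integrability.
Context {d} {T : measurableType d} {R : realType}.
Variable mu : {measure set T -> \bar R}.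
Variable D : set T.
Hypothesis mD : measurable D.
Implicit Types f g h : T -> R.

Lemma itg_meas f : itg mu D f -> measurable_fun D f.
Proof. by move=> /integrableP[/measurable_EFinP]. Qed.

Lemma itg_le f g : measurable_fun D f -> (forall x, D x -> `|f x| <= g x) ->
  itg mu D g -> itg mu D f.
Proof.
move=> mf fg; apply: le_integrable => //; first exact/measurable_EFinP.
by move=> x Dx /=; rewrite lee_fin (le_trans (fg _ Dx))// ler_norm.
Qed.

Lemma itgD f g : itg mu D f -> itg mu D g -> itg mu D (fun x => f x + g x).
Proof. by move=> fi gi; have := (integrableD mD fi gi); apply: eq_integrable. Qed.

Lemma itgB f g : itg mu D f -> itg mu D g -> itg mu D (fun x => f x - g x).
Proof. by move=> fi gi; have := (integrableB mD fi gi); apply: eq_integrable. Qed.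

Lemma itgZ (k : R) f : itg mu D f -> itg mu D (fun x => k * f x).
Proof. by move=> fi; have := (integrableZl mD k fi); apply: eq_integrable. Qed.

Lemma itgabs f : itg mu D f -> itg mu D (fun x => `|f x|).
Proof.
by move=> fi; have := integrable_abse fi; apply: eq_integrable.
Qed.

Lemma itgMb (K : R) f g : itg mu D f -> measurable_fun D g ->
  (forall x, D x -> `|g x| <= K) -> itg mu D (fun x => f x * g x).
Proof.
move=> fi mg gK; apply: (@itg_le _ (fun x => K * `|f x|)).
- by apply: measurable_funM => //; exact: itg_meas.
- by move=> x Dx; rewrite normrM mulrC ler_wpM2r// gK.
- by apply: itgZ; exact: itgabs.
Qed.

Lemma itgM2 f g : measurable_fun D f -> measurable_fun D g ->
  itg mu D (fun x => f x ^+ 2) -> itg mu D (fun x => g x ^+ 2) ->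
  itg mu D (fun x => f x * g x).
Proof.
move=> mf mg f2 g2; apply: (@itg_le _ (fun x => f x ^+ 2 + g x ^+ 2)).
- exact: measurable_funM.
- move=> x _; rewrite normrM -(real_normK (num_real (f x))).
  rewrite -(real_normK (num_real (g x))).
  have := normr_ge0 (f x); have := normr_ge0 (g x); nra.
- exact: itgD.
Qed.

Lemma itgD2 f g : measurable_fun D f -> measurable_fun D g ->
  itg mu D (fun x => f x ^+ 2) -> itg mu D (fun x => g x ^+ 2) ->
  itg mu D (fun x => (f x + g x) ^+ 2).
Proof.
move=> mf mg f2 g2; apply: (@itg_le _ (fun x => 2 * f x ^+ 2 + 2 * g x ^+ 2)).
- by apply: measurable_funX; exact: measurable_funD.
- move=> x _; rewrite ger0_norm ?sqr_ge0//.
  by have := sqr_ge0 (f x - g x); have := sqr_ge0 (f x + g x); nra.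
- by apply: itgD; apply: itgZ.
Qed.

Lemma itgB2 f g : measurable_fun D f -> measurable_fun D g ->
  itg mu D (fun x => f x ^+ 2) -> itg mu D (fun x => g x ^+ 2) ->
  itg mu D (fun x => (f x - g x) ^+ 2).
Proof.
move=> mf mg f2 g2; apply: (@itg_le _ (fun x => 2 * f x ^+ 2 + 2 * g x ^+ 2)).
- by apply: measurable_funX; exact: measurable_funB.
- move=> x _; rewrite ger0_norm ?sqr_ge0//.
  by have := sqr_ge0 (f x - g x); have := sqr_ge0 (f x + g x); nra.
- by apply: itgD; apply: itgZ.
Qed.

Lemma itg_lty f : measurable_fun D f -> (forall x, D x -> 0 <= f x) ->
  (\int[mu]_(x in D) (f x)%:E < +oo)%E -> itg mu D f.
Proof.
move=> mf f0 foo; apply/integrableP; split; first exact/measurable_EFinP.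
rewrite (eq_integral (fun x => (f x)%:E))// => x /set_mem Dx /=.
by rewrite ger0_norm// f0.
Qed.

Lemma Rint_EFin f : itg mu D f ->
  (\int[mu]_(x in D) f x)%R%:E = (\int[mu]_(x in D) (f x)%:E)%E.
Proof. by move=> fi; rewrite /Rintegral fineK//; exact: integrable_fin_num. Qed.

Lemma Rint_ae f g : measurable_fun D f -> measurable_fun D g ->
  {ae mu, forall x, D x -> f x = g x} ->
  \int[mu]_(x in D) f x = \int[mu]_(x in D) g x.
Proof.
move=> mf mg fg; rewrite /Rintegral; congr fine; apply: ae_eq_integral => //.
- exact/measurable_EFinP.
- exact/measurable_EFinP.
- by apply: filterS fg => x /= + Dx => ->.
Qed.

Lemma itg_ae f g : measurable_fun D g ->
  {ae mu, forall x, D x -> f x = g x} -> itg mu D f -> itg mu D g.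
Proof.
move=> mg fg /integrableP[mf foo]; apply/integrableP.
split; first exact/measurable_EFinP.
apply: le_lt_trans foo; rewrite le_eqVlt; apply/orP; left; apply/eqP.
apply: ae_eq_integral => //.
- by apply: measurableT_comp => //; exact/measurable_EFinP.
- exact: measurableT_comp.
- by apply: filterS fg => x /= + Dx => ->.
Qed.

Lemma RintZ (k : R) f : itg mu D f ->
  \int[mu]_(x in D) (k * f x) = k * \int[mu]_(x in D) f x.
Proof. by move=> fi; rewrite RintegralZl. Qed.

Lemma Rint_abs_le f g : itg mu D f -> itg mu D g ->
  (forall x, D x -> `|f x| <= g x) ->
  `|\int[mu]_(x in D) f x| <= \int[mu]_(x in D) g x.
Proof.
move=> fi gi fg; rewrite (le_trans (le_normr_Rintegral mD fi))//.
by apply: le_Rintegral => //; exact: itgabs.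
Qed.

Lemma cauchy_schwarz f g : measurable_fun D f -> measurable_fun D g ->
  itg mu D (fun x => f x ^+ 2) -> itg mu D (fun x => g x ^+ 2) ->
  (\int[mu]_(x in D) (f x * g x)) ^+ 2 <=
  \int[mu]_(x in D) (f x ^+ 2) * \int[mu]_(x in D) (g x ^+ 2).
Proof.
move=> mf mg f2 g2; have fg := itgM2 mf mg f2 g2.
set A := \int[mu]_(x in D) (f x ^+ 2); set B := \int[mu]_(x in D) (g x ^+ 2).
set P := \int[mu]_(x in D) (f x * g x).
have A0 : 0 <= A by apply: Rintegral_ge0 => x _; exact: sqr_ge0.
have H (s t : R) : 0 <= s ^+ 2 * A + 2 * s * t * P + t ^+ 2 * B.
  rewrite /A /P /B -!RintZ// -RintegralD//; [|exact: itgZ|exact: itgZ].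
  rewrite -RintegralD//; [|by apply: itgD; exact: itgZ|exact: itgZ].
  by apply: Rintegral_ge0 => x _; have := sqr_ge0 (s * f x + t * g x); nra.
(* For A > 0, evaluating the nonnegative quadratic form [H] at (P, -A) yields A (A B - P^2) >= 0. *)
have [A1|A1] := ltP 0 A.
  have := H P (- A).
  have -> : P ^+ 2 * A + 2 * P * - A * P + (- A) ^+ 2 * B = A * (A * B - P ^+ 2) by ring.
  by rewrite pmulr_rge0// subr_ge0.
have -> : A = 0 by lra.
have [->|P0] := eqVneq P 0; first by rewrite expr0n mul0r.
(* For A = 0 the form is affine in [s]; if P were nonzero, this [s] would give the negative value -
   B - 2. *)
have := H (- (B + 1) / P) 1; have -> : A = 0 by lra.
have -> : 2 * (- (B + 1) / P) * 1 * P = - 2 * (B + 1) by field.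
have B0 : 0 <= B by apply: Rintegral_ge0 => x _; exact: sqr_ge0.
by rewrite mulr0 add0r expr1n mul1r; lra.
Qed.

Lemma Rint_dct (f_ : nat -> T -> R) f g : (forall n, measurable_fun D (f_ n)) ->
  measurable_fun D f -> (forall x, D x -> f_ ^~ x @ \oo --> f x) ->
  itg mu D g -> (forall n x, D x -> `|f_ n x| <= g x) ->
  (fun n => \int[mu]_(x in D) f_ n x) @ \oo --> \int[mu]_(x in D) f x.
Proof.
move=> mf_ mf ff gi fg.
have ff' : {ae mu, forall x, D x -> (fun n => (f_ n x)%:E) @ \oo --> (f x)%:E}.
  apply: aeW => x Dx; apply/fine_cvgP; split; first exact: nearW.
  exact: ff.
have fg' : {ae mu, forall x n, D x -> (`|(f_ n x)%:E| <= (EFin \o g) x)%E}.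
  by apply: aeW => x n Dx; rewrite /= lee_fin fg.
have mf_E n : measurable_fun D (fun x => (f_ n x)%:E) by exact/measurable_EFinP.
have mfE : measurable_fun D (fun x => (f x)%:E) by exact/measurable_EFinP.
have [fi _ H] := dominated_convergence mD mf_E mfE ff' gi fg'.
by apply: fine_cvg; rewrite Rint_EFin.
Qed.

Lemma Rint_supp (E : set T) f : E `<=` D -> (forall x, D x -> ~ E x -> f x = 0) ->
  \int[mu]_(x in D) f x = \int[mu]_(x in E) f x.
Proof.
move=> ED f0; rewrite Rintegral_mkcond [RHS]Rintegral_mkcond.
apply: eq_Rintegral => x _; rewrite !patchE.
have [xE|xE] := boolP (x \in E).
  by rewrite mem_set//; exact/ED/set_mem.
case: ifPn => // /set_mem Dx; apply: f0 => // Ex.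
by move: xE; rewrite mem_set.
Qed.

End Integrability.

(** * Integrals over real intervals *)

Section Intervals.
Context {R : realType}.
Local Notation mu := (@lebesgue_measure R).
Implicit Types f g : R -> R.

Lemma itg_sub (D E : set R) f : measurable D -> measurable E -> E `<=` D ->
  itg mu D f -> itg mu E f.
Proof. by move=> mD mE ED; exact: integrableS. Qed.

Lemma Rint_split f (p m q : R) : p <= m -> m <= q -> itg mu `[p, q] f ->
  \int[mu]_(x in `[p, q]) f x =
  \int[mu]_(x in `[p, m]) f x + \int[mu]_(x in `[m, q]) f x.
Proof.
move=> pm mq fi; have := @Rintegral_itvB R f (BLeft p) (BRight q) m fi.
rewrite !bnd_simp => /(_ pm mq) /eqP; rewrite subr_eq => /eqP ->.
rewrite addrC; congr (_ + _); rewrite Rintegral_itv_obnd_cbnd//.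
apply: integrableS fi => //; apply: subset_itv; rewrite bnd_simp//.
Qed.

Lemma itg_cst (p q k : R) : itg mu `[p, q] (fun=> k).
Proof.
apply: continuous_compact_integrable; first exact: segment_compact.
by apply: continuous_subspaceT => x; exact: cst_continuous.
Qed.

Lemma Rint_cst (p q k : R) : p <= q -> \int[mu]_(x in `[p, q]) k = k * (q - p).
Proof.
move=> pq; rewrite Rintegral_cst//= lebesgue_measure_itv/= lte_fin.
by case: ltP => //= qp; congr (_ * _); lra.
Qed.

Lemma Rint_oo_cc (p q : R) f : itg mu `[p, q] f ->
  \int[mu]_(x in `]p, q[) f x = \int[mu]_(x in `[p, q]) f x.
Proof.
move=> fi; rewrite Rintegral_itv_bndo_bndc; last first.
  by apply: integrableS fi => //; exact: subset_itv_oo_cc.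
rewrite Rintegral_itv_obnd_cbnd//.
by apply: integrableS fi => //; apply: subset_itv; rewrite bnd_simp.
Qed.

Lemma itg_oo_cc (p q : R) f : itg mu `]p, q[ f -> itg mu `[p, q] f.
Proof.
move=> fi; have mf : measurable_fun `]p, q[ (EFin \o f) by case/integrableP : fi.
apply/integrableP; split; first exact: emeasurable_fun_itv_cc mf.
rewrite integral_itv_bndoo//; first by case/integrableP : fi.
exact: measurableT_comp.
Qed.

Lemma Rint_nil (p q : R) f : q <= p -> \int[mu]_(x in `[p, q]) f x = 0.
Proof.
rewrite le_eqVlt => /predU1P[->|qp].
  by rewrite set_itv1 Rintegral_set1.
by rewrite set_itv_ge ?Rintegral_set0// bnd_simp -ltNge.
Qed.

Lemma FTC2 (F f : R -> R) (p q : R) : p <= q -> (forall x : R, is_derive x (1 : R) F (f x)) ->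
  continuous f -> \int[mu]_(x in `[p, q]) f x = F q - F p.
Proof.
rewrite le_eqVlt => /predU1P[->|pq] dF cf.
  by rewrite Rint_nil// subrr.
have cF x : {for x, continuous F}.
  by apply: differentiable_continuous; apply/derivable1_diffP; case: (dF x).
rewrite /Rintegral (@continuous_FTC2 R f F p q pq)//.
- exact: continuous_subspaceT.
- by split=> [x _||]; [case: (dF x)|apply: cvg_at_right_filter; exact: cF|
    apply: cvg_at_left_filter; exact: cF].
- by move=> x _; rewrite derive1E; apply: derive_val.
Qed.

End Intervals.

(** * The fundamental theorem of calculus for weak derivatives, at Lebesgue points *)

Section WeakFTC.
Context {R : realType}.
Local Notation mu := (@lebesgue_measure R).
Implicit Types (U W : R -> R) (s t b : R).

(** One-sided and along the lengths 1/(n+1) only, to match the support [[s, s + 1/(n+1)]] of the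
    mollifying kernels. *)
Definition right_lebesgue_pt U s := (fun n : nat =>
  n.+1%:R * \int[mu]_(x in `[s, s + n.+1%:R^-1]) `|U x - U s|) @ \oo --> (0 : R).

Lemma near_invS (e : R) : 0 < e -> \forall n \near \oo, n.+1%:R^-1 <= e.
Proof.
move=> e0; near=> n; rewrite -[leRHS]invrK lef_pV2 ?posrE ?invr_gt0//.
rewrite -natr1 (@le_trans _ _ n%:R) ?lerDl//.
by near: n; exact: nbhs_infty_ger.
Unshelve. all: by end_near. Qed.

Section Kernel.
Variables (S dS : R -> R) (K : R).
Hypotheses (SdS : forall x, is_derive x (1 : R) S (dS x)) (cdS : continuous dS).
Hypotheses (S0 : forall x : R, x <= 0 -> S x = 0) (S1 : forall x, 1 <= x -> S x = 1).
Hypothesis dS0 : forall x : R, (x <= 0) || (1 <= x) -> dS x = 0.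
Hypothesis dSK : forall x, `|dS x| <= K.

(** The derivative in [r] of [S] rescaled to climb from 0 to 1 on [[s, s + 1/(n+1)]], hence an
    approximate identity to the right of [s]. *)
Let ker s n (r : R) : R := n.+1%:R * dS (n.+1%:R * r + - (n.+1%:R * s)).

Let ker_derive s n r :
  is_derive r (1 : R) (fun r => S (n.+1%:R * r + - (n.+1%:R * s))) (ker s n r).
Proof. by apply: is_derive_aff. Qed.

Let ker_cont s n : continuous (ker s n).
Proof.
move=> r; apply: cvgM; first exact: cvg_cst.
apply: (@continuous_comp _ _ _ (fun r : R => n.+1%:R * r + - (n.+1%:R * s)) dS);
  last exact: cdS.
by apply: cvgD; [apply: cvgM; [exact: cvg_cst|exact: cvg_id]|exact: cvg_cst].
Qed.

Let ker_meas s n D : measurable_fun D (ker s n).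
Proof.
apply: measurable_funS (continuous_measurable_fun _) => //; exact: ker_cont.
Qed.

Let ker_bound s n r : `|ker s n r| <= n.+1%:R * K.
Proof. by rewrite normrM ger0_norm// ler_wpM2l. Qed.

(** The kernel has mass one and size at most (n+1) K on an interval of length 1/(n+1), so the error
    is at most K times the mean oscillation of [U] to the right of [s]. *)
Lemma kernel_right_lebesgue_pt U s b : s < b -> itg mu `[s, b] U ->
  right_lebesgue_pt U s ->
  (fun n => \int[mu]_(r in `[s, b]) (U r * ker s n r)) @ \oo --> U s.
Proof.
move=> sb Ui Us; apply/cvgrPdist_le => e e0.
have K0 : 0 <= K by apply: le_trans (@dSK 0).
near=> n.
have nb : n.+1%:R^-1 <= b - s.
  by near: n; apply: near_invS; rewrite subr_gt0.
have N0 : 0 < n.+1%:R :> R by rewrite ltr0n.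
have mb : measurable `[s, b] by [].
have I1 : \int[mu]_(r in `[s, b]) ker s n r = 1.
  rewrite (@FTC2 _ (fun r => S (n.+1%:R * r + - (n.+1%:R * s))) (ker s n) _ _ (ltW sb) (ker_derive s n) (@ker_cont s n)).
  rewrite addrN (@S0 0)// subr0 S1// -mulrBr -ler_pdivrMl// mulr1//.
have iker : itg mu `[s, b] (ker s n).
  apply: continuous_compact_integrable; first exact: segment_compact.
  by apply: continuous_subspaceT => x; exact: ker_cont.
have iUk : itg mu `[s, b] (fun r => U r * ker s n r).
  apply: (itgMb (K := n.+1%:R * K) _ Ui) => //; first exact: ker_meas.
have -> : U s - \int[mu]_(r in `[s, b]) (U r * ker s n r) =
    \int[mu]_(r in `[s, b]) ((U s - U r) * ker s n r).
  rewrite -[X in X - _]mulr1 -I1 -RintZ// -RintegralB//; last exact: itgZ.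
  by apply: eq_Rintegral => x _; rewrite mulrBl.
have iD : itg mu `[s, b] (fun r => U s - U r) by apply: itgB => //; exact: itg_cst.
have iDk : itg mu `[s, b] (fun r => (U s - U r) * ker s n r).
  apply: (itgMb (K := n.+1%:R * K) _ iD) => //; first exact: ker_meas.
rewrite (@Rint_split _ _ _ (s + n.+1%:R^-1))//; last 2 first.
  by rewrite lerDl.
  by rewrite -lerBrDl.
rewrite [X in _ + X](_ : _ = 0) ?addr0; last first.
  rewrite (@eq_Rintegral _ _ _ mu _ (fun=> 0)).
    by rewrite Rintegral_cst// mul0r.
  move=> x; rewrite inE/= in_itv/= => /andP[x1 x2].
  rewrite /ker dS0 ?mulr0//; apply/orP; right.
  by rewrite -mulrBr -ler_pdivrMl// mulr1 lerBrDl.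
have sub : `[s, s + n.+1%:R^-1] `<=` `[s, b].
  by apply: subset_itvl; rewrite bnd_simp -lerBrDl.
have iD' := itg_sub mb (measurable_itv _) sub iD.
have iU' : itg mu `[s, s + n.+1%:R^-1] (fun r => `|U r - U s|).
  apply: itgabs => //; apply: itg_sub sub _ => //.
  by apply: itgB => //; exact: itg_cst.
apply: le_trans.
  apply: (@Rint_abs_le _ _ _ mu _ _ _ (fun r => n.+1%:R * K * `|U r - U s|)).
  - by [].
  - exact: itg_sub sub iDk.
  - exact: itgZ.
  - move=> x _; rewrite normrM mulrC distrC ler_wpM2r//.
rewrite RintZ// mulrAC.
have H : n.+1%:R * \int[mu]_(x in `[s, s + n.+1%:R^-1]) `|U x - U s| <= e / (K + 1).
  apply: le_trans (ler_norm _) _; rewrite -normrN -sub0r.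
  near: n; move/cvgrPdist_le : Us; apply.
  by rewrite divr_gt0// ltr_wpDl.
have K1 : 0 < K + 1 by rewrite ltr_wpDl.
rewrite ler_pdivlMr// mulrDr mulr1 in H.
have J0 : 0 <= n.+1%:R * \int[mu]_(x in `[s, s + n.+1%:R^-1]) `|U x - U s|.
  by rewrite mulr_ge0// Rintegral_ge0.
by apply: le_trans H; rewrite lerDl.
Unshelve. all: by end_near. Qed.

End Kernel.

(** The test function is a smooth approximation of the indicator of [s,t], the difference of the
    steps at [s] and at [t]. Its derivative is a difference of two kernels and recovers U(s) - U(t).
    The point [b] leaves room to the right of [t] for the second ramp. *)
Lemma weak_FTC t0 t1 s t b U W : t0 < s -> s < t -> t < b -> b < t1 ->
  itg mu `[s, b] U -> itg mu `[s, b] W ->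
  (forall th, test_fun t0 t1 th ->
    \int[mu]_(r in `]t0, t1[) (U r * derive1 th r) =
    - \int[mu]_(r in `]t0, t1[) (W r * th r)) ->
  right_lebesgue_pt U s -> right_lebesgue_pt U t ->
  U t - U s = \int[mu]_(r in `[s, t]) W r.
Proof.
move=> t0s st tb bt1 Ui Wi UW Us Ut.
have [S [dS [Sn [SdS cdS] [S0 S1] dS0 [S01 [K K0 dSK]]]]] := @smooth_step R.
have K0' : 0 <= K by exact: ltW.
pose St (p : R) n (r : R) := S (n.+1%:R * r + - (n.+1%:R * p)).
pose ker (p : R) n (r : R) : R := n.+1%:R * dS (n.+1%:R * r + - (n.+1%:R * p)).
pose th n r := St s n r + (-1) * St t n r.
have Std p n (r : R) : is_derive r (1 : R) (St p n) (ker p n r).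
  exact: is_derive_aff.
have kc p n : continuous (ker p n).
  move=> r; apply: cvgM; first exact: cvg_cst.
  apply: (@continuous_comp _ _ _ (fun r : R => n.+1%:R * r + - (n.+1%:R * p)) dS);
    last exact: cdS.
  by apply: cvgD; [apply: cvgM; [exact: cvg_cst|exact: cvg_id]|exact: cvg_cst].
have Stc p n : continuous (St p n).
  move=> r; apply: differentiable_continuous; apply/derivable1_diffP.
  by case: (Std p n r).
have dth n r : derive1 (th n) r = ker s n r - ker t n r.
  rewrite derive1E; apply: derive_val.
  have -> : ker s n r - ker t n r = ker s n r + (-1 : R) *: (ker t n r : R^o).
    by rewrite scalarE mulN1r.
  by apply: is_deriveD; apply: is_deriveZ.
have St0 p n r : r <= p -> St p n r = 0.
  by move=> rp; rewrite /St S0// -mulrBr mulr_ge0_le0// subr_le0.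
have St1 p n r : p + n.+1%:R^-1 <= r -> St p n r = 1.
  by move=> rp; rewrite /St S1// -mulrBr -ler_pdivrMl// mulr1 lerBrDl.
have ker0 p n r : r <= p \/ p + n.+1%:R^-1 <= r -> ker p n r = 0.
  case=> rp; rewrite /ker dS0 ?mulr0//; apply/orP.
    by left; rewrite -mulrBr mulr_ge0_le0// subr_le0.
  by right; rewrite -mulrBr -ler_pdivrMl// mulr1 lerBrDl.
have th01 n r : `|th n r| <= 1.
  rewrite ler_norml /th mulN1r; have /andP[a1 a2] := S01 (n.+1%:R * r + - (n.+1%:R * s)).
  have /andP[b1 b2] := S01 (n.+1%:R * r + - (n.+1%:R * t)); rewrite /St.
  by apply/andP; clear -a1 a2 b1 b2; split; lra.
have thc n : continuous (th n).
  move=> r; apply: cvgD; first exact: Stc.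
  by apply: cvgM; [exact: cvg_cst|exact: Stc].
have mth n D : measurable_fun D (th n).
  by apply: measurable_funS (continuous_measurable_fun (thc n)).
have sb : s < b by exact: lt_trans tb.
have Ui' : itg mu `[t, b] U.
  by apply: itg_sub Ui => //; apply: subset_itvr; rewrite bnd_simp ltW.
have L1 := kernel_right_lebesgue_pt SdS cdS S0 S1 dS0 dSK sb Ui Us.
have L2 := kernel_right_lebesgue_pt SdS cdS S0 S1 dS0 dSK tb Ui' Ut.
have st' := ltW st; have tb' := ltW tb.
have Wst : itg mu `[s, t] W by apply: itg_sub Wi => //; exact: subset_itvl.
have Wtb : itg mu `[t, b] W by apply: itg_sub Wi => //; exact: subset_itvr.
have Wst' : itg mu `]s, t[ W by apply: itg_sub Wst => //; exact: subset_itv_oo_cc.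
have Wtb' : itg mu `]t, b[ W by apply: itg_sub Wtb => //; exact: subset_itv_oo_cc.
have L3 : (fun n => \int[mu]_(r in `]s, t[) (W r * th n r)) @ \oo -->
    \int[mu]_(r in `]s, t[) W r.
  apply: (Rint_dct _ _ _ _ (itgabs _ Wst')) => //.
  - by move=> n; apply: measurable_funM; [exact: itg_meas Wst'|exact: mth].
  - exact: itg_meas Wst'.
  - move=> r /=; rewrite in_itv/= => /andP[sr rt].
    apply: cvg_near_cst; near=> n.
    rewrite /th St1 ?St0 ?mulr0 ?addr0 ?mulr1 ?(ltW rt)//.
    by rewrite -lerBrDl; near: n; apply: near_invS; rewrite subr_gt0.
  - by move=> n r _; rewrite normrM ler_piMr.
(* Beyond [t] both steps are eventually 1, so their difference tends to 0 there. *)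
have L4 : (fun n => \int[mu]_(r in `]t, b[) (W r * th n r)) @ \oo -->
    \int[mu]_(r in `]t, b[) (0 : R).
  apply: (Rint_dct _ _ _ _ (itgabs _ Wtb')) => //.
  - by move=> n; apply: measurable_funM; [exact: itg_meas Wtb'|exact: mth].
  - move=> r /=; rewrite in_itv/= => /andP[tr rb].
    apply: cvg_near_cst; near=> n.
    have nt : t + n.+1%:R^-1 <= r.
      by rewrite -lerBrDl; near: n; apply: near_invS; rewrite subr_gt0.
    rewrite /th !St1 ?mulr1 ?subrr ?mulr0//.
    by rewrite (le_trans _ nt)// lerD2r.
  - by move=> n r _; rewrite normrM ler_piMr.
(* Once the ramp at [t] ends before [b], [th n] is an admissible test function supported in [s,b],
   and the weak identity splits at [t]. *)
have E : \forall n \near \oo,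
    \int[mu]_(r in `[s, b]) (U r * ker s n r)
    - \int[mu]_(r in `[t, b]) (U r * ker t n r) =
    - (\int[mu]_(r in `]s, t[) (W r * th n r) + \int[mu]_(r in `]t, b[) (W r * th n r)).
  near=> n.
  have nb : t + n.+1%:R^-1 <= b.
    by rewrite -lerBrDl; near: n; apply: near_invS; rewrite subr_gt0.
  have th0 r : ~ (`[s, b]%classic r) -> th n r = 0 /\ derive1 (th n) r = 0.
    rewrite /= in_itv/= => /negP; rewrite negb_and -!ltNge dth /th => /orP[rs|br].
      rewrite !St0 ?(ltW rs)//; last by rewrite ltW// (lt_trans rs).
      by rewrite !ker0 ?subrr ?mulr0 ?addr0//; left; rewrite ltW// (lt_trans rs).
    have h1 : t + n.+1%:R^-1 <= r by rewrite (le_trans nb)// ltW.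
    have h2 : s + n.+1%:R^-1 <= r by rewrite (le_trans _ h1)// lerD2r.
    by rewrite !St1// !ker0 ?subrr ?mulr1 ?subrr//; right.
  have tf : test_fun t0 t1 (th n).
    split.
      apply: nder_smooth => m; apply: (@nderD R m (St s n) (fun r => -1 * St t n r)).
        exact: nder_aff.
      apply: (@nderM R m (fun=> -1) (St t n)); first exact: nder_cst.
      exact: nder_aff.
    exists s, b; split => // r /negP rsb.
    by case: (th0 r rsb).
  have sub : `[s, b] `<=` `]t0, t1[.
    by apply: subset_itv; rewrite bnd_simp.
  have := UW _ tf; rewrite (Rint_supp mu (f := fun r => U r * derive1 (th n) r) sub); last first.
    by move=> r _ /th0[_ ->]; rewrite mulr0.
  rewrite (Rint_supp mu (f := fun r => W r * th n r) sub); last first.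
    by move=> r _ /th0[-> _]; rewrite mulr0.
  have Wth : itg mu `[s, b] (fun r => W r * th n r).
    by apply: (itgMb (K := 1) _ Wi) => //; exact: mth.
  rewrite (@Rint_split _ (fun r => W r * th n r) s t b)//.
  have i1 : itg mu `[s, t] (fun r => W r * th n r).
    by apply: itg_sub Wth => //; exact: subset_itvl.
  have i2 : itg mu `[t, b] (fun r => W r * th n r).
    by apply: itg_sub Wth => //; exact: subset_itvr.
  rewrite -(Rint_oo_cc i1) -(Rint_oo_cc i2).
  move=> <-.
  have kb p r : `|ker p n r| <= n.+1%:R * K by rewrite normrM ger0_norm// ler_wpM2l.
  have mk p D : measurable_fun D (ker p n).
    by apply: measurable_funS (continuous_measurable_fun (@kc p n)).
  have ik p : itg mu `[s, b] (fun r => U r * ker p n r).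
    by apply: (itgMb (K := n.+1%:R * K) _ Ui) => //; exact: mk.
  have -> : \int[mu]_(r in `[s, b]) (U r * derive1 (th n) r) =
      \int[mu]_(r in `[s, b]) (U r * ker s n r - U r * ker t n r).
    by apply: eq_Rintegral => r _; rewrite dth mulrBr.
  rewrite RintegralB//; congr (_ - _).
  apply: esym; apply: Rint_supp; first by apply: subset_itvr; rewrite bnd_simp.
  move=> r; rewrite /= !in_itv/= => /andP[_ rb]; rewrite rb andbT => /negP.
  by rewrite -ltNge => rt; rewrite ker0 ?mulr0//; left; exact: ltW.
have L12 := cvgB L1 L2.
have L34 := cvgN (cvgD L3 L4).
have L12' : (fun n => - (\int[mu]_(r in `]s, t[) (W r * th n r) +
    \int[mu]_(r in `]t, b[) (W r * th n r))) @ \oo --> U s - U t.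
  exact: (cvg_trans (near_eq_cvg E) (L12 _)).
have H := cvg_unique (@norm_hausdorff _ _) L12' (L34 _ _).
move: H; rewrite Rintegral_cst// mul0r addr0 Rint_oo_cc// => H.
by rewrite -[RHS]opprK -H opprB.
Unshelve. all: by end_near. Qed.

End WeakFTC.

(** * Induction along a real interval *)

Section Chain.
Context {R : realType}.

(** Let c be the supremum of the points t with [P p t]. The local hypothesis at c joins a point just
    below c to min(c + e/2, q), which would exceed c unless c = q. *)
Lemma interval_chain (P : R -> R -> Prop) (p q : R) : p <= q ->
  (forall s, P s s) -> (forall s t u, s <= t -> t <= u -> P s t -> P t u -> P s u) ->
  (forall t0, p <= t0 <= q -> exists2 e, 0 < e & forall s t,
     p <= s -> s <= t -> t <= q -> `|s - t0| < e -> `|t - t0| < e -> P s t) ->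
  P p q.
Proof.
move=> pq Pss Pcat Ploc.
pose A := [set t | p <= t <= q /\ P p t].
have Ap : A p by split => //; rewrite lexx.
have Aq : has_ubound A by exists q => t [/andP[]].
have hA : has_sup A by split => //; exists p.
set c := sup A.
have pc : p <= c by exact: ub_le_sup.
have cq : c <= q by apply: ge_sup; [exists p|move=> t [/andP[]]].
have [e e0 He] := Ploc c (introT andP (conj pc cq)).
have [t [/andP[pt tq] Pt] ct] := sup_adherent e0 hA.
have tc : t <= c by apply: ub_le_sup => //; split => //; rewrite pt.
pose c' := Num.min (c + e / 2) q.
have tc' : t <= c' by rewrite le_min tq (le_trans tc)// lerDl divr_ge0// ltW.
have c'q : c' <= q by rewrite ge_min lexx orbT.
have Pc' : P p c'.
  apply: (Pcat _ t) => //; apply: He => //.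
    by rewrite ler0_norm ?subr_le0// opprB; rewrite -/c in ct; lra.
  rewrite ltr_norml; apply/andP; split.
    by rewrite -/c in ct; have := tc'; lra.
  have : c' <= c + e / 2 by rewrite ge_min lexx.
  by have : e / 2 < e by [lra]; lra.
have : c' <= c by apply: ub_le_sup => //; split => //; rewrite c'q (le_trans pt).
rewrite /c' ge_min; case: leP => [|_] ; first by lra.
move=> /= qc; have -> : q = c by apply/eqP; rewrite eq_le qc cq.
by move: Pc'; have -> : c' = c; rewrite // /c' minEle; case: ifP; lra.
Qed.

End Chain.

(** * Almost everywhere statements under the integral *)

Section AeInt.
Context {d} {T : measurableType d} {R : realType}.
Variable mu : {measure set T -> \bar R}.

Lemma ae_imp (P Q : T -> Prop) : (forall x, P x -> Q x) ->
  {ae mu, forall x, P x} -> {ae mu, forall x, Q x}.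
Proof. by move=> PQ; apply: filterS. Qed.

Lemma ae_and (P Q : T -> Prop) : {ae mu, forall x, P x} ->
  {ae mu, forall x, Q x} -> {ae mu, forall x, P x /\ Q x}.
Proof. by move=> HP HQ; apply: filterS2 HP HQ. Qed.

Lemma ae_foralln (P : nat -> T -> Prop) :
  (forall n, {ae mu, forall x, P n x}) -> {ae mu, forall x n, P n x}.
Proof.
move=> H; have := negligible_bigcup H; apply: negligibleS => x /=.
move=> /existsNP[n Pn]; by exists n.
Qed.

Lemma Rint_abs_le_ae (D : set T) (f g : T -> R) : measurable D ->
  itg mu D f -> itg mu D g -> (forall x, D x -> 0 <= g x) ->
  {ae mu, forall x, D x -> `|f x| <= g x} ->
  `|\int[mu]_(x in D) f x| <= \int[mu]_(x in D) g x.
Proof.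
move=> mD fi gi g0 fg; rewrite (le_trans (le_normr_Rintegral mD fi))//.
rewrite -lee_fin !Rint_EFin//; last exact: itgabs.
have mf : measurable_fun D (fun x => `|f x|%:E).
  by apply/measurable_EFinP; apply: measurableT_comp => //; exact: itg_meas fi.
have mg : measurable_fun D (fun x => (g x)%:E).
  by apply/measurable_EFinP; exact: itg_meas gi.
have g0' x : D x -> (0 <= (g x)%:E)%E by move=> Dx; rewrite lee_fin g0.
by apply: ae_ge0_le_integral.
Qed.

End AeInt.

(** * Differentiation along the diagonal *)

Section Diagonal.
Context {R : realType}.
Local Notation mu := (@lebesgue_measure R).

(* [B] is differentiated in each variable separately; uniformity in the other
   variable gives [d B(r,r) = (b1 + b2) dr] locally, and [interval_chain] makes
   the estimate global. *)
Lemma diag_FTC (B b1 b2 : R -> R -> R) (m : R -> R) (p q : R) : p <= q ->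
  (forall t, p <= t <= q -> itg mu `[p, q] (b1 ^~ t)) ->
  (forall s, p <= s <= q -> itg mu `[p, q] (b2 s)) ->
  (forall s s' t, p <= s -> s <= s' -> s' <= q -> p <= t <= q ->
    B s' t - B s t = \int[mu]_(r in `[s, s']) b1 r t) ->
  (forall s t t', p <= t -> t <= t' -> t' <= q -> p <= s <= q ->
    B s t' - B s t = \int[mu]_(r in `[t, t']) b2 s r) ->
  itg mu `[p, q] (fun r => b1 r r + b2 r r) ->
  itg mu `[p, q] m -> (forall r, p <= r <= q -> 0 <= m r) ->
  (forall t0 e, p <= t0 <= q -> 0 < e -> exists2 de, 0 < de &
    {ae mu, forall r, p <= r <= q -> forall t, p <= t <= q -> `|t - t0| < de ->
       `|b1 r t - b1 r t0| <= e * m r /\ `|b2 t r - b2 t0 r| <= e * m r}) ->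
  B q q - B p p = \int[mu]_(r in `[p, q]) (b1 r r + b2 r r).
Proof.
move=> pq ib1 ib2 B1 B2 ib im m0 loc.
pose be r := b1 r r + b2 r r.
(* The identity follows from an error bound proportional to an arbitrary [e]; such a bound is
   additive over adjacent intervals, as [interval_chain] requires. *)
suff H e : 0 < e -> `|B q q - B p p - \int[mu]_(r in `[p, q]) be r| <=
    e * \int[mu]_(r in `[p, q]) m r.
  apply/eqP; rewrite -subr_eq0 -normr_le0; apply/ler_addgt0Pl => e e0.
  have M0 : 0 <= \int[mu]_(r in `[p, q]) m r.
    by apply: Rintegral_ge0 => r /=; rewrite in_itv/=; exact: m0.
  have M1 : 0 < \int[mu]_(r in `[p, q]) m r + 1 by rewrite ltr_wpDl.
  rewrite addr0; apply: le_trans (H (e / (\int[mu]_(r in `[p, q]) m r + 1)) _) _.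
    by rewrite divr_gt0.
  by rewrite mulrAC ler_pdivrMr// mulrDr mulr1 lerDl ltW.
move=> e0.
pose P (s t : R) := p <= s -> t <= q ->
  `|B t t - B s s - \int[mu]_(r in `[s, t]) be r| <= e * \int[mu]_(r in `[s, t]) m r.
suff : P p q by apply.
apply: interval_chain => //.
- by move=> s _ _; rewrite !Rint_nil// mulr0 subrr subr0 normr0.
- move=> s t u st tu Pst Ptu ps uq.
  have sub : `[s, u] `<=` `[p, q] by apply: subset_itv; rewrite bnd_simp.
  have ib' : itg mu `[s, u] be by apply: itg_sub ib.
  have im' : itg mu `[s, u] m by apply: itg_sub im.
  rewrite (Rint_split st tu ib') (Rint_split st tu im') mulrDr.
  have tq : t <= q by exact: le_trans uq.
  have pt : p <= t by exact: le_trans st.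
  apply: le_trans (lerD (Pst ps tq) (Ptu pt uq)).
  by apply: le_trans (ler_normD _ _); rewrite le_eqVlt; apply/orP; left; apply/eqP;
    congr (`|_|); ring.
move=> t0 t0pq; have e4 : 0 < e / 4 by rewrite divr_gt0.
have [de de0 Hde] := loc _ _ t0pq e4; exists de => // s t ps st tq st0 tt0 _ _.
have sub : `[s, t] `<=` `[p, q] by apply: subset_itv; rewrite bnd_simp.
have spq : p <= s <= q by rewrite ps (le_trans st).
have tpq : p <= t <= q by rewrite tq (le_trans ps).
have i1 : itg mu `[s, t] (b1 ^~ t) by apply: itg_sub sub _ => //; exact: ib1.
have i2 : itg mu `[s, t] (b2 s) by apply: itg_sub sub _ => //; exact: ib2.
have i3 : itg mu `[s, t] be by apply: itg_sub sub _.
have i4 : itg mu `[s, t] m by apply: itg_sub sub _.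
(* The increment goes through B(s,t): the first variable moves with the second fixed at [t], then
   the second moves with the first fixed at [s]. *)
have -> : B t t - B s s - \int[mu]_(r in `[s, t]) be r =
    \int[mu]_(r in `[s, t]) (b1 r t + b2 s r - be r).
  rewrite RintegralB//; last exact: itgD.
  rewrite RintegralD// -(B1 s t t)//.
  by rewrite -(B2 s s t)//; ring.
rewrite -RintZ//; apply: Rint_abs_le_ae => //.
- by apply: itgB => //; exact: itgD.
- exact: itgZ.
- move=> r /sub/=; rewrite in_itv/= => rpq; rewrite mulr_ge0 ?m0// ltW//.
- apply: ae_imp Hde => r Hr /=; rewrite in_itv/= => /andP[sr rt].
  have rpq : p <= r <= q by rewrite (le_trans ps)//= (le_trans rt).
  have rt0 : `|r - t0| < de.
    move: st0 tt0; rewrite !ltr_norml => /andP[? _] /andP[_ ?].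
    by apply/andP; split; lra.
  have [h1 _] := Hr rpq t tpq tt0; have [h2 h3] := Hr rpq r rpq rt0.
  have [_ h4] := Hr rpq s spq st0.
  have -> : b1 r t + b2 s r - be r = (b1 r t - b1 r t0) - (b1 r r - b1 r t0)
     + ((b2 s r - b2 t0 r) - (b2 r r - b2 t0 r)) by rewrite /be; ring.
  apply: le_trans (ler_normD _ _) _.
  apply: le_trans (lerD (ler_normB _ _) (ler_normB _ _)) _.
  apply: le_trans (lerD (lerD h1 h2) (lerD h4 h3)) _.
  by rewrite le_eqVlt; apply/orP; left; apply/eqP; field.
Qed.

End Diagonal.

(** * Criteria for one-sided Lebesgue points *)

Section LebesguePoints.
Context {R : realType}.
Local Notation mu := (@lebesgue_measure R).
Implicit Types (U W v w : R -> R) (s t b l : R).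

Lemma continuous_right_lebesgue_pt U s b : s < b -> itg mu `[s, b] U ->
  {for s, continuous U} -> right_lebesgue_pt U s.
Proof.
move=> sb Ui cU; apply/cvgrPdist_le => e e0.
have [d /= d0 Hd] : \forall x \near s, `|U s - U x| <= e.
  by move/cvgrPdist_le : cU; apply.
near=> n.
have nb : s + n.+1%:R^-1 <= b.
  by rewrite -lerBrDl; near: n; apply: near_invS; rewrite subr_gt0.
have nd : n.+1%:R^-1 <= d / 2 by near: n; apply: near_invS; rewrite divr_gt0.
have N0 : 0 < n.+1%:R :> R by rewrite ltr0n.
have ss : s <= s + n.+1%:R^-1 by rewrite lerDl invr_ge0 ltW.
rewrite sub0r normrN ger0_norm; last by rewrite mulr_ge0 ?(ltW N0) ?Rintegral_ge0.
rewrite -ler_pdivlMl//.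
have -> : n.+1%:R^-1 * e = \int[mu]_(x in `[s, s + n.+1%:R^-1]) e.
  by rewrite Rint_cst// addrAC subrr add0r mulrC.
apply: le_Rintegral => //.
- apply: itgabs => //; apply: itgB => //; last exact: itg_cst.
  by apply: itg_sub Ui => //; apply: subset_itvl; rewrite bnd_simp.
- exact: itg_cst.
- move=> x /=; rewrite in_itv/= => /andP[sx xs]; rewrite distrC; apply: Hd.
  rewrite /ball_/= ler0_norm ?subr_le0// opprB.
  apply: (@le_lt_trans _ _ (d / 2)); last by lra.
  by apply: le_trans nd; rewrite lerBlDl.
Unshelve. all: by end_near. Qed.

Lemma lebesgue_pt_right U s : itg mu setT U -> lebesgue_pt U s -> right_lebesgue_pt U s.
Proof.
move=> Ui Us; apply/cvgrPdist_le => e e0.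
have e8 : (0 < (e / 4)%:E)%E by rewrite lte_fin divr_gt0.
have [d /= d0 Hd] : \forall r \near (0 : R)^'+, (davg U s r <= (e / 4)%:E)%E.
  have := Us; rewrite /lebesgue_pt => /fine_cvgP[Hf Hc].
  have H1 : \forall r \near (0 : R)^'+, `|0 - (fine \o davg U s) r| <= e / 4.
    by move/cvgrPdist_le : Hc; apply; rewrite divr_gt0.
  near=> r.
  have Hr : `|0 - (fine \o davg U s) r| <= e / 4 by near: r.
  have Fr : davg U s r \is a fin_num by near: r.
  rewrite -(fineK Fr) lee_fin; apply: le_trans Hr.
  by rewrite sub0r normrN ler_norm.
near=> n.
have nd : n.+1%:R^-1 <= d / 4 by near: n; apply: near_invS; rewrite divr_gt0.
have N0 : 0 < n.+1%:R :> R by rewrite ltr0n.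
(* Twice the length, since the open ball must contain the closed interval [[s, s + 1/(n+1)]]. The
   ball has measure 4/(n+1), which explains the bound e/4 on the averages. *)
pose rn : R := 2 * n.+1%:R^-1.
have rn0 : 0 < rn by rewrite mulr_gt0 ?invr_gt0.
have := Hd rn; rewrite /ball_/= sub0r normrN gtr0_norm//.
have i0 : 0 < n.+1%:R^-1 :> R by rewrite invr_gt0.
have rnd : rn < d.
  by move: nd; rewrite /rn; move: (n.+1%:R^-1) => i; lra.
move=> /(_ rnd rn0); rewrite /davg /iavg (lebesgue_measure_ball _ (ltW rn0)).
have rn20 : rn *+ 2 != 0 by rewrite mulrn_eq0 /= gt_eqF.
rewrite -/mu inver (negbTE rn20).
have mf : measurable_fun setT (fun x => `|U x - U s|).
  by apply: measurableT_comp => //; apply: measurable_funB => //; exact: itg_meas Ui.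
have le1 : (\int[mu]_(x in `[s, (s + n.+1%:R^-1)%R]) (`|U x - U s|%R)%:E <=
   \int[mu]_(y in ball s rn) `|(center (U s) \o U) y|%:E)%E.
  apply: ge0_subset_integral => //.
  - exact: measurable_ball.
  - by apply/measurable_EFinP; apply: measurable_funTS.
  - move=> x /=; rewrite in_itv/= /ball/= => /andP[sx xs].
    rewrite ler0_norm ?subr_le0// opprB /rn.
    by move: i0 xs; move: (n.+1%:R^-1) => i; lra.
have iU : itg mu `[s, s + n.+1%:R^-1] (fun x => `|U x - U s|).
  apply: itgabs => //; apply: itgB => //; last exact: itg_cst.
  by apply: itg_sub Ui.
move=> H; rewrite sub0r normrN ger0_norm; last by rewrite mulr_ge0 ?(ltW N0) ?Rintegral_ge0.
rewrite -ler_pdivlMl// -lee_fin Rint_EFin//.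
apply: le_trans le1 _.
move: H; rewrite lee_pdivrMl ?mulrn_wgt0// => H; apply: le_trans H _.
by rewrite -EFinM lee_fin /rn mulr2n; move: (n.+1%:R^-1) => i; lra.
Unshelve. all: by end_near. Qed.

End LebesguePoints.

Lemma itg_restrict d (T : measurableType d) (R : realType)
    (mu : {measure set T -> \bar R}) (D : set T) (f : T -> R) : measurable D ->
  itg mu D f -> itg mu setT (f \_ D).
Proof. by move=> mD; rewrite -restrict_EFin; move/integrable_mkcond; apply. Qed.

(** * Weak derivatives and indefinite integrals *)

Section AbsolutelyContinuous.
Context {R : realType}.
Local Notation mu := (@lebesgue_measure R).
Implicit Types (f v w : R -> R) (p q l e c : R).

Lemma within_eps p q f t0 e : {within `[p, q], continuous f} -> p <= t0 <= q ->
  0 < e -> exists2 de, 0 < de & forall t, p <= t <= q -> `|t - t0| < de ->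
  `|f t - f t0| <= e.
Proof.
move=> /subspace_continuousP cf t0pq e0.
have t0A : `[p, q]%classic t0 by rewrite /= in_itv.
have /cvgrPdist_le /(_ _ e0) [de /= de0 H] := cf _ t0A.
exists de => // t tpq tt0; rewrite distrC; apply: H.
  by rewrite /ball_/= distrC.
by rewrite /= in_itv.
Qed.

Lemma loc_itg (D : set R) f p q : locally_integrable D f -> `[p, q] `<=` D ->
  itg mu `[p, q] f.
Proof.
move=> [mf oD Kf] sub; apply/integrableP; split.
  apply/measurable_EFinP; apply: measurable_funS sub mf.
  exact: open_measurable.
by apply: Kf => //; exact: segment_compact.
Qed.

Lemma right_lebesgue_pt_near U v p b : p < b ->
  (forall x, p <= x <= b -> U x = v x) -> right_lebesgue_pt U p -> right_lebesgue_pt v p.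
Proof.
move=> pb Uv; apply: cvg_trans; apply: near_eq_cvg; near=> n.
congr (_ * _); apply: eq_Rintegral => x; rewrite inE/= in_itv/= => /andP[px xn].
have nb : p + n.+1%:R^-1 <= b.
  by rewrite -lerBrDl; near: n; apply: near_invS; rewrite subr_gt0.
rewrite !Uv ?lexx ?(ltW pb)//.
by rewrite px (le_trans xn).
Unshelve. all: by end_near. Qed.

Lemma ae_right_lebesgue_pt l v : locally_integrable `]0, l[ v ->
  {ae mu, forall x, x \in `]0, l[ -> right_lebesgue_pt v x}.
Proof.
move=> lv; pose c (n : nat) : R := n.+1%:R^-1.
have c0 n : 0 < c n by rewrite invr_gt0.
(* Lebesgue differentiation is applied to truncations integrable on the whole line, since [v] is
   only locally integrable in (0,l). *)
pose vn n := v \_ (`[c n, l - c n]).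
have vi n : itg mu setT (vn n).
  apply: itg_restrict; first exact: measurable_itv.
  apply: loc_itg lv _; apply: subset_itv; rewrite bnd_simp//.
  by rewrite ltrBlDr ltrDl.
have H n : {ae mu, forall x, lebesgue_pt (vn n) x}.
  apply: lebesgue_differentiation; apply: open_integrable_locally => //.
  exact: openT.
apply: ae_imp (ae_foralln H) => x Hx; rewrite in_itv/= => /andP[x0 xl].
(* The factor 1/2 keeps [[x, x + (l - x) / 2]] inside the truncation interval, so that [vn n] and
   [v] agree to the right of [x]. *)
have [n [nx nl]] : exists n, c n <= x /\ c n <= (l - x) / 2.
  near \oo => n; exists n; split; near: n; apply: near_invS => //.
  by rewrite divr_gt0// subr_gt0.
have xl2 : x < x + (l - x) / 2 by rewrite ltrDl divr_gt0// subr_gt0.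
apply: (right_lebesgue_pt_near xl2) (lebesgue_pt_right (vi n) (Hx n)).
move=> y /andP[xy yx]; rewrite /vn patchE mem_set//= in_itv/=.
by rewrite (le_trans nx)//=; lra.
Unshelve. all: by end_near. Qed.

Lemma ae_exists p q (P : R -> Prop) : p < q ->
  {ae mu, forall x, x \in `]p, q[ -> P x} -> exists2 x, p < x < q & P x.
Proof.
move=> pq HP; apply: contrapT => nP.
have H10 : {ae mu, forall x, `]p, q[%classic x -> (1 : R) = 0}.
  apply: ae_imp HP => x H xpq; exfalso; apply: nP.
  by exists x; [rewrite /= in_itv/= in xpq|exact: H].
have : \int[mu]_(x in `]p, q[) (1 : R) = \int[mu]_(x in `]p, q[) (0 : R).
  by apply: Rint_ae.
rewrite Rint_oo_cc; last exact: itg_cst.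
rewrite Rint_oo_cc; last exact: itg_cst.
by rewrite !Rint_cst ?(ltW pq)// mul1r mul0r => /eqP; rewrite subr_eq0 gt_eqF.
Qed.

(** The representative is anchored at one Lebesgue point [m] of [v]; by [weak_FTC] it then agrees
    with [v] at every other Lebesgue point, hence almost everywhere. *)
Lemma weak_deriv_AC l v w : 0 < l -> weak_deriv l v w -> exists V : R -> R,
  (forall p q, 0 < p -> p <= q -> q < l -> V q - V p = \int[mu]_(r in `[p, q]) w r) /\
  {ae mu, forall x, x \in `]0, l[ -> v x = V x}.
Proof.
move=> l0 [lv lw vw]; have good := ae_right_lebesgue_pt lv.
have [m /andP[m0 ml] Hm] := ae_exists l0 good.
have wi p q : 0 < p -> q < l -> itg mu `[p, q] w.
  by move=> p0 ql; apply: loc_itg lw _; apply: subset_itv; rewrite bnd_simp.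
have vi p q : 0 < p -> q < l -> itg mu `[p, q] v.
  by move=> p0 ql; apply: loc_itg lv _; apply: subset_itv; rewrite bnd_simp.
(* An oriented integral from [m] to [x]: at least one of the two terms always vanishes. *)
pose V x := v m + (\int[mu]_(r in `[m, x]) w r - \int[mu]_(r in `[x, m]) w r).
exists V; split.
  move=> p q p0 pq ql; rewrite /V.
  have [mp|pm] := leP m p.
    rewrite (Rint_split mp pq); last exact: wi.
    by rewrite (Rint_nil _ mp) (Rint_nil _ (le_trans mp pq)); ring.
  have [qm|mq] := leP q m.
    rewrite (Rint_split pq qm); last exact: wi.
    by rewrite (Rint_nil _ (ltW pm)) (Rint_nil _ qm); ring.
  rewrite (Rint_split (ltW pm) (ltW mq)); last exact: wi.
  by rewrite (Rint_nil _ (ltW pm)) (Rint_nil _ (ltW mq)); ring.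
apply: ae_imp good => x Hx xl; have Hx' := Hx xl.
move: xl; rewrite in_itv/= => /andP[x0 xl]; rewrite /V.
have FTC s t : 0 < s -> s < t -> t < l -> right_lebesgue_pt v s ->
    right_lebesgue_pt v t -> v t - v s = \int[mu]_(r in `[s, t]) w r.
  move=> s0 st tl; have t1 : t < (t + l) / 2 by lra.
  have t2 : (t + l) / 2 < l by lra.
  by apply: (weak_FTC s0 st t1 t2); [exact: vi|exact: wi|].
have [mx|xm|->] := ltgtP m x.
- by rewrite -FTC// (Rint_nil _ (ltW mx)); ring.
- by rewrite (Rint_nil _ (ltW xm)) -FTC//; ring.
- by rewrite Rint_nil// subrr addr0.
Qed.

Lemma AC_continuous l (V w : R -> R) p q : 0 < p -> p <= q -> q < l ->
  itg mu `[p, q] w ->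
  (forall p q, 0 < p -> p <= q -> q < l -> V q - V p = \int[mu]_(r in `[p, q]) w r) ->
  {within `[p, q], continuous V}.
Proof.
move=> p0 pq ql wi HV.
have c1 := parameterized_integral_continuous pq wi.
apply/subspace_continuousP => x xA.
have xA' := xA; move: xA'; rewrite /= in_itv/= => /andP[px xq].
have := (subspace_continuousP _ _).1 c1 _ xA => H.
apply/cvgrPdist_le => e e0; have /cvgrPdist_le /(_ _ e0) He := H.
near=> y.
have : `[p, q]%classic y by near: y; exact: withinT.
rewrite /= in_itv/= => /andP[py yq].
have -> : V x - V y = parameterized_integral mu p x w - parameterized_integral mu p y w.
  rewrite /parameterized_integral -!HV//; [ring|exact: le_lt_trans ql..].
by near: y.
Unshelve. all: by end_near. Qed.

Lemma within_meas p q f : {within `[p, q], continuous f} -> measurable_fun `[p, q] f.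
Proof. by move=> cf; apply: subspace_continuous_measurable_fun. Qed.

Lemma within_bounded p q f : {within `[p, q], continuous f} ->
  exists K, forall x, p <= x <= q -> `|f x| <= K.
Proof.
move=> cf; have [pq|qp] := leP p q; last first.
  exists 0 => x /andP[px xq]; exfalso; have := le_trans px xq.
  by rewrite leNgt qp.
have cn : {within `[p, q], continuous (fun x => `|f x|)}.
  by move=> x; apply: cvg_norm; exact: cf.
have [c _ Hc] := EVT_max pq cn.
by exists `|f c| => x xpq; apply: Hc; rewrite in_itv.
Qed.

(** If [dist * f >= c] held almost everywhere on a strip of width y/2 where [dist < y], then f >=
    c/y there and its integral would be at least c/2. But the integral of [f] over the points with
    [dist < y] tends to 0 with y. The parameter [dist] is the distance to one end, so that both ends
    share the argument. *)
Lemma small_point l (dist lo hi : R -> R) f (P : R -> Prop) r c :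
  0 < l -> measurable_fun `]0, l[ dist ->
  (forall x, 0 < x < l -> 0 < dist x) ->
  (forall y, 0 < y < l -> [/\ 0 <= lo y, hi y <= l, hi y - lo y = y / 2 &
      forall x, lo y < x < hi y -> dist x < y]) ->
  itg mu `]0, l[ f -> (forall x, 0 < x < l -> 0 <= f x) ->
  {ae mu, forall x, x \in `]0, l[ -> P x} -> 0 < r -> 0 < c ->
  exists x, [/\ 0 < x < l, P x, dist x < r & dist x * f x < c].
Proof.
move=> l0 md d0 lohi fi f0 HP r0 c0.
pose fn (n : nat) x : R := f x * (if dist x < n.+1%:R^-1 then 1 else 0).
have mI n : measurable_fun `]0, l[ (fun x => if dist x < n.+1%:R^-1 then 1 else 0 : R).
  apply: measurable_fun_if => //.
  exact: (measurable_fun_ltr md (measurable_cst _)).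
have L : (fun n => \int[mu]_(x in `]0, l[) fn n x) @ \oo --> \int[mu]_(x in `]0, l[) (0 : R).
  apply: (Rint_dct _ _ _ _ (itgabs _ fi)) => //.
  - by move=> n; apply: measurable_funM; [exact: itg_meas fi|exact: mI].
  - move=> x; rewrite /= in_itv/= => xl; apply: cvg_near_cst; near=> n.
    rewrite /fn ltNge (_ : (_ <= _) = true) /= ?mulr0//.
    by near: n; apply: near_invS; exact: d0.
  - move=> n x _; rewrite /fn normrM; case: ifP => _; first by rewrite normr1 mulr1.
    by rewrite normr0 mulr0.
rewrite Rintegral_cst// mul0r in L.
near \oo => n.
have yr : n.+1%:R^-1 <= r by near: n; apply: near_invS.
have yl : n.+1%:R^-1 <= l / 2 by near: n; apply: near_invS; rewrite divr_gt0.
(* A value below the c/2 that the strip would contribute. *)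
have small : \int[mu]_(x in `]0, l[) fn n x <= c / 4.
  apply: le_trans (ler_norm _) _; rewrite -normrN -sub0r.
  by near: n; move/cvgrPdist_le : L; apply; rewrite divr_gt0.
have y0 : 0 < n.+1%:R^-1 :> R by rewrite invr_gt0.
set y : R := n.+1%:R^-1 in yr yl y0.
have yl' : 0 < y < l by rewrite y0/=; lra.
have [lo0 hil lohiE lohid] := lohi _ yl'.
have sub : `]lo y, hi y[ `<=` `]0, l[ by apply: subset_itv; rewrite bnd_simp.
have lohi' : lo y <= hi y by clear -lohiE y0; lra.
apply: contrapT => nP.
have fin : itg mu `]0, l[ (fn n).
  apply: (itgMb (K := 1) _ fi) => //; first exact: mI.
  move=> x _.
  by case: ifP => _; rewrite ?normr1 ?normr0.
have fin2 : itg mu `]lo y, hi y[ (fn n) by apply: itg_sub fin.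
have cst2 : itg mu `]lo y, hi y[ (fun=> c / y).
  by apply: itg_sub (itg_cst (lo y) (hi y) _) => //; exact: subset_itv_oo_cc.
have : `|\int[mu]_(x in `]lo y, hi y[) (c / y)| <= \int[mu]_(x in `]lo y, hi y[) fn n x.
  apply: Rint_abs_le_ae => //.
    move=> x /sub/=; rewrite in_itv/= => xl; rewrite mulr_ge0 ?f0//.
    by case: ifP.
  apply: ae_imp HP => x Hx /= xlo.
  have xl := sub _ xlo; move: (xl) (xlo); rewrite /= !in_itv/= => xl' xlo'.
  have dy := lohid _ xlo'.
  rewrite /fn -/y dy mulr1 ger0_norm; last by rewrite divr_ge0 ?ltW.
  rewrite leNgt; apply/negP => fc; apply: nP; exists x; split => //.
  - exact: Hx.
  - exact: lt_le_trans yr.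
  - have := fc; rewrite ltr_pdivlMr// mulrC => fc'.
    by apply: le_lt_trans fc'; rewrite ler_wpM2r ?f0// ltW.
rewrite Rint_oo_cc ?Rint_cst//; last exact: itg_cst.
rewrite lohiE ger0_norm; last by rewrite mulr_ge0 ?divr_ge0 ?ltW.
have -> : c / y * (y / 2) = c / 2 by field; rewrite gt_eqF.
have : \int[mu]_(x in `]lo y, hi y[) fn n x <= \int[mu]_(x in `]0, l[) fn n x.
  rewrite Rintegral_mkcond [leRHS]Rintegral_mkcond.
  apply: le_Rintegral => //.
  - by apply: itg_restrict.
  - by apply: itg_restrict.
  - move=> x _; rewrite !patchE; case: ifPn => [xlo|_].
      by rewrite mem_set//; exact/sub/set_mem.
    case: ifPn => // /set_mem/=; rewrite in_itv/= => xl.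
    by rewrite mulr_ge0 ?f0//; case: ifP.
move=> h1 h2; have h3 := le_trans (le_trans h2 h1) small.
by clear -h3 c0; lra.
Unshelve. all: by end_near. Qed.

Lemma small_point_left l f (P : R -> Prop) r c : 0 < l ->
  itg mu `]0, l[ f -> (forall x, 0 < x < l -> 0 <= f x) ->
  {ae mu, forall x, x \in `]0, l[ -> P x} -> 0 < r -> 0 < c ->
  exists x, [/\ 0 < x < l, P x, x < r & x * f x < c].
Proof.
move=> l0 fi f0 HP; apply: (@small_point l id (fun y => y / 2) id f P) => //.
- by move=> x /andP[].
- move=> y /andP[y0 yl]; split; rewrite /=; [lra|lra|lra|].
  by move=> x /andP[].
Qed.

Lemma small_point_right l f (P : R -> Prop) r c : 0 < l ->
  itg mu `]0, l[ f -> (forall x, 0 < x < l -> 0 <= f x) ->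
  {ae mu, forall x, x \in `]0, l[ -> P x} -> 0 < r -> 0 < c ->
  exists x, [/\ 0 < x < l, P x, l - x < r & (l - x) * f x < c].
Proof.
move=> l0 fi f0 HP.
apply: (@small_point l (fun x => l - x) (fun y => l - y) (fun y => l - y / 2) f P) => //.
- by apply: measurable_funB => //; exact: measurable_cst.
- by move=> x /andP[]; lra.
- move=> y /andP[y0 yl]; split; rewrite /=; [lra|lra|lra|].
  by move=> x /andP[]; lra.
Qed.

End AbsolutelyContinuous.

(** * Poincare's inequality and integration by parts in space *)

Section SpaceIBP.
Context {R : realType}.
Local Notation mu := (@lebesgue_measure R).
Implicit Types (f g h k v w : R -> R) (p q l e c : R).

Lemma le_of_eps (x y C : R) : 0 <= C -> (forall e, 0 < e -> x <= y + C * e) -> x <= y.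
Proof.
move=> C0 H; apply/ler_addgt0Pr => e e0.
have C1 : 0 < C + 1 by rewrite ltr_wpDl.
apply: le_trans (H (e / (C + 1)) _) _; first by rewrite divr_gt0.
by rewrite lerD2l mulrA ler_pdivrMr// mulrC ler_wpM2l ?(ltW e0)// lerDl.
Qed.

Lemma itg_L1 p q f : measurable_fun `]p, q[ f -> itg mu `]p, q[ (fun x => f x ^+ 2) ->
  itg mu `]p, q[ f.
Proof.
move=> mf f2; apply: (@itg_le _ _ _ mu _ _ _ (fun x => 1 + f x ^+ 2)) => //.
- move=> x _; rewrite -(real_normK (num_real (f x))); have := normr_ge0 (f x); nra.
- apply: itgD => //; apply: itg_sub (itg_cst p q 1) => //; exact: subset_itv_oo_cc.
Qed.

Lemma sub_Rint_le (D E : set R) f : measurable D -> measurable E -> E `<=` D ->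
  itg mu D f -> (forall x, D x -> 0 <= f x) ->
  \int[mu]_(x in E) f x <= \int[mu]_(x in D) f x.
Proof.
move=> mD mE ED fi f0.
have fE : itg mu E f by apply: itg_sub fi.
rewrite -lee_fin !Rint_EFin//; apply: ge0_subset_integral => //.
by apply/measurable_EFinP; exact: itg_meas fi.
Qed.

Lemma holder_half l k p q : measurable_fun `]0, l[ k ->
  itg mu `]0, l[ (fun x => k x ^+ 2) -> 0 < p -> p <= q -> q < l ->
  (\int[mu]_(x in `[p, q]) k x) ^+ 2 <=
    (q - p) * \int[mu]_(x in `]0, l[) (k x ^+ 2).
Proof.
move=> mk k2 p0 pq ql.
have sub : `[p, q] `<=` `]0, l[ by apply: subset_itv; rewrite bnd_simp.
have k2' : itg mu `[p, q] (fun x => k x ^+ 2) by apply: itg_sub k2.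
have mk' : measurable_fun `[p, q] k by apply: measurable_funS sub mk.
have i1 : itg mu `[p, q] (fun=> 1 ^+ 2 : R) by exact: itg_cst.
have := @cauchy_schwarz _ _ _ mu `[p, q] (measurable_itv _) (fun=> 1) k
  (@measurable_cst _ _ _ _ _ _) mk' i1 k2'.
have -> : \int[mu]_(x in `[p, q]) (1 * k x) = \int[mu]_(x in `[p, q]) k x.
  by apply: eq_Rintegral => x _; rewrite mul1r.
rewrite Rint_cst// expr1n mul1r => /le_trans; apply.
rewrite ler_wpM2l ?subr_ge0//; apply: sub_Rint_le => // x _; exact: sqr_ge0.
Qed.

(** Weak derivatives are integrated only between interior points, so v(x) is compared with v(p) for
    p close to 0, where v is small by continuity. The factor 2 is the price of v(x)^2 <= 2 (v(x) -
    v(p))^2 + 2 v(p)^2. *)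
Lemma poincare l v w : 0 < l -> {within `[0, l], continuous v} -> v 0 = 0 ->
  weak_deriv l v w -> measurable_fun `]0, l[ w ->
  itg mu `]0, l[ (fun x => w x ^+ 2) ->
  \int[mu]_(x in `]0, l[) (v x ^+ 2) <= 2 * l ^+ 2 * \int[mu]_(x in `]0, l[) (w x ^+ 2).
Proof.
move=> l0 cv v0 [lv lw vw] mw w2.
set A := \int[mu]_(x in _) (w x ^+ 2).
have A0 : 0 <= A by apply: Rintegral_ge0 => x _; exact: sqr_ge0.
have vc x : 0 < x < l -> {for x, continuous v}.
  move=> xl; have [+ _ _] := (continuous_within_itvP v l0).1 cv.
  by apply; rewrite in_itv.
have wi p q : 0 < p -> q < l -> itg mu `[p, q] w.
  by move=> p0 ql; apply: loc_itg lw _; apply: subset_itv; rewrite bnd_simp.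
have vi p q : 0 < p -> q < l -> itg mu `[p, q] v.
  by move=> p0 ql; apply: loc_itg lv _; apply: subset_itv; rewrite bnd_simp.
have FTC s t : 0 < s -> s < t -> t < l -> v t - v s = \int[mu]_(r in `[s, t]) w r.
  move=> s0 st tl; have t1 : t < (t + l) / 2 by lra.
  have t2 : (t + l) / 2 < l by lra.
  apply: (weak_FTC s0 st t1 t2); [exact: vi|exact: wi|by []| |].
    apply: (continuous_right_lebesgue_pt st); first exact: vi.
    by apply: vc; rewrite s0 (lt_trans st).
  apply: (continuous_right_lebesgue_pt t1); first by apply: vi => //; lra.
  by apply: vc; rewrite tl (lt_trans s0).
have vb x : 0 < x < l -> v x ^+ 2 <= 2 * l * A.
  move=> /andP[x0 xl]; apply: (@le_of_eps _ _ 2) => // e e0.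
  (* Capping at 1 gives e'^2 <= e, so that v(p)^2 <= e. *)
  pose e' := Num.min e 1.
  have e'0 : 0 < e' by rewrite lt_min e0 ltr01.
  have O : 0 <= (0 : R) <= l by rewrite lexx ltW.
  have [de de0 Hde] := within_eps cv O e'0.
  pose p := Num.min (de / 2) (x / 2).
  have p0 : 0 < p by rewrite lt_min !divr_gt0.
  have px : p < x by rewrite gt_min; apply/orP; right; lra.
  have pde : p < de by rewrite gt_min; apply/orP; left; lra.
  have := Hde p; rewrite v0 !subr0 gtr0_norm// (ltW p0) (ltW (lt_trans px xl)).
  move=> /(_ isT pde) vp.
  have H1 : (v x - v p) ^+ 2 <= l * A.
    rewrite FTC//; apply: le_trans (holder_half mw w2 p0 (ltW px) xl) _.
    by rewrite ler_wpM2r//; lra.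
  have H2 : v p ^+ 2 <= e.
    have e1 : e' <= 1 by rewrite ge_min lexx orbT.
    have ee : e' <= e by rewrite ge_min lexx.
    rewrite -(real_normK (num_real (v p))); have := normr_ge0 (v p); nra.
  have := sqr_ge0 (v x - 2 * v p); nra.
have cst1 : itg mu `]0, l[ (fun=> 2 * l * A).
  by apply: itg_sub (itg_cst 0 l _) => //; exact: subset_itv_oo_cc.
have mv : measurable_fun `]0, l[ v by case: lv.
have v2 : itg mu `]0, l[ (fun x => v x ^+ 2).
  apply: (itg_le _ _ _ cst1) => //; first exact: measurable_funX.
  by move=> x /=; rewrite in_itv/= => xl; rewrite ger0_norm ?sqr_ge0 ?vb.
apply: le_trans.
  apply: le_Rintegral cst1 _ => // x /=; rewrite in_itv/=; exact: vb.
rewrite Rint_oo_cc ?Rint_cst ?(ltW l0)//; last exact: itg_cst.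
by rewrite subr0 expr2 le_eqVlt; apply/orP; left; apply/eqP; ring.
Qed.

(* [h^2 / a = a f^2] is integrable whereas [a] is at most linear near the ends,
   so that [h] is small at points arbitrarily close to them. *)
Lemma zero_trace_bound l a K h k f H : 0 < l -> 0 <= K ->
  measurable_fun `]0, l[ k -> itg mu `]0, l[ (fun x => k x ^+ 2) ->
  (forall x, 0 < x < l -> 0 < a x /\ a x <= K * x /\ a x <= K * (l - x)) ->
  (forall x, 0 < x < l -> h x = a x * f x) ->
  itg mu `]0, l[ (fun x => a x * f x ^+ 2) ->
  (forall p q, 0 < p -> p <= q -> q < l -> H q - H p = \int[mu]_(r in `[p, q]) k r) ->
  {ae mu, forall x, x \in `]0, l[ -> h x = H x} ->
  forall x, 0 < x < l -> H x ^+ 2 <= 2 * \int[mu]_(r in `]0, l[) (k r ^+ 2) * x /\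
    H x ^+ 2 <= 2 * \int[mu]_(r in `]0, l[) (k r ^+ 2) * (l - x).
Proof.
move=> l0 K0 mk k2 aK haf af HV hH x /andP[x0 xl].
set A := \int[mu]_(r in _) _.
have A0 : 0 <= A by apply: Rintegral_ge0 => y _; exact: sqr_ge0.
have af0 y : 0 < y < l -> 0 <= a y * f y ^+ 2.
  by move=> yl; rewrite mulr_ge0 ?sqr_ge0//; have [/ltW] := aK _ yl.
(* At points where [h = H], H^2 = a (a f^2) <= K d (a f^2), and [small_point] makes d (a f^2)
   small. *)
have Hsmall p (d e : R) : 0 < p < l -> h p = H p -> a p <= K * d -> 0 <= d ->
    d * (a p * f p ^+ 2) < e -> H p ^+ 2 <= K * e.
  move=> pl <- apd d0 fe; rewrite haf// exprMn.
  have -> : a p ^+ 2 * f p ^+ 2 = a p * (a p * f p ^+ 2) by ring.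
  apply: le_trans (ler_wpM2r (af0 _ pl) apd) _.
  by rewrite -mulrA ler_wpM2l// ltW.
have sq2 (y z : R) : y ^+ 2 <= 2 * (y - z) ^+ 2 + 2 * z ^+ 2.
  by have := sqr_ge0 (y - 2 * z); nra.
have K2 : 0 <= 2 * K by rewrite mulr_ge0.
split; apply: (le_of_eps K2) => e e0.
  have [p [pl hp px pe]] := small_point_left l0 af af0 hH x0 e0.
  have [p0 _] := andP pl; have [_ [aKp _]] := aK _ pl.
  have H1 := Hsmall _ _ _ pl hp aKp (ltW p0) pe.
  have := holder_half mk k2 p0 (ltW px) xl; rewrite -HV ?(ltW px)// -/A => H2.
  have := sq2 (H x) (H p).
  have : (x - p) * A <= x * A by rewrite ler_wpM2r//; lra.
  by nra.
have lx0 : 0 < l - x by lra.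
have [p [pl hp px pe]] := small_point_right l0 af af0 hH lx0 e0.
have [_ pl'] := andP pl; have [_ [_ aKp]] := aK _ pl.
have lp0 : 0 <= l - p by lra.
have xp : x <= p by lra.
have H1 := Hsmall _ _ _ pl hp aKp lp0 pe.
have := holder_half mk k2 x0 xp pl'; rewrite -HV// -/A => H2.
have := sq2 (H x) (H p); rewrite -(sqrrN (H x - H p)) opprB.
have : (p - x) * A <= (l - x) * A by rewrite ler_wpM2r//; lra.
by nra.
Qed.

(* The boundary terms [H W] vanish along suitable points: [H] is [O(sqrt x)]
   and [x w(x)^2] takes arbitrarily small values as [w] is square integrable. *)
Lemma space_IBP l a K h k f w g : 0 < l -> 0 <= K ->
  (forall x, 0 < x < l -> 0 < a x /\ a x <= K * x /\ a x <= K * (l - x)) ->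
  measurable_fun `]0, l[ a ->
  weak_deriv l h k -> (forall x, 0 < x < l -> h x = a x * f x) ->
  measurable_fun `]0, l[ f -> itg mu `]0, l[ (fun x => a x * f x ^+ 2) ->
  itg mu `]0, l[ (fun x => k x ^+ 2) ->
  weak_deriv l w g -> itg mu `]0, l[ (fun x => w x ^+ 2) ->
  itg mu `]0, l[ (fun x => a x * g x ^+ 2) ->
  itg mu `]0, l[ (fun x => h x * g x) /\
  \int[mu]_(x in `]0, l[) (h x * g x) = - \int[mu]_(x in `]0, l[) (k x * w x).
Proof.
move=> l0 K0 aK ma hk haf mf af k2 wg w2 ag2.
have [lh lk _] := hk; have [lw lg _] := wg.
have mh : measurable_fun `]0, l[ h by case: lh.
have mk : measurable_fun `]0, l[ k by case: lk.
have mw : measurable_fun `]0, l[ w by case: lw.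
have mg : measurable_fun `]0, l[ g by case: lg.
have ihg : itg mu `]0, l[ (fun x => h x * g x).
  apply: (@itg_le _ _ _ mu _ _ _ (fun x => a x * f x ^+ 2 + a x * g x ^+ 2)) => //.
  - exact: measurable_funM.
  - move=> x /=; rewrite in_itv/= => xl; rewrite haf// -mulrA normrM.
    have [a0 _] := aK _ xl; rewrite gtr0_norm// -mulrDr ler_wpM2l ?(ltW a0)//.
    rewrite normrM -(real_normK (num_real (f x))) -(real_normK (num_real (g x))).
    have := normr_ge0 (f x); have := normr_ge0 (g x); nra.
  - exact: itgD.
have ikw : itg mu `]0, l[ (fun x => k x * w x) by apply: itgM2.
split=> //.
have [H [HV hH]] := weak_deriv_AC l0 hk; have [W [WV wW]] := weak_deriv_AC l0 wg.
have Hb := zero_trace_bound l0 K0 mk k2 aK haf af HV hH.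
set A := \int[mu]_(r in _) _ in Hb.
have A0 : 0 <= A by apply: Rintegral_ge0 => y _; exact: sqr_ge0.
(* Almost everywhere the derivative of the product [H W]; the claim is that its integral over (0,l)
   vanishes. *)
pose be x := k x * w x + h x * g x.
have ibe : itg mu `]0, l[ be by apply: itgD.
have gi p q : 0 < p -> q < l -> itg mu `[p, q] g.
  by move=> p0 ql; apply: loc_itg lg _; apply: subset_itv; rewrite bnd_simp.
have ki p q : 0 < p -> q < l -> itg mu `[p, q] k.
  by move=> p0 ql; apply: loc_itg lk _; apply: subset_itv; rewrite bnd_simp.
have inner p q : 0 < p -> p <= q -> q < l ->
    H q * W q - H p * W p = \int[mu]_(x in `[p, q]) be x.
  move=> p0 pq ql; have gpq := gi _ _ p0 ql; have kpq := ki _ _ p0 ql.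
  have cH := AC_continuous p0 pq ql kpq HV.
  have cW := AC_continuous p0 pq ql gpq WV.
  have mH := within_meas cH; have mW := within_meas cW.
  have [BH HBH] := within_bounded cH; have [BW HBW] := within_bounded cW.
  have ikW : itg mu `[p, q] (fun r => k r * W r).
    apply: (itgMb (K := BW) _ kpq) => // x; rewrite /= in_itv/=; exact: HBW.
  have igH : itg mu `[p, q] (fun r => H r * g r).
    have igH' : itg mu `[p, q] (fun r => g r * H r).
      apply: (itgMb (K := BH) _ gpq) => // x; rewrite /= in_itv/=; exact: HBH.
    by move: igH'; apply: eq_integrable => // x _ /=; rewrite mulrC.
  (* The product rule for two indefinite integrals; [H] and [W] are continuous on [p,q], so the
     weight |k| + |g| dominates both variations. *)
  rewrite (@diag_FTC R (fun s t => H s * W t) (fun r t => k r * W t)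
    (fun s r => H s * g r) (fun r => `|k r| + `|g r|) p q pq).
  - apply: Rint_ae => //.
    + by apply: measurable_funD; [exact: itg_meas ikW|exact: itg_meas igH].
    + apply: measurable_funS (itg_meas ibe) => //.
      by apply: subset_itv; rewrite bnd_simp.
    + apply: ae_imp (ae_and hH wW) => x [hx wx]; rewrite /= in_itv/= => /andP[px xq].
      have xl : x \in `]0, l[ by rewrite in_itv/= (lt_le_trans p0)//= (le_lt_trans xq).
      by rewrite /be hx// wx.
  - move=> t _; have igt : itg mu `[p, q] (fun r => W t * k r) by apply: itgZ.
    by move: igt; apply: eq_integrable => // x _ /=; rewrite mulrC.
  - by move=> s _; apply: itgZ.
  - move=> s s' t ps ss sq _; rewrite -mulrBl HV//; last 2 first.
      exact: lt_le_trans ps.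
      exact: le_lt_trans ql.
    have i1 : itg mu `[s, s'] k by apply: ki; [exact: lt_le_trans ps|exact: le_lt_trans ql].
    rewrite mulrC -RintZ//; apply: eq_Rintegral => x _; exact: mulrC.
  - move=> s t t' pt tt tq _; rewrite -mulrBr WV//; last 2 first.
      exact: lt_le_trans pt.
      exact: le_lt_trans ql.
    have i1 : itg mu `[t, t'] g by apply: gi; [exact: lt_le_trans pt|exact: le_lt_trans ql].
    by rewrite -RintZ.
  - exact: itgD.
  - by apply: itgD => //; exact: itgabs.
  - by move=> r _; rewrite addr_ge0.
  - move=> t0 e t0pq e0.
    have [d1 d10 Hd1] := within_eps cH t0pq e0; have [d2 d20 Hd2] := within_eps cW t0pq e0.
    exists (Num.min d1 d2); first by rewrite lt_min d10.
    apply: aeW => r _ t tpq; rewrite lt_min => /andP[t1 t2].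
    have h1 := Hd1 _ tpq t1; have h2 := Hd2 _ tpq t2.
    rewrite -mulrBr -mulrBl !normrM [_ * (_ + _)]mulrC; split.
      apply: (@le_trans _ _ (`|k r| * e)); first by rewrite ler_wpM2l.
      by rewrite ler_wpM2r ?(ltW e0)// lerDl.
    apply: (@le_trans _ _ (e * `|g r|)); first by rewrite ler_wpM2r.
    by rewrite ?[e * _]mulrC ler_pM2r// lerDr.
have w20 x : 0 < x < l -> 0 <= w x ^+ 2 by move=> _; exact: sqr_ge0.
have prod_small (x d e : R) : 0 < x < l -> w x = W x -> H x ^+ 2 <= 2 * A * d ->
    0 <= d -> d * w x ^+ 2 < e -> (H x * W x) ^+ 2 <= 2 * A * e.
  move=> xl <- Hx d0 de; rewrite exprMn.
  apply: le_trans (ler_wpM2r (sqr_ge0 _) Hx) _.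
  by rewrite -[leLHS]mulrA ler_wpM2l ?mulr_ge0// ltW.
(* Each squared boundary term is at most 2 A/(n+1), and (Y - X)^2 <= 2 X^2 + 2 Y^2 gives the factor
   8. *)
have pts (n : nat) : exists pq : R * R, [/\ 0 < pq.1, pq.2 < l,
    pq.1 < n.+1%:R^-1 /\ l - pq.2 < n.+1%:R^-1, pq.1 <= pq.2 &
    (\int[mu]_(x in `[pq.1, pq.2]) be x) ^+ 2 <= 8 * A * n.+1%:R^-1].
  have n0 : 0 < n.+1%:R^-1 :> R by rewrite invr_gt0.
  (* The bound l/2 puts the left point before the right one. *)
  pose r : R := Num.min (n.+1%:R^-1) (l / 2).
  have r0 : 0 < r by rewrite lt_min n0 divr_gt0.
  have rn : r <= n.+1%:R^-1 by rewrite ge_min lexx.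
  have rl : r <= l / 2 by rewrite ge_min lexx orbT.
  have [p [pl wp pr pe]] := small_point_left l0 w2 w20 wW r0 n0.
  have [q [ql wq qr qe]] := small_point_right l0 w2 w20 wW r0 n0.
  have [p0 pl'] := andP pl; have [q0 ql'] := andP ql.
  have pq : p <= q by clear -pr qr rl; lra.
  exists (p, q); split => //=; first by split; exact: lt_le_trans rn.
  have [Hp _] := Hb _ pl; have [_ Hq] := Hb _ ql.
  have lq0 : 0 <= l - q by rewrite subr_ge0 ltW.
  have h1 := prod_small _ _ _ pl wp Hp (ltW p0) pe.
  have h2 := prod_small _ _ _ ql wq Hq lq0 qe.
  rewrite -inner//.
  move: h1 h2; set X := H p * W p; set Y := H q * W q; set c := n.+1%:R^-1.
  by move=> h1 h2; have := sqr_ge0 (X + Y); clear -h1 h2; nra.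
have [pq Hpq] := choice pts.
(* The intervals exhaust (0,l) but need not be nested, so the limit is taken by dominated
   convergence on truncations. *)
pose In n x := if (x \in `[(pq n).1, (pq n).2]) then be x else 0.
have L : (fun n => \int[mu]_(x in `]0, l[) In n x) @ \oo --> \int[mu]_(x in `]0, l[) be x.
  apply: (Rint_dct _ _ _ _ (itgabs _ ibe)) => //.
  - move=> n; apply: measurable_fun_if => //.
    + apply: (measurable_fun_bool true).
      rewrite (_ : _ `&` _ = `]0, l[ `&` `[(pq n).1, (pq n).2]); first exact: measurableI.
      by apply/seteqP; split => x /=.
    + apply: measurable_funS (itg_meas ibe) => //; exact: subIsetl.
  - exact: itg_meas ibe.
  - move=> x /=; rewrite in_itv/= => /andP[x0 xl]; apply: cvg_near_cst; near=> n.
    have [_ _ [p1 q1] _ _] := Hpq n.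
    rewrite /In ifT// in_itv/=; apply/andP; split.
      by apply: (le_trans (ltW p1)); near: n; exact: near_invS.
    have : n.+1%:R^-1 <= l - x by near: n; apply: near_invS; rewrite subr_gt0.
    move: q1; set c := n.+1%:R^-1; set q := (pq n).2; clearbody c q.
    by move=> h1 h2; rewrite -(lerD2r (- q - x)); clear -h1 h2; lra.
  - by move=> n x _; rewrite /In; case: ifP => // _; rewrite normr0.
have L2 : (fun n => \int[mu]_(x in `]0, l[) In n x) @ \oo --> (0 : R).
  apply/cvgrPdist_le => e e0; near=> n.
  have [p0 ql _ _ Hn] := Hpq n.
  rewrite sub0r normrN.
  have -> : \int[mu]_(x in `]0, l[) In n x = \int[mu]_(x in `[(pq n).1, (pq n).2]) be x.
    transitivity (\int[mu]_(x in `[(pq n).1, (pq n).2]) In n x).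
      apply: Rint_supp; first by apply: subset_itv; rewrite bnd_simp.
      by move=> x _ /= /negP xn; rewrite /In (negbTE xn).
    by apply: eq_Rintegral => x; rewrite inE /In /= => ->.
  have hn : n.+1%:R^-1 <= e ^+ 2 / (8 * A + 1).
    near: n; apply: near_invS; rewrite divr_gt0 ?exprn_gt0//.
    by rewrite ltr_wpDl// mulr_ge0.
  rewrite -(@ler_pXn2r _ 2)// ?nnegrE ?(ltW e0)// real_normK ?num_real//.
  apply: le_trans Hn _.
  have A8 : 0 <= 8 * A by rewrite mulr_ge0.
  have A81 : 0 < 8 * A + 1 by rewrite ltr_wpDl.
  apply: le_trans (ler_wpM2l A8 hn) _.
  by rewrite mulrA ler_pdivrMr// mulrC ler_wpM2l ?sqr_ge0// lerDl.
have := cvg_unique (@norm_hausdorff _ _) L L2.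
rewrite RintegralD// => E; apply/eqP; rewrite -addr_eq0 addrC E.
Unshelve. all: by end_near. Qed.

End SpaceIBP.

(** * Fubini and Tonelli on rectangles *)

Section RectangleFubini.
Context {d1 d2} {T1 : measurableType d1} {T2 : measurableType d2} {R : realType}.
Variables (m1 : {sigma_finite_measure set T1 -> \bar R})
  (m2 : {sigma_finite_measure set T2 -> \bar R}).
Variables (A : set T1) (B : set T2).
Hypotheses (mA : measurable A) (mB : measurable B).
Implicit Types f : T1 -> T2 -> R.

Let mAB : measurable (A `*` B).
Proof. exact: measurableX. Qed.

(** The extension by zero off the rectangle, which turns integrals over it into integrals over the
    full product. *)
Let G f := (fun z : T1 * T2 => (f z.1 z.2)%:E) \_ (A `*` B).

Let G_sec f x : A x -> (fun y => G f (x, y)) = (fun y => (f x y)%:E) \_ B.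
Proof.
move=> Ax; apply/funext => y; rewrite /G !patchE.
have [yB|yB] := boolP (y \in B).
  by rewrite mem_set//=; split=> //; exact: set_mem.
case: ifPn => // /set_mem[/= _ By]; by move: yB; rewrite mem_set.
Qed.

Let G_secN f x : ~ A x -> (fun y => G f (x, y)) = cst 0%E.
Proof.
move=> Ax; apply/funext => y; rewrite /G patchE.
by case: ifPn => // /set_mem[/= Ax' _].
Qed.

Let G_sec2 f y : B y -> (fun x => G f (x, y)) = (fun x => (f x y)%:E) \_ A.
Proof.
move=> By; apply/funext => x; rewrite /G !patchE.
have [xA|xA] := boolP (x \in A).
  by rewrite mem_set//=; split=> //; exact: set_mem.
case: ifPn => // /set_mem[/= Ax _]; by move: xA; rewrite mem_set.
Qed.

Let G_sec2N f y : ~ B y -> (fun x => G f (x, y)) = cst 0%E.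
Proof.
move=> By; apply/funext => x; rewrite /G patchE.
by case: ifPn => // /set_mem[/= _ By'].
Qed.

Lemma rect_meas_sec f x : A x ->
  measurable_fun (A `*` B) (fun z => f z.1 z.2) -> measurable_fun B (f x).
Proof.
move=> Ax /measurable_EFinP /(measurable_restrictT _ mAB).1 mG.
apply/measurable_EFinP; apply/(measurable_restrictT _ mB).
by rewrite -(@G_sec f x Ax); exact: (measurable_fun_pair2 x mG).
Qed.

Lemma rect_tonelli f : measurable_fun (A `*` B) (fun z => f z.1 z.2) ->
  (forall x y, 0 <= f x y) ->
  (\int[m1]_(x in A) \int[m2]_(y in B) (f x y)%:E =
   \int[(m1 \x m2)%E]_(z in A `*` B) (f z.1 z.2)%:E)%E.
Proof.
move=> mf f0; rewrite [RHS]integral_mkcond fubini_tonelli1; last 2 first.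
  by apply/(measurable_restrictT _ mAB); exact/measurable_EFinP.
  by move=> z; apply: erestrict_ge0 => x _; rewrite lee_fin.
rewrite [LHS]integral_mkcond; apply: eq_integral => x _.
rewrite /fubini_F -/(G f) patchE; case: ifPn => [/set_mem Ax|].
  by rewrite [LHS]integral_mkcond -G_sec.
move=> /negP xA; have Ax : ~ A x by move=> Ax; apply: xA; rewrite mem_set.
have -> : (\int[m2]_y G f (x, y) = \int[m2]_y cst 0 y)%E.
  by apply: eq_integral => y _; have /(congr1 (fun h => h y)) := G_secN f Ax.
by rewrite integral0.
Qed.

Section Integrable.
Variable f : T1 -> T2 -> R.
Hypothesis fi : itg (m1 \x m2)%E (A `*` B) (fun z => f z.1 z.2).

Let Gi : (m1 \x m2)%E.-integrable setT (G f).
Proof. exact: (integrable_mkcond _ mAB).1. Qed.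

Lemma rect_ae_itg : {ae m1, forall x, A x -> itg m2 B (f x)}.
Proof.
have := ae_integrable1 Gi; apply: ae_imp => x Hx Ax.
by apply/(integrable_mkcond _ mB); rewrite -(@G_sec f x Ax).
Qed.

Lemma rect_ae_itg2 : {ae m2, forall y, B y -> itg m1 A (f ^~ y)}.
Proof.
have := ae_integrable2 Gi; apply: ae_imp => y Hy By.
by apply/(integrable_mkcond _ mA); rewrite -(@G_sec2 f y By).
Qed.

Let FE x : A x -> fubini_F m2 (G f) x = (\int[m2]_(y in B) (f x y)%:E)%E.
Proof. by move=> Ax; rewrite /fubini_F [RHS]integral_mkcond -(@G_sec f x Ax). Qed.

Let FN x : ~ A x -> fubini_F m2 (G f) x = 0%E.
Proof.
move=> Ax; rewrite /fubini_F -[RHS](integral0 m2 setT).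
by apply: eq_integral => y _; have /(congr1 (fun h => h y)) := G_secN f Ax.
Qed.

Let HE y : B y -> fubini_G m1 (G f) y = (\int[m1]_(x in A) (f x y)%:E)%E.
Proof. by move=> By; rewrite /fubini_G [RHS]integral_mkcond -(@G_sec2 f y By). Qed.

Let HN y : ~ B y -> fubini_G m1 (G f) y = 0%E.
Proof.
move=> By; rewrite /fubini_G -[RHS](integral0 m1 setT).
by apply: eq_integral => x _; have /(congr1 (fun h => h x)) := G_sec2N f By.
Qed.

Lemma rect_itg_Rint : itg m1 A (fun x => \int[m2]_(y in B) f x y).
Proof.
have Fi := integrable_fubini_F Gi.
have FiA : m1.-integrable A (fubini_F m2 (G f)) by apply: integrableS Fi.
have E x : A x -> \int[m2]_(y in B) f x y = fine (fubini_F m2 (G f) x).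
  by move=> Ax; rewrite FE.
have mFA := measurable_int _ FiA.
apply: (le_integrable mA _ _ FiA).
  apply/measurable_EFinP; apply: (@eq_measurable_fun _ _ _ _ _ (fine \o fubini_F m2 (G f))).
    by move=> x /set_mem Ax; rewrite E.
  by apply: measurableT_comp.
(* Where the inner integral is infinite, [fine] gives 0, and the domination is trivial. *)
move=> x Ax; rewrite /= E//; by case: (fubini_F _ _ x) => //= *; rewrite normr0 leey.
Qed.

Lemma rect_fubini1 : \int[m1]_(x in A) (\int[m2]_(y in B) f x y) =
  \int[(m1 \x m2)%E]_(z in A `*` B) f z.1 z.2.
Proof.
rewrite [RHS]/Rintegral [X in _ = fine X]integral_mkcond -/(G f).
rewrite -(integral12_prod_meas1 Gi) Rintegral_mkcond /Rintegral; congr fine.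
have mF : measurable_fun setT (fubini_F m2 (G f)).
  by case/integrableP : (integrable_fubini_F Gi).
apply: ae_eq_integral => //.
  apply/measurable_EFinP; apply: (measurable_restrictT _ mA).1.
  exact: itg_meas rect_itg_Rint.
(* The real and the extended inner integrals are identified on the sections where the function is
   integrable, that is almost everywhere. *)
apply: ae_imp rect_ae_itg => x Hx _; rewrite patchE; case: ifPn => [/set_mem Ax|].
  by rewrite FE//= Rint_EFin//; exact: Hx.
by move=> /negP xA; rewrite FN// => Ax; apply: xA; rewrite mem_set.
Qed.

Lemma rect_meas_Rint2 : measurable_fun B (fun y => \int[m1]_(x in A) f x y).
Proof.
have mG := measurable_fubini_G Gi.
apply: (@eq_measurable_fun _ _ _ _ _ (fine \o fubini_G m1 (G f))).
  by move=> y /set_mem By; rewrite /= HE.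
by apply: measurableT_comp => //; exact: measurable_funS mG.
Qed.

Lemma rect_fubini2 : \int[m2]_(y in B) (\int[m1]_(x in A) f x y) =
  \int[(m1 \x m2)%E]_(z in A `*` B) f z.1 z.2.
Proof.
rewrite [RHS]/Rintegral [X in _ = fine X]integral_mkcond -/(G f).
rewrite -(integral21_prod_meas1 Gi) Rintegral_mkcond /Rintegral; congr fine.
have mF : measurable_fun setT (fubini_G m1 (G f)) by exact: measurable_fubini_G Gi.
apply: ae_eq_integral => //.
  apply/measurable_EFinP; apply: (measurable_restrictT _ mB).1.
  exact: rect_meas_Rint2.
apply: ae_imp rect_ae_itg2 => y Hy _; rewrite patchE; case: ifPn => [/set_mem By|].
  by rewrite HE//= Rint_EFin//; exact: Hy.
by move=> /negP yB; rewrite HN// => By; apply: yB; rewrite mem_set.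
Qed.

End Integrable.

Lemma rect_itg_lty f : measurable_fun (A `*` B) (fun z => f z.1 z.2) ->
  (forall x y, 0 <= f x y) ->
  (\int[m1]_(x in A) \int[m2]_(y in B) (f x y)%:E < +oo)%E ->
  itg (m1 \x m2)%E (A `*` B) (fun z => f z.1 z.2).
Proof.
by move=> mf f0; rewrite rect_tonelli// => foo; apply: itg_lty.
Qed.

Lemma rect_meas1 (h : T1 -> R) : measurable_fun A h ->
  measurable_fun (A `*` B) (fun z => h z.1).
Proof.
move=> mh; apply: (measurable_comp (F := A) _ _ mh) => //.
  by move=> _ [[x y] [/= Ax _] <-].
exact: (measurable_funS measurableT _ measurable_fst).
Qed.

Lemma rect_meas2 (h : T2 -> R) : measurable_fun B h ->
  measurable_fun (A `*` B) (fun z => h z.2).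
Proof.
move=> mh; apply: (measurable_comp (F := B) _ _ mh) => //.
  by move=> _ [[x y] [/= _ By] <-].
exact: (measurable_funS measurableT _ measurable_snd).
Qed.

Lemma rect_itg2 (h : T2 -> R) : (m1 A < +oo)%E -> itg m2 B h ->
  itg (m1 \x m2)%E (A `*` B) (fun z => h z.2).
Proof.
move=> Aoo hi; have mh := rect_meas2 (itg_meas hi).
apply/integrableP; split; first exact/measurable_EFinP.
have := @rect_tonelli (fun _ y => `|h y|) _ _.
rewrite /= => <- //; last by apply: measurableT_comp.
rewrite integral_cst//.
have hia : itg m2 B (fun y => `|h y|) by apply: itgabs.
have hfin := Rint_EFin mB hia.
have hoo : (\int[m2]_(y in B) (`|h y|)%:E < +oo)%E by rewrite -hfin ltry.
rewrite muleC; apply: lte_mul_pinfty => //.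
by rewrite ge0_fin_numE.
Qed.

End RectangleFubini.

(** * Pairings of time-dependent functions with a fixed function of space *)

Section Time.
Context {R : realType}.
Local Notation mu := (@lebesgue_measure R).
Implicit Types (u v w : R -> R -> R) (g h k : R -> R) (l p q s t e : R).

Lemma L2_itg l g : L2 l g ->
  measurable_fun `]0, l[ g /\ itg mu `]0, l[ (fun x => g x ^+ 2).
Proof.
move=> [mg goo]; split => //; apply: itg_lty => //.
  exact: measurable_funX.
by move=> x _; exact: sqr_ge0.
Qed.

Lemma L2L2_itg l p q u : L2L2 l p q u ->
  measurable_fun (`]p, q[ `*` `]0, l[) (fun z : R * R => u z.1 z.2) /\
  itg (mu \x mu)%E (`]p, q[ `*` `]0, l[) (fun z : R * R => u z.1 z.2 ^+ 2).
Proof.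
move=> [m_u uoo]; split => //.
apply: (@rect_itg_lty _ _ _ _ _ mu mu _ _ _ _ (fun t x => u t x ^+ 2)) => //.
  exact: measurable_funX.
by move=> x y; exact: sqr_ge0.
Qed.

Lemma rect_sub l p q p' q' (F : R * R -> R) : p' <= p -> q <= q' ->
  itg (mu \x mu)%E (`]p', q'[ `*` `]0, l[) F ->
  itg (mu \x mu)%E (`]p, q[ `*` `]0, l[) F.
Proof.
move=> pp qq; apply: integrableS.
- exact: measurableX.
- exact: measurableX.
- by move=> [t x] [/= ta xa]; split => //=; move: ta; apply: subset_itv; rewrite bnd_simp.
Qed.

Lemma rect_meas_sub l p q p' q' (F : R * R -> R) : p' <= p -> q <= q' ->
  measurable_fun (`]p', q'[ `*` `]0, l[) F -> measurable_fun (`]p, q[ `*` `]0, l[) F.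
Proof.
move=> pp qq; apply: measurable_funS; first exact: measurableX.
by move=> [t x] [/= ta xa]; split => //=; move: ta; apply: subset_itv; rewrite bnd_simp.
Qed.

Lemma itg_rect_space l p q h : itg mu `]0, l[ h ->
  itg (mu \x mu)%E (`]p, q[ `*` `]0, l[) (fun z : R * R => h z.2).
Proof.
move=> hi; apply: rect_itg2 => //.
rewrite [X in (X < _)%E](lebesgue_measure_itv `]p, q[).
by case: ifP => // _; rewrite -EFinD ltry.
Qed.

Lemma H1L2_eps l p q u t e : H1L2 l p q u -> p <= t <= q -> 0 < e ->
  exists2 de, 0 < de & forall s, p <= s <= q -> `|s - t| < de ->
    \int[mu]_(x in `]0, l[) ((u s x - u t x) ^+ 2) <= e.
Proof.
move=> [_ _ uL2 ucont] tpq e0.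
have tA : t \in `[p, q] by rewrite in_itv.
have /fine_cvgP[_ /cvgrPdist_le/(_ _ e0)[de /= de0 H]] := ucont t tA.
exists de => // s spq st.
have := H s; rewrite /ball_/= distrC => /(_ st).
rewrite in_itv/= => /(_ spq); rewrite sub0r normrN; apply: le_trans.
by rewrite ler_norm.
Qed.

Lemma RintN (D : set R) (f : R -> R) :
  \int[mu]_(x in D) (- f x) = - \int[mu]_(x in D) f x.
Proof.
rewrite /Rintegral [X in fine X = _]integralE [X in _ = - fine X]integralE.
have -> : (fun x => (- f x)%:E) = (\- (fun x => (f x)%:E))%E by [].
rewrite funeposN funenegN.
(* If either part is infinite, [fine] gives 0 on both sides. *)
by case: integral => [a||]; case: integral => [b||] //=; rewrite ?oppr0// opprB.
Qed.

Section Pull.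
Variables (l p q : R) (w : R -> R -> R) (g ka : R -> R) (K : R).
Hypothesis mw : measurable_fun (`]p, q[ `*` `]0, l[) (fun z : R * R => w z.1 z.2).
Hypothesis w2 : itg (mu \x mu)%E (`]p, q[ `*` `]0, l[) (fun z : R * R => w z.1 z.2 ^+ 2).
Hypotheses (mg : measurable_fun `]0, l[ g) (g2 : itg mu `]0, l[ (fun x => g x ^+ 2)).
Hypotheses (mka : measurable_fun `]p, q[ ka)
  (kaK : forall t, `]p, q[%classic t -> `|ka t| <= K).

Let mQ : measurable (`]p, q[%classic `*` `]0, l[%classic : set (R * R)).
Proof. exact: measurableX. Qed.

Lemma rect_itg_pair :
  itg (mu \x mu)%E (`]p, q[ `*` `]0, l[) (fun z : R * R => w z.1 z.2 * g z.2).
Proof.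
apply: itgM2 => //; first exact: rect_meas2.
exact: (itg_rect_space p q g2).
Qed.

Let fi : itg (mu \x mu)%E (`]p, q[ `*` `]0, l[)
  (fun z : R * R => (w z.1 z.2 * g z.2) * ka z.1).
Proof.
apply: (itgMb (K := K) _ rect_itg_pair) => //; first exact: rect_meas1.
by move=> [t x] [/= tA _]; exact: kaK.
Qed.

Let wka : itg (mu \x mu)%E (`]p, q[ `*` `]0, l[) (fun z : R * R => w z.1 z.2 * ka z.1).
Proof.
have wi : itg (mu \x mu)%E (`]p, q[ `*` `]0, l[) (fun z : R * R => w z.1 z.2).
  apply: (@itg_le _ _ _ (mu \x mu)%E _ mQ _ (fun z : R * R => w z.1 z.2 ^+ 2 + 1)) => //.
    move=> z _; rewrite -(real_normK (num_real (w z.1 z.2))).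
    by have := normr_ge0 (w z.1 z.2); nra.
  apply: itgD => //; apply: (@itg_rect_space l p q (fun=> 1)).
  by apply: itg_sub (itg_cst 0 l 1) => //; exact: subset_itv_oo_cc.
apply: (itgMb (K := K) _ wi) => //; first exact: rect_meas1.
by move=> [t x] [/= tA _]; exact: kaK.
Qed.

(** [weak_dt] integrates over time at fixed x, whereas a pairing integrates over space at fixed t.
    This lemma and [rect_pull_space] equate the two orders with one double integral. *)
Lemma rect_pull_time :
  \int[mu]_(t in `]p, q[) ((\int[mu]_(x in `]0, l[) (w t x * g x)) * ka t) =
  \int[(mu \x mu)%E]_(z in `]p, q[ `*` `]0, l[) (w z.1 z.2 * g z.2 * ka z.1).
Proof.
rewrite -(@rect_fubini1 _ _ _ _ _ mu mu `]p, q[ `]0, l[ _ _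
  (fun t x => w t x * g x * ka t))//.
have i1 := @rect_itg_Rint _ _ _ _ _ mu mu `]p, q[ `]0, l[ _ _
  (fun t x => w t x * g x * ka t) fi.
have i2 := @rect_itg_Rint _ _ _ _ _ mu mu `]p, q[ `]0, l[ _ _
  (fun t x => w t x * g x) rect_itg_pair.
have i3 := @rect_ae_itg _ _ _ _ _ mu mu `]p, q[ `]0, l[ _ _
  (fun t x => w t x * g x) rect_itg_pair.
apply: Rint_ae => //.
- by apply: measurable_funM => //; apply: (itg_meas (i2 _ _)).
- exact: (itg_meas (i1 _ _)).
- apply: ae_imp (i3 _ _) => // t Ht tA.
  by rewrite RintegralZr//; exact: Ht.
Qed.

Lemma rect_meas_space : measurable_fun `]0, l[ (fun x => \int[mu]_(t in `]p, q[) (w t x * ka t)).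
Proof.
by apply: (@rect_meas_Rint2 _ _ _ _ _ mu mu `]p, q[ `]0, l[ _ _
  (fun t x => w t x * ka t) wka).
Qed.

Lemma rect_pull_space :
  \int[mu]_(x in `]0, l[) ((\int[mu]_(t in `]p, q[) (w t x * ka t)) * g x) =
  \int[(mu \x mu)%E]_(z in `]p, q[ `*` `]0, l[) (w z.1 z.2 * g z.2 * ka z.1).
Proof.
rewrite -(@rect_fubini2 _ _ _ _ _ mu mu `]p, q[ `]0, l[ _ _
  (fun t x => w t x * g x * ka t))//.
have i1 := @rect_meas_Rint2 _ _ _ _ _ mu mu `]p, q[ `]0, l[ _ _
  (fun t x => w t x * g x * ka t) fi.
have i3 := @rect_ae_itg2 _ _ _ _ _ mu mu `]p, q[ `]0, l[ _ _
  (fun t x => w t x * ka t) wka.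
apply: Rint_ae => //.
- by apply: measurable_funM => //; exact: rect_meas_space.
- exact: (i1 _ _).
- apply: ae_imp (i3 _ _) => // x Hx xA.
  rewrite -RintegralZr//; last exact: Hx.
  by apply: eq_Rintegral => t _; rewrite mulrAC.
Qed.

End Pull.

Lemma test_fun_cont p q (th : R -> R) : test_fun p q th ->
  continuous th /\ continuous (derive1 th).
Proof.
move=> [sm _]; split => x; apply: differentiable_continuous; apply/derivable1_diffP.
  by have := sm x 0%N; rewrite derive1n0.
by have := sm x 1%N; rewrite derive1n1.
Qed.

Lemma cont_bounded p q (f : R -> R) : continuous f -> exists K,
  forall t, `]p, q[%classic t -> `|f t| <= K.
Proof.
move=> cf; have [K HK] := within_bounded (p := p) (q := q) (continuous_subspaceT cf).
by exists K => t; rewrite /= in_itv/= => /andP[pt tq]; apply: HK; rewrite !ltW.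
Qed.

Lemma cont_meas (D : set R) (f : R -> R) : continuous f -> measurable_fun D f.
Proof. by move=> cf; apply: measurable_funS (continuous_measurable_fun cf). Qed.

(** Exchanging the integrations turns the identity valid at almost every x into the statement that t
    |-> \int u(t) g has a scalar weak derivative. *)
Lemma pairing_weak l p q u g (th : R -> R) : H1L2 l p q u -> L2 l g ->
  test_fun p q th ->
  \int[mu]_(t in `]p, q[) ((\int[mu]_(x in `]0, l[) (u t x * g x)) * derive1 th t) =
  - \int[mu]_(t in `]p, q[) ((\int[mu]_(x in `]0, l[) (dt l p q u t x * g x)) * th t).
Proof.
move=> [uL2 [duL2 wd] _ _] /L2_itg[mg g2] tth.
have [m_u u2] := L2L2_itg uL2; have [mdu du2] := L2L2_itg duL2.
have [cth cdth] := test_fun_cont tth.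
have [K HK] := cont_bounded p q cth.
have [K' HK'] := cont_bounded p q cdth.
have mth : measurable_fun `]p, q[ th by exact: cont_meas.
have mdth : measurable_fun `]p, q[ (derive1 th) by exact: cont_meas.
rewrite (rect_pull_time m_u u2 mg g2 mdth HK') -(rect_pull_space m_u u2 mg g2 mdth HK').
rewrite (rect_pull_time mdu du2 mg g2 mth HK) -(rect_pull_space mdu du2 mg g2 mth HK).
have m1 := rect_meas_space m_u u2 mdth HK'.
have m2 := rect_meas_space mdu du2 mth HK.
transitivity (\int[mu]_(x in `]0, l[)
    (- ((\int[mu]_(t in `]p, q[) (dt l p q u t x * th t)) * g x))).
  apply: Rint_ae => //.
  - exact: measurable_funM.
  - by apply: measurableT_comp => //; exact: measurable_funM.
  - apply: ae_imp (wd _ tth) => x Hx xA.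
    by rewrite (Hx xA) mulNr.
exact: RintN.
Qed.


Lemma pair_sq l g h : L2 l g -> L2 l h ->
  (\int[mu]_(x in `]0, l[) (g x * h x)) ^+ 2 <=
  \int[mu]_(x in `]0, l[) (g x ^+ 2) * \int[mu]_(x in `]0, l[) (h x ^+ 2).
Proof. by move=> /L2_itg[mg g2] /L2_itg[mh h2]; exact: cauchy_schwarz. Qed.

Lemma pairB l g g' h : L2 l g -> L2 l g' -> L2 l h ->
  \int[mu]_(x in `]0, l[) ((g x - g' x) * h x) =
  \int[mu]_(x in `]0, l[) (g x * h x) - \int[mu]_(x in `]0, l[) (g' x * h x).
Proof.
move=> /L2_itg[mg g2] /L2_itg[mg' g2'] /L2_itg[mh h2].
rewrite -RintegralB//; [|exact: itgM2..].
by apply: eq_Rintegral => x _; rewrite mulrBl.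
Qed.

Lemma L2B l g h : L2 l g -> L2 l h -> L2 l (fun x => g x - h x).
Proof.
move=> /L2_itg[mg g2] /L2_itg[mh h2]; split; first exact: measurable_funB.
have : itg mu `]0, l[ (fun x => (g x - h x) ^+ 2) by apply: itgB2.
by move=> i; rewrite -Rint_EFin ?ltry.
Qed.

(** As u is continuous in time with values in L^2, the pairing is continuous and [weak_FTC] applies
    at all interior times; the end times are then reached by continuity. *)
Lemma pairing_FTC l p q u g : p < q -> H1L2 l p q u -> L2 l g ->
  itg mu `[p, q] (fun r => \int[mu]_(x in `]0, l[) (dt l p q u r x * g x)) /\
  forall s t, p <= s -> s <= t -> t <= q ->
    \int[mu]_(x in `]0, l[) (u t x * g x) - \int[mu]_(x in `]0, l[) (u s x * g x) =
    \int[mu]_(r in `[s, t]) \int[mu]_(x in `]0, l[) (dt l p q u r x * g x).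
Proof.
move=> pq uH gL2; have [uL2 [duL2 wd] uL ucont] := uH.
have [mg g2] := L2_itg gL2.
have [mdu du2] := L2L2_itg duL2.
pose U t := \int[mu]_(x in `]0, l[) (u t x * g x).
pose W r := \int[mu]_(x in `]0, l[) (dt l p q u r x * g x).
have iW : itg mu `[p, q] W.
  apply: itg_oo_cc.
  exact: (@rect_itg_Rint _ _ _ _ _ mu mu `]p, q[ `]0, l[ _ _
    (fun r x => dt l p q u r x * g x) (rect_itg_pair mdu du2 mg g2)).
split=> //.
set A := \int[mu]_(x in `]0, l[) (g x ^+ 2).
have A0 : 0 <= A by apply: Rintegral_ge0 => x _; exact: sqr_ge0.
have Ueps t e : p <= t <= q -> 0 < e -> exists2 de, 0 < de & forall s,
    p <= s <= q -> `|s - t| < de -> `|U s - U t| <= e.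
  (* Chosen so that Cauchy-Schwarz, which multiplies by A, leaves at most e^2; the +1 covers A =
     0. *)
  move=> tpq e0; have e2 : 0 < e ^+ 2 / (A + 1) by rewrite divr_gt0 ?exprn_gt0// ltr_wpDl.
  have [de de0 H] := H1L2_eps uH tpq e2; exists de => // s spq st.
  have us : L2 l (u s) by apply: uL; rewrite in_itv.
  have ut : L2 l (u t) by apply: uL; rewrite in_itv.
  rewrite /U -pairB// -(@ler_pXn2r _ 2)// ?nnegrE ?(ltW e0)// real_normK ?num_real//.
  apply: le_trans (pair_sq (L2B us ut) gL2) _.
  apply: le_trans (ler_wpM2r A0 (H s spq st)) _.
  rewrite mulrAC ler_pdivrMr ?ltr_wpDl// ler_wpM2l ?sqr_ge0// lerDl//.
have Ucont t : p < t < q -> {for t, continuous U}.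
  move=> /andP[pt tq]; apply/cvgrPdist_le => e e0.
  have tpq : p <= t <= q by rewrite !ltW.
  have [de de0 H] := Ueps t e tpq e0.
  near=> s; rewrite distrC; apply: H.
    by apply/andP; split; apply: ltW; near: s; [exact: lt_nbhsr|exact: lt_nbhsl].
  near: s; exists de => //= s; by rewrite /ball_/= distrC.
have cU : {within `[p, q], continuous U}.
  apply/subspace_continuousP => t; rewrite /= in_itv/= => tpq.
  apply/cvgrPdist_le => e e0; have [de de0 H] := Ueps t e tpq e0.
  near=> s; rewrite distrC; apply: H.
    suff : `[p, q]%classic s by rewrite /= in_itv.
    by near: s; exact: withinT.
  near: s; apply: cvg_within; exists de => //= s; by rewrite /ball_/= distrC.
have iU : itg mu `[p, q] U.
  by apply: continuous_compact_integrable => //; exact: segment_compact.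
have FTC s t : p < s -> s < t -> t < q -> U t - U s = \int[mu]_(r in `[s, t]) W r.
  move=> ps st tq; have t1 : t < (t + q) / 2 by lra.
  have t2 : (t + q) / 2 < q by lra.
  have sub x : p <= x -> x <= (t + q) / 2 -> `[x, (t + q) / 2] `<=` `[p, q].
    move=> px xq; apply: subset_itv; rewrite bnd_simp// ltW//.
  have tb : t <= (t + q) / 2 by exact: ltW.
  have sb : s <= (t + q) / 2 by rewrite ltW// (lt_trans st).
  have iUs : itg mu `[s, (t + q) / 2] U by apply: itg_sub (sub s (ltW ps) sb) iU.
  have pt : p < t by exact: lt_trans st.
  have iUt : itg mu `[t, (t + q) / 2] U by apply: itg_sub (sub t (ltW pt) tb) iU.
  have iWs : itg mu `[s, (t + q) / 2] W by apply: itg_sub (sub s (ltW ps) sb) iW.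
  apply: (weak_FTC ps st t1 t2 iUs iWs).
  - by move=> th tth; exact: (pairing_weak uH gL2 tth).
  - apply: (continuous_right_lebesgue_pt (lt_trans st t1) iUs).
    by apply: Ucont; rewrite ps (lt_trans st).
  - apply: (continuous_right_lebesgue_pt t1 iUt).
    by apply: Ucont; rewrite tq (lt_trans ps).
(* Constant on the open interval and continuous on the closed one. *)
pose Phi t := U t - \int[mu]_(r in `[p, t]) W r.
have cPhi : {within `[p, q], continuous Phi}.
  move=> x; apply: cvgB; first exact: cU.
  exact: (parameterized_integral_continuous (ltW pq) iW).
have PhiE s t : p <= s -> s <= t -> t <= q ->
    Phi t - Phi s = U t - U s - \int[mu]_(r in `[s, t]) W r.
  move=> ps st tq; have iWt : itg mu `[p, t] W.
    by apply: itg_sub iW => //; apply: subset_itvl; rewrite bnd_simp.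
  by rewrite /Phi (Rint_split ps st iWt); ring.
move=> s t ps st tq.
suff : Phi t - Phi s = 0 by rewrite PhiE// => /eqP; rewrite subr_eq0 => /eqP.
move: st; rewrite le_eqVlt => /predU1P[->|st]; first by rewrite subrr.
apply/eqP; rewrite -normr_le0; apply: (@le_of_eps _ _ _ 2) => // e e0.
have spq : p <= s <= q by rewrite ps (le_trans (ltW st)).
have tpq : p <= t <= q by rewrite tq (le_trans ps)// ltW.
have [d1 d10 H1] := within_eps cPhi spq e0.
have [d2 d20 H2] := within_eps cPhi tpq e0.
pose d := Num.min (Num.min d1 d2) (t - s).
have d0 : 0 < d by rewrite !lt_min d10 d20 subr_gt0.
have dd1 : d <= d1 by rewrite !ge_min lexx.
have dd2 : d <= d2 by rewrite !ge_min lexx orbT.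
have dts : d <= t - s by rewrite ge_min lexx orbT.
clearbody d.
(* As d <= t - s, shifts by d/3 inwards give two interior times still in the right order. *)
have h1 := H1 (s + d / 3); have h2 := H2 (t - d / 3).
have d3 : 0 < d / 3 by rewrite divr_gt0.
have d3d : d / 3 < d by clear -d0; lra.
have sdq : s + d / 3 < t - d / 3 by clear -dts d0; lra.
have ps' : p < s + d / 3 by exact: le_lt_trans ps (ltr_pwDr d3 (lexx s)).
have tq' : t - d / 3 < q by apply: lt_le_trans tq; rewrite ltrBlDr ltrDl.
have a1 : p <= s + d / 3 <= q by rewrite (ltW ps') ltW// (lt_trans sdq).
have a2 : `|s + d / 3 - s| < d1.
  by rewrite addrAC subrr add0r gtr0_norm// (lt_le_trans d3d).
have a3 : p <= t - d / 3 <= q by rewrite (ltW tq') andbT ltW// (lt_trans ps').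
have a4 : `|t - d / 3 - t| < d2.
  by rewrite addrAC subrr add0r normrN gtr0_norm// (lt_le_trans d3d).
have E : Phi (t - d / 3) = Phi (s + d / 3).
  by apply/eqP; rewrite -subr_eq0 PhiE ?ltW// FTC// subrr.
have -> : Phi t - Phi s = (Phi (s + d / 3) - Phi s) - (Phi (t - d / 3) - Phi t).
  by rewrite E; ring.
rewrite add0r; apply: le_trans (ler_normB _ _) _.
by rewrite mulr_natl mulr2n lerD ?h1 ?h2.
Unshelve. all: by end_near. Qed.

End Time.

(** * Integration by parts in time and the dual identity *)

Section Dual.
Context {R : realType}.
Local Notation mu := (@lebesgue_measure R).
Implicit Types (u v w : R -> R -> R) (g h k a : R -> R) (l p q s t e : R).

Lemma ae_neq p : {ae mu, forall x, x != p}.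
Proof.
exists [set p]; split => //; first by rewrite /= lebesgue_measure_set1.
by move=> x /= /negP; rewrite negbK => /eqP.
Qed.

Lemma L2L2_ae_L2 l p q u : L2L2 l p q u ->
  {ae mu, forall t, p < t < q -> L2 l (u t)}.
Proof.
move=> /L2L2_itg[m_u u2].
have := @rect_ae_itg _ _ _ _ _ mu mu `]p, q[ `]0, l[ (measurable_itv _) (measurable_itv _)
  (fun t x => u t x ^+ 2) u2.
apply: ae_imp => t Ht tpq.
have tA : `]p, q[%classic t by rewrite /= in_itv.
split; first exact: (@rect_meas_sec _ _ _ _ _ `]p, q[ `]0, l[ _ _ u t tA m_u).
by have i := Ht tA; rewrite -Rint_EFin ?ltry.
Qed.

Lemma pairC l g h :
  \int[mu]_(x in `]0, l[) (g x * h x) = \int[mu]_(x in `]0, l[) (h x * g x).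
Proof. by apply: eq_Rintegral => x _; rewrite mulrC. Qed.

(** Cauchy-Schwarz gives e sqrt(X), and sqrt(X) <= 1 + X. The linear form matters because X will be
    the squared norm of a time derivative, whose integral in time is finite. *)
Lemma pair_small l g h h' e X : L2 l g -> L2 l h -> L2 l h' -> 0 < e ->
  \int[mu]_(x in `]0, l[) (g x ^+ 2) <= X ->
  \int[mu]_(x in `]0, l[) ((h x - h' x) ^+ 2) <= e ^+ 2 ->
  `|\int[mu]_(x in `]0, l[) (h x * g x) - \int[mu]_(x in `]0, l[) (h' x * g x)|
    <= e * (1 + X).
Proof.
move=> gL hL hL' e0 gX he; rewrite -pairB//.
have A0 : 0 <= \int[mu]_(x in `]0, l[) (g x ^+ 2).
  by apply: Rintegral_ge0 => x _; exact: sqr_ge0.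
have X0 : 0 <= X by exact: le_trans gX.
have eX : 0 <= e * (1 + X) by rewrite mulr_ge0 ?addr_ge0// ltW.
rewrite -(@ler_pXn2r _ 2)// ?nnegrE// real_normK ?num_real//.
apply: le_trans (pair_sq (L2B hL hL') gL) _.
apply: le_trans (ler_wpM2r A0 he) _.
rewrite exprMn ler_wpM2l ?sqr_ge0//; apply: le_trans gX _; nra.
Qed.

Lemma rect_itgM l p q u v :
  L2L2 l p q u -> L2L2 l p q v ->
  itg (mu \x mu)%E (`]p, q[ `*` `]0, l[) (fun z : R * R => u z.1 z.2 * v z.1 z.2).
Proof.
move=> /L2L2_itg[m_u u2] /L2L2_itg[mv v2]; apply: itgM2 => //.
exact: measurableX.
Qed.

Lemma L2L2_sub l p q p' q' u : p' <= p -> q <= q' -> L2L2 l p' q' u -> L2L2 l p q u.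
Proof.
move=> pp qq uL; have [m_u u2] := L2L2_itg uL.
have m_u' := rect_meas_sub pp qq m_u; split => //.
rewrite (@rect_tonelli _ _ _ _ _ mu mu _ _ _ _ (fun t x => u t x ^+ 2))//; last 2 first.
  exact: measurable_funX.
  by move=> x y; exact: sqr_ge0.
have u2' := rect_sub pp qq u2.
by rewrite -Rint_EFin ?ltry//; exact: measurableX.
Qed.

(** [diag_FTC] for B(s,t) = \int u(s) v(t), with [pairing_FTC] in each variable. The function u
    lives on a longer interval than v, and its derivative [dt l t0 q u] is kept relative to that
    interval. *)
Lemma time_IBP l t0 p q u v : t0 <= p -> p < q -> H1L2 l t0 q u -> H1L2 l p q v ->
  \int[mu]_(x in `]0, l[) (u q x * v q x) - \int[mu]_(x in `]0, l[) (u p x * v p x) =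
  \int[(mu \x mu)%E]_(z in `]p, q[ `*` `]0, l[) (dt l t0 q u z.1 z.2 * v z.1 z.2)
  + \int[(mu \x mu)%E]_(z in `]p, q[ `*` `]0, l[) (dt l p q v z.1 z.2 * u z.1 z.2).
Proof.
move=> t0p pq uH vH; have t0q : t0 < q by exact: le_lt_trans pq.
have [uL2 [duL2 _] uL _] := uH; have [vL2 [dvL2 _] vL _] := vH.
set du := dt l t0 q u in duL2 *; set dv := dt l p q v in dvL2 *.
have uL2' := L2L2_sub t0p (lexx q) uL2.
have duL2' := L2L2_sub t0p (lexx q) duL2.
have uLt t : p <= t <= q -> L2 l (u t).
  by move=> /andP[pt tq]; apply: uL; rewrite in_itv/= tq (le_trans t0p).
have vLt t : p <= t <= q -> L2 l (v t) by move=> tpq; apply: vL; rewrite in_itv.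
pose B s t := \int[mu]_(x in `]0, l[) (u s x * v t x).
pose b1 r t := \int[mu]_(x in `]0, l[) (du r x * v t x).
pose b2 s r := \int[mu]_(x in `]0, l[) (dv r x * u s x).
have i1 := rect_itgM duL2' vL2; have i2 := rect_itgM dvL2 uL2'.
have mI (D : interval R) : measurable [set` D] by exact: measurable_itv.
have ib1 : itg mu `[p, q] (fun r => b1 r r).
  apply: itg_oo_cc; exact: (@rect_itg_Rint _ _ _ _ _ mu mu `]p, q[ `]0, l[ (mI _) (mI _)
    (fun r x => du r x * v r x) i1).
have ib2 : itg mu `[p, q] (fun r => b2 r r).
  apply: itg_oo_cc; exact: (@rect_itg_Rint _ _ _ _ _ mu mu `]p, q[ `]0, l[ (mI _) (mI _)
    (fun r x => dv r x * u r x) i2).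
pose m r := (1 + \int[mu]_(x in `]0, l[) (du r x ^+ 2))
  + \int[mu]_(x in `]0, l[) (dv r x ^+ 2).
have [_ du2] := L2L2_itg duL2'; have [_ dv2] := L2L2_itg dvL2.
have im : itg mu `[p, q] m.
  apply: itgD => //; first (apply: itgD => //; first exact: itg_cst).
  - apply: itg_oo_cc; exact: (@rect_itg_Rint _ _ _ _ _ mu mu `]p, q[ `]0, l[ (mI _) (mI _)
      (fun r x => du r x ^+ 2) du2).
  - apply: itg_oo_cc; exact: (@rect_itg_Rint _ _ _ _ _ mu mu `]p, q[ `]0, l[ (mI _) (mI _)
      (fun r x => dv r x ^+ 2) dv2).
have sq0 g : 0 <= \int[mu]_(x in `]0, l[) (g x ^+ 2).
  by apply: Rintegral_ge0 => x _; exact: sqr_ge0.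
have sub : `[p, q] `<=` `[t0, q] by apply: subset_itvr; rewrite bnd_simp.
have D : B q q - B p p = \int[mu]_(r in `[p, q]) (b1 r r + b2 r r).
  apply: (@diag_FTC R B b1 b2 m) => //.
  - exact: ltW.
  - by move=> t /vLt vt; have [H _] := pairing_FTC t0q uH vt; apply: itg_sub sub H.
  - by move=> s /uLt us; have [H _] := pairing_FTC pq vH us.
  - move=> s s' t ps ss sq /vLt vt; have [_ H] := pairing_FTC t0q uH vt.
    by apply: H => //; exact: le_trans ps.
  - move=> s t t' pt tt tq /uLt us; have [_ H] := pairing_FTC pq vH us.
    by rewrite /B !(pairC _ (u s)); exact: H.
  - exact: itgD.
  - by move=> r _; rewrite !addr_ge0.
  - move=> r0 e r0pq e0; have e20 : 0 < e ^+ 2 by rewrite exprn_gt0.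
    have r0pq' : t0 <= r0 <= q by case/andP : r0pq => ? ->; rewrite (le_trans t0p).
    have [d1 d10 H1] := H1L2_eps uH r0pq' e20.
    have [d2 d20 H2] := H1L2_eps vH r0pq e20.
    exists (Num.min d1 d2); first by rewrite lt_min d10.
    (* The end times are discarded as a null set, the derivatives being known to be in L^2(0,l) only
       at almost every interior time. *)
    apply: ae_imp (ae_and (ae_and (L2L2_ae_L2 duL2') (L2L2_ae_L2 dvL2))
      (ae_and (ae_neq p) (ae_neq q))) => r [[Hdu Hdv] [rp rq]] /andP[pr rq'] t tpq.
    have rpq : p < r < q by rewrite !lt_neqAle eq_sym rp pr rq rq'.
    rewrite lt_min => /andP[t1 t2].
    have tpq' : t0 <= t <= q by case/andP : tpq => ? ->; rewrite (le_trans t0p).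
    have h1 := H1 t tpq' t1; have h2 := H2 t tpq t2.
    split.
      rewrite /b1 !(pairC _ (du r)).
      apply: le_trans (pair_small (Hdu rpq) (vLt _ tpq) (vLt _ r0pq) e0 (lexx _) h2) _.
      by rewrite /m ler_wpM2l ?(ltW e0)// lerDl.
    rewrite /b2 !(pairC _ (dv r)).
    apply: le_trans (pair_small (Hdv rpq) (uLt _ tpq) (uLt _ r0pq) e0 (lexx _) h1) _.
    by rewrite /m ler_wpM2l ?(ltW e0)// addrAC lerDl.
rewrite -/(B q q) -/(B p p) D RintegralD// -!Rint_oo_cc//.
congr (_ + _).
- exact: (@rect_fubini1 _ _ _ _ _ mu mu `]p, q[ `]0, l[ (mI _) (mI _)
    (fun r x => du r x * v r x) i1).
- exact: (@rect_fubini1 _ _ _ _ _ mu mu `]p, q[ `]0, l[ (mI _) (mI _)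
    (fun r x => dv r x * u r x) i2).
Qed.

Lemma L2Ha_ae l a p q u : measurable_fun `]0, l[ a ->
  (forall x, x \in `]0, l[ -> 0 < a x) -> L2Ha l a p q u ->
  {ae mu, forall t, p < t < q -> Ha l a (u t) /\
     itg mu `]0, l[ (fun x => a x * grad l (u t) x ^+ 2)}.
Proof.
move=> ma a0 [m_u [du [mdu duE duoo]]].
have mI (D : interval R) : measurable [set` D] by exact: measurable_itv.
(* The sign of [a] is known only inside (0,l); the absolute value makes the integrand nonnegative
   everywhere, as Tonelli is stated here. *)
pose b x := `|a x|.
have mb : measurable_fun `]0, l[ b by exact: measurableT_comp.
pose f t x := b x * (u t x ^+ 2 + du t x ^+ 2).
have mf : measurable_fun (`]p, q[ `*` `]0, l[) (fun z : R * R => f z.1 z.2).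
  apply: measurable_funM.
    exact: rect_meas2.
  by apply: measurable_funD; exact: measurable_funX.
have f0 x y : 0 <= f x y.
  by rewrite /f /b mulr_ge0 ?addr_ge0 ?sqr_ge0.
have fi : itg (mu \x mu)%E (`]p, q[ `*` `]0, l[) (fun z : R * R => f z.1 z.2).
  apply: rect_itg_lty; [exact: mI|exact: mI|exact: mf|exact: f0|].
  apply: le_lt_trans duoo.
  rewrite le_eqVlt; apply/orP; left; apply/eqP.
  apply: eq_integral => t _; apply: eq_integral => x /set_mem xl.
  by rewrite /f /b gtr0_norm// a0.
apply: ae_imp (ae_and duE (@rect_ae_itg _ _ _ _ _ mu mu _ _ (mI _) (mI _) f fi)) => t [H1 H2] tpq.
have tA : t \in `]p, q[ by rewrite in_itv.
have [Hat Hd] := H1 tA; split => //.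
have [[_ [mg _ _] _] _] := Hat.
have fti := H2 tA.
have mdt : measurable_fun `]0, l[ (du t).
  exact: (@rect_meas_sec _ _ _ _ _ `]p, q[ `]0, l[ (mI _) (mI _) du t tA mdu).
have i1 : itg mu `]0, l[ (fun x => a x * du t x ^+ 2).
  apply: (@itg_le _ _ _ mu _ _ _ (f t)) => //.
    by apply: measurable_funM => //; exact: measurable_funX.
  by move=> x xl; rewrite /f /b normrM (ger0_norm (sqr_ge0 _)) ler_wpM2l// lerDr sqr_ge0.
apply: itg_ae i1 => //.
  by apply: measurable_funM => //; exact: measurable_funX.
by apply: ae_imp Hd => x Hx xl; rewrite Hx.
Qed.

(** At almost every time phi(t) lies in L^2 and in the weighted space, so it is a legitimate test
    function in the equation of u. *)
Lemma weak_solution_dual l T sigma a phi0 K (q : R -> R) (be : R) u phi divphi :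
  0 < l -> 0 < sigma -> sigma < T -> 0 <= K -> measurable_fun `]0, l[ a ->
  (forall x, 0 < x < l -> 0 < a x /\ a x <= K * x /\ a x <= K * (l - x)) ->
  measurable_fun `]0, l[ q -> (forall x, x \in `]0, l[ -> `|q x| <= be) ->
  weak_solution l T a phi0 q u ->
  H10L2 l (T - sigma) T phi -> L2Ha l a (T - sigma) T phi ->
  L2L2 l (T - sigma) T divphi ->
  {ae mu, forall t, t \in `]T - sigma, T[ ->
     weak_deriv l (fun x => a x * grad l (phi t) x) (divphi t)} ->
  \int[(mu \x mu)%E]_(z in `](T - sigma), T[ `*` `]0, l[)
    (u z.1 z.2 * (dt l (T - sigma) T phi z.1 z.2 + divphi z.1 z.2
       - q z.2 * phi z.1 z.2)) = 0.
Proof.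
move=> l0 s0 sT K0 ma aK mq qbe [uH uHa _ ueq] [phiH phi_p phi_T] phiHa divL2 divE.
set p := T - sigma in phiH phi_p phiHa divL2 divE *.
have p0 : 0 <= p by rewrite subr_ge0 ltW.
have pT : p < T by rewrite ltrBlDr ltrDl.
have mI (D : interval R) : measurable [set` D] by exact: measurable_itv.
have [uL2 [duL2 _] uL _] := uH; have [phiL2 [dphiL2 _] phiL _] := phiH.
set du := dt l 0 T u in duL2 ueq *; set dphi := dt l p T phi in dphiL2 *.
have uL2' := L2L2_sub p0 (lexx T) uL2; have duL2' := L2L2_sub p0 (lexx T) duL2.
have a0 x : x \in `]0, l[ -> 0 < a x.
  by rewrite in_itv/= => xl; have [] := aK _ xl.
have i1 := rect_itgM duL2' phiL2; have i2 := rect_itgM dphiL2 uL2'.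
have i3 := rect_itgM uL2' divL2; have i4 := rect_itgM uL2' phiL2.
have i5 : itg (mu \x mu)%E (`]p, T[ `*` `]0, l[)
    (fun z : R * R => u z.1 z.2 * phi z.1 z.2 * q z.2).
  apply: (itgMb (K := be) _ i4); [exact: measurableX|exact: rect_meas2|].
  by move=> [t x] [/= _ xl]; apply: qbe; rewrite inE.
have IBP := time_IBP p0 pT uH phiH.
have mul0 g h : {ae mu, forall x, x \in `]0, l[ -> h x = 0} ->
    L2 l g -> L2 l h -> \int[mu]_(x in `]0, l[) (g x * h x) = 0.
  move=> h0 /L2_itg[mg _] /L2_itg[mh _].
  rewrite (@Rint_ae _ _ _ mu `]0, l[ (mI _) _ (fun=> 0)).
  - by rewrite Rintegral_cst// mul0r.
  - exact: measurable_funM.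
  - exact: measurable_cst.
  - by apply: ae_imp h0 => x Hx xl; rewrite Hx ?mulr0.
rewrite (mul0 (u T) (phi T)) ?(mul0 (u p) (phi p)) ?subrr// in IBP; last 4 first.
  by apply: uL; rewrite in_itv/= p0 ltW.
  by apply: phiL; rewrite in_itv/= lexx ltW.
  by apply: uL; rewrite in_itv/= lexx andbT ltW// (le_lt_trans p0).
  by apply: phiL; rewrite in_itv/= lexx ltW.
(* The equation tested with phi and integrated over time, once the space derivatives have been moved
   onto phi. *)
have EQ : \int[(mu \x mu)%E]_(z in `]p, T[ `*` `]0, l[) (du z.1 z.2 * phi z.1 z.2
    - u z.1 z.2 * divphi z.1 z.2 + u z.1 z.2 * phi z.1 z.2 * q z.2) = 0.
  have i6 : itg (mu \x mu)%E (`]p, T[ `*` `]0, l[) (fun z : R * R => du z.1 z.2 * phi z.1 z.2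
      - u z.1 z.2 * divphi z.1 z.2 + u z.1 z.2 * phi z.1 z.2 * q z.2).
    by apply: itgD; [exact: measurableX|apply: itgB => //; exact: measurableX|].
  rewrite -(@rect_fubini1 _ _ _ _ _ mu mu `]p, T[ `]0, l[ (mI _) (mI _)
    (fun t x => du t x * phi t x - u t x * divphi t x + u t x * phi t x * q x) i6).
  have i7 := @rect_itg_Rint _ _ _ _ _ mu mu `]p, T[ `]0, l[ (mI _) (mI _)
    (fun t x => du t x * phi t x - u t x * divphi t x + u t x * phi t x * q x) i6.
  rewrite (@Rint_ae _ _ _ mu `]p, T[ (mI _) _ (fun=> 0)).
  - by rewrite Rintegral_cst// mul0r.
  - exact: itg_meas i7.
  - exact: measurable_cst.
  have f1 := @rect_ae_itg _ _ _ _ _ mu mu `]p, T[ `]0, l[ (mI _) (mI _)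
    (fun t x => du t x * phi t x) i1.
  have f3 := @rect_ae_itg _ _ _ _ _ mu mu `]p, T[ `]0, l[ (mI _) (mI _)
    (fun t x => u t x * divphi t x) i3.
  have f5 := @rect_ae_itg _ _ _ _ _ mu mu `]p, T[ `]0, l[ (mI _) (mI _)
    (fun t x => u t x * phi t x * q x) i5.
  have f := ae_and (ae_and f1 (ae_and f3 f5)) (ae_and (ae_and ueq divE)
    (ae_and (L2Ha_ae ma a0 uHa) (ae_and (L2Ha_ae ma a0 phiHa) (L2L2_ae_L2 divL2)))).
  apply: ae_imp f => t [[g1 [g3 g5]] [[Hu Hdiv] [Hua [Hphi Hd]]]] tA.
  have tpT : p < t < T by move: tA; rewrite /= in_itv.
  have [pt tT] := andP tpT.
  have t0T : 0 < t < T by rewrite tT (le_lt_trans p0).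
  have [Hau iau] := Hua t0T; have [Haphi iaphi] := Hphi tpT.
  have phit : L2 l (phi t) by apply: phiL; rewrite in_itv/= !ltW.
  have ut : L2 l (u t) by apply: uL; rewrite in_itv/= (le_trans p0) ?ltW.
  have [mut ut2] := L2_itg ut; have [_ div2] := L2_itg (Hd tpT).
  have tA' : t \in `]0, T] by rewrite in_itv/= (le_lt_trans p0)//= ltW.
  have := Hu tA' (phi t) phit Haphi.
  have wd := Hdiv tA.
  have [[_ [mgphi _ _] _] _] := Haphi; have [wdu _] := Hau.
  (* The factors are swapped so that [a] goes with the gradient of phi, the flux whose divergence is
     given. *)
  have -> : \int[mu]_(x in `]0, l[) (a x * grad l (u t) x * grad l (phi t) x) =
      \int[mu]_(x in `]0, l[) (a x * grad l (phi t) x * grad l (u t) x).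
    by apply: eq_Rintegral => x _; ring.
  have [_ ->] := space_IBP l0 K0 aK ma wd (fun x _ => erefl) mgphi iaphi div2 wdu ut2 iau.
  have gd := g1 tA; have gu := g3 tA; have gq := g5 tA.
  rewrite RintegralD//; last exact: itgB.
  rewrite RintegralB// => E0; rewrite -[RHS]E0; congr (_ + _ + _).
    by rewrite pairC.
  by apply: eq_Rintegral => x _; ring.
transitivity (\int[(mu \x mu)%E]_(z in `]p, T[ `*` `]0, l[) (dphi z.1 z.2 * u z.1 z.2
    + u z.1 z.2 * divphi z.1 z.2 - u z.1 z.2 * phi z.1 z.2 * q z.2)).
  by apply: eq_Rintegral => z _; ring.
rewrite RintegralB; [|exact: measurableX|by apply: itgD => //; exact: measurableX|by []].
rewrite RintegralD; [|exact: measurableX|by []|by []].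
move: EQ; rewrite RintegralD; [|exact: measurableX|by apply: itgB => //; exact: measurableX|by []].
rewrite RintegralB; [|exact: measurableX|by []|by []].
move: IBP; rewrite -/du -/dphi.
set I1 := Rintegral _ _ _; set I2 := Rintegral _ _ _.
set I3 := Rintegral _ _ _; set I4 := Rintegral _ _ _.
clearbody I1 I2 I3 I4; clear; lra.
Qed.

End Dual.

(** * The final inequality and its constants *)

Section Estimate.
Context {R : realType}.
Local Notation mu := (@lebesgue_measure R).

(** The mean value theorem from each end, with K a bound of |a'| on [0,l]. *)
Lemma C1_bound (l : R) (a : R -> R) : 0 < l -> C1 l a -> a 0 = 0 -> a l = 0 ->
  exists2 K, 0 <= K & forall x, 0 < x < l -> a x <= K * x /\ a x <= K * (l - x).
Proof.
move=> l0 [ca [df [cdf da]]] a0 al.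
have [K HK] := within_bounded cdf.
have K0 : 0 <= K by apply: le_trans (HK 0 _) => //; rewrite lexx ltW.
exists K => // x /andP[x0 xl].
have ca1 : {within `[0, x], continuous a}.
  by apply: continuous_subspaceW ca; apply: subset_itvl; rewrite bnd_simp ltW.
have ca2 : {within `[x, l], continuous a}.
  by apply: continuous_subspaceW ca; apply: subset_itvr; rewrite bnd_simp ltW.
have da1 y : y \in `]0, x[ -> is_derive y 1 a (df y).
  rewrite in_itv/= => /andP[y0 yx]; apply: da.
  by rewrite in_itv/= y0 (lt_trans yx).
have da2 y : y \in `]x, l[ -> is_derive y 1 a (df y).
  rewrite in_itv/= => /andP[y0 yx]; apply: da.
  by rewrite in_itv/= yx (lt_trans x0).
have [c] := @MVT R a df 0 x x0 da1 ca1.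
rewrite in_itv/= => /andP[c0 cx]; rewrite a0 !subr0 => E1.
have [c'] := @MVT R a df x l xl da2 ca2.
rewrite in_itv/= => /andP[c0' cx']; rewrite al sub0r => E.
have h1 : `|df c| <= K by apply: HK; rewrite (ltW c0) ltW// (lt_trans cx).
have h2 : `|df c'| <= K by apply: HK; rewrite (ltW cx') andbT ltW// (lt_trans x0).
split; first by rewrite E1 ler_pM2r// (le_trans (ler_norm _)).
by rewrite -[leLHS]opprK E -mulNr ler_pM2r ?subr_gt0// (le_trans (ler_norm _))// normrN.
Qed.

(** As [grad] picks a representative by choice, Poincare's inequality is applied to the difference
    of the two chosen gradients rather than to [grad] of the difference. *)
Lemma weak_derivB (l : R) (v w v' w' : R -> R) : L2 l v -> L2 l v' -> L2 l w -> L2 l w' ->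
  weak_deriv l v w -> weak_deriv l v' w' ->
  weak_deriv l (fun x => v x - v' x) (fun x => w x - w' x).
Proof.
move=> /L2_itg[mv v2] /L2_itg[mv' v2'] /L2_itg[mw w2] /L2_itg[mw' w2'].
move=> [lv lw vw] [lv' lw' vw']; split.
- exact: locally_integrableB.
- exact: locally_integrableB.
move=> psi tpsi; have [cpsi cdpsi] := test_fun_cont tpsi.
have [K HK] := cont_bounded 0 l cpsi; have [K' HK'] := cont_bounded 0 l cdpsi.
have mpsi : measurable_fun `]0, l[ psi by exact: cont_meas.
have mdpsi : measurable_fun `]0, l[ (derive1 psi) by exact: cont_meas.
have ip (f : R -> R) : measurable_fun `]0, l[ f -> itg mu `]0, l[ (fun x => f x ^+ 2) ->
    itg mu `]0, l[ (fun x => f x * psi x) /\ itg mu `]0, l[ (fun x => f x * derive1 psi x).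
  by move=> mf f2; have fi := itg_L1 mf f2; split; [exact: (itgMb (K := K) _ fi)|
    exact: (itgMb (K := K') _ fi)].
transitivity (\int[mu]_(x in `]0, l[) (v x * derive1 psi x - v' x * derive1 psi x)).
  by apply: eq_Rintegral => x _; rewrite mulrBl.
have [_ i1] := ip _ mv v2; have [_ i2] := ip _ mv' v2'.
have [i3 _] := ip _ mw w2; have [i4 _] := ip _ mw' w2'.
rewrite RintegralB// vw// vw'//.
transitivity (- \int[mu]_(x in `]0, l[) (w x * psi x - w' x * psi x)).
  by rewrite RintegralB//; ring.
by congr (- _); apply: eq_Rintegral => x _; rewrite mulrBl.
Qed.

Lemma misfit_iint (l T sigma : R) (u v : R -> R -> R) :
  measurable_fun (`](T - sigma), T[ `*` `]0, l[) (fun z : R * R => u z.1 z.2 - v z.1 z.2) ->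
  misfit l T sigma u v = (\int[(mu \x mu)%E]_(z in `](T - sigma)%R, T[ `*` `]0%R, l[)
    ((u z.1 z.2 - v z.1 z.2) ^+ 2)%:E)%E.
Proof.
move=> m_uv; rewrite /misfit.
rewrite (@rect_tonelli _ _ _ _ _ mu mu _ _ _ _ (fun t x => (u t x - v t x) ^+ 2))//.
  exact: measurable_funX.
by move=> x y; exact: sqr_ge0.
Qed.

Lemma lty_of_le (c y : R) (X : \bar R) : 0 < c -> (c%:E * X <= y%:E)%E -> (X < +oo)%E.
Proof.
by case: X => [r||] c0 //; rewrite ?ltry// gt0_muley ?lte_fin// leye_eq.
Qed.

(** Here s = 1/sigma; A and D are the squared misfits of u(q_N) and u(q_0) to the data; G, Gs, P are
    the squared norms and the scalar product of the gradients; I is the pairing; W and Z are the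
    squared norms of w and z; 3 B bounds Z. *)
Lemma final_estimate (s A D G Gs P I W Z B de N c1 c2 : R) :
  0 < s -> 0 <= A -> 0 <= G - 2 * P + Gs -> 0 <= B -> 0 < de -> 0 < c1 -> 0 < c2 ->
  c1 * de <= N -> N <= c2 * de ->
  s / 2 * A + N / 2 * G <= s / 2 * D + N / 2 * Gs -> Gs - P = s * I ->
  N * I <= W / 8 + 2 * N ^+ 2 * Z -> W <= 2 * A + 2 * D -> s * D <= de ^+ 2 ->
  Z <= 3 * B ->
  let C0 := 3 / 4 + 6 * c2 ^+ 2 * B * s in
  G - 2 * P + Gs <= 2 * C0 / c1 * de /\ s * W <= (8 * C0 + 2) * de ^+ 2.
Proof.
move=> s0 A0 E0 B0 de0 c10 c20 Nlo Nhi J GI Y W2 D1 Z3 C0.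
have N0 : 0 < N by apply: lt_le_trans Nlo; rewrite mulr_gt0.
have N2 : N ^+ 2 <= c2 ^+ 2 * de ^+ 2.
  by rewrite -exprMn ler_pXn2r ?nnegrE ?mulr_ge0// ltW.
have NZ : N ^+ 2 * Z <= c2 ^+ 2 * de ^+ 2 * (3 * B).
  apply: le_trans (ler_wpM2l (sqr_ge0 _) Z3) _.
  by rewrite ler_wpM2r// mulr_ge0.
have sNI : s * (N * I) <= s * (W / 8 + 2 * N ^+ 2 * Z) by rewrite ler_wpM2l// ltW.
have sNZ : s * (N ^+ 2 * Z) <= s * (c2 ^+ 2 * de ^+ 2 * (3 * B)) by rewrite ler_wpM2l// ltW.
have sW : s * W <= s * (2 * A + 2 * D) by rewrite ler_wpM2l// ltW.
have NGP : N * (Gs - P) = s * (N * I) by rewrite GI; ring.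
(* Completing the square leaves sA/2 + N/2 (G - 2P + Gs) <= sD/2 + s N I. Young's bound costs sW/8
   <= sA/4 + sD/4, so sA/4 survives on the left. On the right 3 sD/4 + 2 s N^2 Z gives both terms of
   C0. *)
have key : s * A / 4 + N / 2 * (G - 2 * P + Gs) <= C0 * de ^+ 2.
  rewrite /C0.
  have -> : (3 / 4 + 6 * c2 ^+ 2 * B * s) * de ^+ 2 =
    3 / 4 * de ^+ 2 + 2 * (s * (c2 ^+ 2 * de ^+ 2 * (3 * B))) by field.
  have e1 : N / 2 * (G - 2 * P + Gs) = N / 2 * G - N / 2 * Gs + N * (Gs - P) by field.
  rewrite e1 NGP.
  have e2 : s * (W / 8 + 2 * N ^+ 2 * Z) = (s * W) / 8 + 2 * (s * (N ^+ 2 * Z)) by field.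
  rewrite e2 in sNI.
  have e3 : s * (2 * A + 2 * D) = 2 * (s * A) + 2 * (s * D) by ring.
  rewrite e3 in sW.
  have e4 : s / 2 * A = (s * A) / 2 by field.
  have e5 : s / 2 * D = (s * D) / 2 by field.
  rewrite e4 e5 in J.
  move: J sNI sNZ sW D1; clear.
  move: (s * A) (s * D) (s * W) (s * (N ^+ 2 * Z)) (s * (N * I))
    (s * (c2 ^+ 2 * de ^+ 2 * (3 * B))) (N / 2 * G) (N / 2 * Gs) (de ^+ 2).
  by move=> *; lra.
have sA0 : 0 <= s * A by rewrite mulr_ge0// ltW.
have NE0 : 0 <= N / 2 * (G - 2 * P + Gs) by rewrite mulr_ge0// divr_ge0// ltW.
split; last first.
  apply: le_trans sW _; have -> : s * (2 * A + 2 * D) = 8 * (s * A / 4) + 2 * (s * D) by field.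
  by rewrite mulrDl -mulrA; lra.
(* The lower bound on N enters here, to divide delta^2 by N. *)
have h : c1 * de / 2 * (G - 2 * P + Gs) <= C0 * de ^+ 2.
  apply: le_trans (_ : N / 2 * (G - 2 * P + Gs) <= _); last by lra.
  by rewrite ler_wpM2r// ler_pM2r.
rewrite -(@ler_pM2l _ (c1 * de / 2)) ?divr_gt0 ?mulr_gt0//.
apply: le_trans h _; rewrite le_eqVlt; apply/orP; left; apply/eqP.
by field; rewrite gt_eqF.
Qed.

End Estimate.

Unset Implicit Arguments.

#[local] Opaque Rintegral grad dt.

Theorem theorem6p2 (R : realType)
  (l sigma : R) (l_gt0 : 0 < l) (sigma_gt0 : 0 < sigma)
  (a : R -> R) (a_C1 : C1 l a) (a0 : a 0 = 0) (al : a l = 0)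
  (a_gt0 : forall x, x \in `]0, l[ -> 0 < a x)
  (phi0 : R -> R)
  (phi0_cont : {within `[0, l], continuous phi0})
  (phi0_smooth : forall x, x \in `]0, l[ -> smooth_at phi0 x)
  (phi0_ge0 : forall x, x \in `]0, l[ -> 0 <= phi0 x)
  (phi0_neq0 : exists2 x, x \in `]0, l[ & phi0 x != 0)
  (alpha beta : R) (alpha_gt0 : 0 < alpha) (beta_gt0 : 0 < beta)
  (qstar : R -> R) (qstar_adm : admissible l alpha beta qstar)
  (* N ~ delta means c1 * delta <= N <= c2 * delta *)
  (c1 c2 : R) (c1_gt0 : 0 < c1) (c2_gt0 : 0 < c2)
  (* bound on the norms of the source function phi: phi is defined on
     (T-sigma,T), so a constant independent of T can depend on phi only
     through its norms *)
  (M : R) :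
  exists C : R, 0 < C /\
  forall T : R, sigma < T ->
  forall ustar : R -> R -> R, weak_solution l T a phi0 qstar ustar ->
  forall g : R -> R, Linfty l g ->
    {ae @lebesgue_measure R, forall x, x \in `]0, l[ -> ustar T x = g x} ->
  forall phi divphi : R -> R -> R,
    H10L2 l (T - sigma) T phi ->
    L2Ha l a (T - sigma) T phi ->
    (forall p : R -> R, H1 l p ->
       \int[@lebesgue_measure R]_(x in `]0, l[) (F T sigma ustar phi x * p x) =
       \int[@lebesgue_measure R]_(x in `]0, l[)
         (grad l qstar x * grad l p x)) ->
    (* divphi is the divergence of a grad phi *)
    L2L2 l (T - sigma) T divphi ->
    {ae @lebesgue_measure R, forall t, t \in `]T - sigma, T[ ->
       weak_deriv l (fun x => a x * grad l (phi t) x) (divphi t)} ->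
    (\int[@lebesgue_measure R]_(t in `](T - sigma)%R, T[)
       \int[@lebesgue_measure R]_(x in `]0%R, l[)
         ((phi t x) ^+ 2 + (dt l (T - sigma) T phi t x) ^+ 2
          + (divphi t x) ^+ 2)%:E <= M%:E)%E ->
  forall delta N : R, 0 < delta -> 0 < N ->
    c1 * delta <= N <= c2 * delta ->
  forall gd : R -> R, measurable_fun `]0, l[ gd ->
    (((2 * sigma)^-1)%:E * misfit l T sigma ustar (fun _ => gd)
       <= (delta ^+ 2 / 2)%:E)%E ->
  forall qN : R -> R, minimizer l T sigma N alpha beta a phi0 gd qN ->
    qN 0 = qstar 0 -> qN l = qstar l ->
  forall uN : R -> R -> R, weak_solution l T a phi0 qN uN ->
    (\int[@lebesgue_measure R]_(x in `]0%R, l[) ((qN x - qstar x) ^+ 2)%:E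
       <= (C * delta)%:E)%E /\
    ((sigma^-1)%:E * misfit l T sigma uN ustar <= (C * delta ^+ 2)%:E)%E.
Proof.
have mI (D : interval R) : measurable [set` D] by exact: measurable_itv.
have [K K0 aK0] := C1_bound l_gt0 a_C1 a0 al.
have aK x : 0 < x < l -> 0 < a x /\ a x <= K * x /\ a x <= K * (l - x).
  by move=> xl; split; [apply: a_gt0; rewrite in_itv|exact: aK0].
have ma : measurable_fun `]0, l[ a.
  have [ca _] := a_C1; apply: measurable_funS (within_meas ca) => //.
  exact: subset_itv_oo_cc.
pose s := sigma^-1; have s0 : 0 < s by rewrite invr_gt0.
(* The factor beta^2 accounts for the term q_N phi in z. The absolute value makes B nonnegative
   before any phi is given. *)
pose B := (1 + beta ^+ 2) * `|M|.
have B0 : 0 <= B by rewrite mulr_ge0// addr_ge0// sqr_ge0.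
pose C0 := 3 / 4 + 6 * c2 ^+ 2 * B * s.
have C0_gt0 : 0 < C0.
  have sge : 0 <= s by exact: ltW.
  apply: ltr_wpDr; last by rewrite divr_gt0.
  by do 3 (apply: mulr_ge0 => //); exact: sqr_ge0.
(* [Ca] is Poincare's constant times the gradient bound; [Cb] is the constant of the bound on w. *)
pose Ca := 2 * l ^+ 2 * (2 * C0 / c1); pose Cb := 8 * C0 + 2.
have Ca0 : 0 < Ca.
  apply: mulr_gt0; first by apply: mulr_gt0 => //; exact: exprn_gt0.
  by apply: divr_gt0 => //; exact: mulr_gt0.
have Cb0 : 0 < Cb by apply: addr_gt0 => //; exact: mulr_gt0.
exists (Ca + Cb); split; first exact: addr_gt0.
move=> T sT us usol g _ _ phi divphi phiH phiHa source divL2 divE normM.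
move=> de N de0 N0 /andP[Nlo Nhi] gd mgd noise qN [qN_adm minq] qN0 qNl uN uNsol.
pose p := T - sigma.
have [[cqs qsL2 wqs gqsL2] qsb] := qstar_adm; have [[cqN qNL2 wqN gqNL2] qNb] := qN_adm.
have [mqs qs2] := L2_itg qsL2; have [mqN qN2] := L2_itg qNL2.
have [mgs gs2] := L2_itg gqsL2; have [mgN gN2] := L2_itg gqNL2.
have qabs q : (forall x, x \in `]0, l[ -> alpha <= q x <= beta) ->
    forall x, x \in `]0, l[ -> `|q x| <= beta.
  move=> H x xl; have /andP[h1 h2] := H x xl.
  by rewrite ger0_norm// (le_trans _ h1)// ltW.
have qsb' := qabs _ qsb; have qNb' := qabs _ qNb.
have dualN := weak_solution_dual l_gt0 sigma_gt0 sT K0 ma aK mqN qNb' uNsol phiH phiHa divL2 divE.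
have duals := weak_solution_dual l_gt0 sigma_gt0 sT K0 ma aK mqs qsb' usol phiH phiHa divL2 divE.
set dphi := dt l (T - sigma) T phi in dualN duals normM.
have p0 : 0 <= p by rewrite subr_ge0 ltW.
have uNL2 : L2L2 l (T - sigma) T uN.
  by have [[uL _ _ _] _ _ _] := uNsol; exact: (L2L2_sub p0 (lexx T) uL).
have usL2 : L2L2 l (T - sigma) T us.
  by have [[uL _ _ _] _ _ _] := usol; exact: (L2L2_sub p0 (lexx T) uL).
have [[phiL2 [dphiL2 _] _ _] _ _] := phiH.
have [muN uN2] := L2L2_itg uNL2; have [mus us2] := L2L2_itg usL2.
have [mphi phi2] := L2L2_itg phiL2; have [mdphi dphi2] := L2L2_itg dphiL2.
have [mdiv div2] := L2L2_itg divL2.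
rewrite -/dphi in mdphi dphi2.
have mQ : measurable (`](T - sigma), T[ `*` `]0, l[) by exact: measurableX.
have mgd' : measurable_fun (`](T - sigma), T[ `*` `]0, l[) (fun z : R * R => gd z.2).
  exact: rect_meas2.
have mqN' : measurable_fun (`](T - sigma), T[ `*` `]0, l[) (fun z : R * R => qN z.2).
  exact: rect_meas2.
have mqs' : measurable_fun (`](T - sigma), T[ `*` `]0, l[) (fun z : R * R => qstar z.2).
  exact: rect_meas2.
pose iint (f : R * R -> R) := \int[(lebesgue_measure \x lebesgue_measure)%E]_(z in
  `](T - sigma), T[ `*` `]0, l[) f z.
have mrs := measurable_funB mus mgd'.
have mrN := measurable_funB muN mgd'.
have s2 : 0 < (2 * sigma)^-1 by rewrite invr_gt0 mulr_gt0.
have rs2 : itg (lebesgue_measure \x lebesgue_measure)%E (`](T - sigma), T[ `*` `]0, l[)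
    (fun z : R * R => (us z.1 z.2 - gd z.2) ^+ 2).
  apply: itg_lty => //; first exact: measurable_funX.
    by move=> z _; exact: sqr_ge0.
  by have := lty_of_le s2 noise; rewrite misfit_iint.
have mw := measurable_funB muN mus.
have w2 : itg (lebesgue_measure \x lebesgue_measure)%E (`](T - sigma), T[ `*` `]0, l[)
    (fun z : R * R => (uN z.1 z.2 - us z.1 z.2) ^+ 2) by apply: itgB2.
have rN2 : itg (lebesgue_measure \x lebesgue_measure)%E (`](T - sigma), T[ `*` `]0, l[)
    (fun z : R * R => (uN z.1 z.2 - gd z.2) ^+ 2).
  (* Finiteness of the misfit of u(q_N) goes through u(q_0), whose misfit is finite by the noise
     bound. *)
  have : itg (lebesgue_measure \x lebesgue_measure)%E (`](T - sigma), T[ `*` `]0, l[)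
    (fun z : R * R => ((uN z.1 z.2 - us z.1 z.2) + (us z.1 z.2 - gd z.2)) ^+ 2).
    by apply: itgD2.
  by apply: eq_integrable => // z _ /=; rewrite addrA subrK.
have [A AE] : exists A : R, A = iint (fun z => (uN z.1 z.2 - gd z.2) ^+ 2) := ex_intro _ _ erefl.
have [D DE] : exists D : R, D = iint (fun z => (us z.1 z.2 - gd z.2) ^+ 2) := ex_intro _ _ erefl.
have [W WE] : exists W : R, W = iint (fun z => (uN z.1 z.2 - us z.1 z.2) ^+ 2) := ex_intro _ _ erefl.
have [G GE] : exists G : R, G = \int[@lebesgue_measure R]_(x in `]0, l[) (grad l qN x ^+ 2) := ex_intro _ _ erefl.
have [Gs GsE] : exists Gs : R, Gs = \int[@lebesgue_measure R]_(x in `]0, l[) (grad l qstar x ^+ 2) := ex_intro _ _ erefl.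
have [P PE] : exists P : R, P = \int[@lebesgue_measure R]_(x in `]0, l[) (grad l qstar x * grad l qN x) := ex_intro _ _ erefl.
have half : (2 * sigma)^-1 = s / 2 by rewrite invfM mulrC.
have mN : misfit l T sigma uN (fun _ => gd) = A%:E by rewrite misfit_iint// AE -Rint_EFin.
have ms : misfit l T sigma us (fun _ => gd) = D%:E by rewrite misfit_iint// DE -Rint_EFin.
have mNs : misfit l T sigma uN us = W%:E by rewrite misfit_iint// WE -Rint_EFin.
have J1 : s / 2 * A + N / 2 * G <= s / 2 * D + N / 2 * Gs.
  have EG : (\int[@lebesgue_measure R]_(x in `]0%R, l[) ((grad l qN x) ^+ 2)%:E = G%:E)%E.
    by rewrite GE -Rint_EFin; first [exact: gN2 | exact: erefl | exact: mI].
  have EGs : (\int[@lebesgue_measure R]_(x in `]0%R, l[) ((grad l qstar x) ^+ 2)%:E = Gs%:E)%E.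
    by rewrite GsE -Rint_EFin; first [exact: gs2 | exact: erefl | exact: mI].
  have := minq qstar uN us qstar_adm uNsol usol; rewrite /J mN ms half EG EGs.
  by rewrite -!EFinM -!EFinD lee_fin.
have D1 : s * D <= de ^+ 2.
  move: noise; rewrite ms half -EFinM lee_fin => h; clear -h; lra.
have bnd (q : R -> R) : (forall x, x \in `]0, l[ -> `|q x| <= beta) ->
    forall z : R * R, (`](T - sigma), T[ `*` `]0, l[) z -> `|q z.2| <= beta.
  by move=> qb [t x] [/= _ xl]; exact: qb.
have i4 : itg (lebesgue_measure \x lebesgue_measure)%E (`](T - sigma), T[ `*` `]0, l[)
    (fun z : R * R => us z.1 z.2 * phi z.1 z.2) by apply: itgM2.
have i5 (q : R -> R) : measurable_fun (`](T - sigma), T[ `*` `]0, l[) (fun z : R * R => q z.2) ->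
    (forall x, x \in `]0, l[ -> `|q x| <= beta) ->
    itg (lebesgue_measure \x lebesgue_measure)%E (`](T - sigma), T[ `*` `]0, l[)
    (fun z : R * R => us z.1 z.2 * phi z.1 z.2 * q z.2).
  by move=> mq qb; apply: (itgMb (K := beta) _ i4) => //; exact: bnd.
have FE (q : R -> R) : measurable_fun `]0, l[ q -> (forall x, x \in `]0, l[ -> `|q x| <= beta) ->
    \int[@lebesgue_measure R]_(x in `]0, l[) (F T sigma us phi x * q x) =
    - s * iint (fun z => us z.1 z.2 * phi z.1 z.2 * q z.2).
  move=> mq qb; have mq' : measurable_fun (`](T - sigma), T[ `*` `]0, l[) (fun z : R * R => q z.2).
    exact: rect_meas2.
  have i6 := i5 q mq' qb.
  have i7 : itg (lebesgue_measure \x lebesgue_measure)%E (`](T - sigma), T[ `*` `]0, l[)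
    (fun z : R * R => - s * (us z.1 z.2 * phi z.1 z.2 * q z.2)) by apply: itgZ.
  rewrite -RintZ// -(@rect_fubini2 _ _ _ _ _ lebesgue_measure lebesgue_measure
    `](T - sigma), T[ `]0, l[ (mI _) (mI _)
    (fun t x => - s * (us t x * phi t x * q x)) i7).
  have m1 := @rect_meas_Rint2 _ _ _ _ _ lebesgue_measure lebesgue_measure
    `](T - sigma), T[ `]0, l[ (mI _) (mI _)
    (fun t x => us t x * phi t x) i4.
  have m2 := @rect_meas_Rint2 _ _ _ _ _ lebesgue_measure lebesgue_measure
    `](T - sigma), T[ `]0, l[ (mI _) (mI _)
    (fun t x => - s * (us t x * phi t x * q x)) i7.
  have f1 := @rect_ae_itg2 _ _ _ _ _ lebesgue_measure lebesgue_measure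
    `](T - sigma), T[ `]0, l[ (mI _) (mI _)
    (fun t x => us t x * phi t x) i4.
  apply: Rint_ae => //.
    apply: measurable_funM => //; apply: measurableT_comp => //.
    by apply: measurable_funM.
  apply: ae_imp f1 => x Hx xl; have ix := Hx xl.
  rewrite /F -/s -mulNr -mulrA [_ * q x]mulrC -RintZ// -RintZ; [|by []|exact: itgZ].
  by apply: eq_Rintegral => t _; ring.
have [I IE] : exists I : R, I = iint (fun z => us z.1 z.2 * phi z.1 z.2 * qN z.2)
  - iint (fun z => us z.1 z.2 * phi z.1 z.2 * qstar z.2) := ex_intro _ _ erefl.
(* The source condition at p = q_0 minus the one at p = q_N; the minus sign in [F] turns q_0 - q_N
   into q_N - q_0. *)
have GI : Gs - P = s * I.
  have h1 := source _ (proj1 qstar_adm); have h2 := source _ (proj1 qN_adm).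
  rewrite FE// in h1; rewrite FE// in h2.
  have Gs2 : Gs = \int[@lebesgue_measure R]_(x in `]0, l[) (grad l qstar x * grad l qstar x).
    by rewrite GsE; apply: eq_Rintegral => x _; rewrite expr2.
  by rewrite PE -h2 Gs2 -h1 IE; ring.
pose zf (q : R -> R) (z : R * R) := dphi z.1 z.2 + divphi z.1 z.2 - q z.2 * phi z.1 z.2.
have zP (q : R -> R) : measurable_fun (`](T - sigma), T[ `*` `]0, l[) (fun z : R * R => q z.2) ->
    (forall x, x \in `]0, l[ -> `|q x| <= beta) ->
    measurable_fun (`](T - sigma), T[ `*` `]0, l[) (zf q) /\
    itg (lebesgue_measure \x lebesgue_measure)%E (`](T - sigma), T[ `*` `]0, l[)
      (fun z => zf q z ^+ 2).
  move=> mq qb; have mdd := measurable_funD mdphi mdiv.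
  have mqp := measurable_funM mq mphi.
  split; first exact: measurable_funB.
  apply: itgB2 => //; first exact: itgD2.
  apply: (@itg_le _ _ _ (lebesgue_measure \x lebesgue_measure)%E _ _ _
    (fun z : R * R => beta ^+ 2 * phi z.1 z.2 ^+ 2)).
  - exact: measurableX.
  - exact: measurable_funX.
  - move=> z Qz; rewrite ger0_norm ?sqr_ge0// exprMn ler_wpM2r ?sqr_ge0//.
    by rewrite -(real_normK (num_real (q _))) lerXn2r ?nnegrE ?(ltW beta_gt0)// bnd.
  - exact: itgZ.
have [mzN zN2] := zP _ mqN' qNb'; have [mzs zs2] := zP _ mqs' qsb'.
have iwz : itg (lebesgue_measure \x lebesgue_measure)%E (`](T - sigma), T[ `*` `]0, l[)
    (fun z : R * R => (uN z.1 z.2 - us z.1 z.2) * zf qN z) by apply: itgM2.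
have iNz : itg (lebesgue_measure \x lebesgue_measure)%E (`](T - sigma), T[ `*` `]0, l[)
    (fun z : R * R => uN z.1 z.2 * zf qN z) by apply: itgM2.
have isz : itg (lebesgue_measure \x lebesgue_measure)%E (`](T - sigma), T[ `*` `]0, l[)
    (fun z : R * R => us z.1 z.2 * zf qstar z) by apply: itgM2.
have i5N := i5 _ mqN' qNb'; have i5s := i5 _ mqs' qsb'.
have WZ : iint (fun z => (uN z.1 z.2 - us z.1 z.2) * zf qN z) = I.
  (* Uses z_0 - z_N = (q_N - q_0) phi, where z_0 and z_N are the residuals of q_0 and q_N; the first
     two products integrate to 0 by duality. *)
  rewrite IE; transitivity (iint (fun z => (uN z.1 z.2 * zf qN z - us z.1 z.2 * zf qstar z)
     + (us z.1 z.2 * phi z.1 z.2 * qN z.2 - us z.1 z.2 * phi z.1 z.2 * qstar z.2))).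
    by apply: eq_Rintegral => z _; rewrite /zf; ring.
  rewrite /iint RintegralD; [|by []|exact: itgB|exact: itgB].
  rewrite RintegralB// RintegralB// -/(iint _).
  rewrite [X in X - _](_ : _ = 0); last exact: dualN.
  by rewrite [X in _ - X](_ : _ = 0) ?subrr ?add0r; last exact: duals.
have [Z ZE] : exists Z : R, Z = iint (fun z => zf qN z ^+ 2) := ex_intro _ _ erefl.
have Y : N * I <= W / 8 + 2 * N ^+ 2 * Z.
  rewrite -WZ WE ZE /iint [X in _ <= X + _]mulrC -!RintZ// -RintegralD; [|by []|exact: itgZ|exact: itgZ].
  apply: le_Rintegral => //; [exact: itgZ|by apply: itgD => //; exact: itgZ|].
  (* The square of w - 4 N z yields N w z <= w^2/8 + 2 N^2 z^2; the weight 1/8 is small enough for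
     the misfit to absorb. *)
  move=> z _; have := sqr_ge0 ((uN z.1 z.2 - us z.1 z.2) - 4 * N * zf qN z).
  by move: (uN z.1 z.2 - us z.1 z.2) (zf qN z) => w y; clear; nra.
have W2 : W <= 2 * A + 2 * D.
  rewrite WE AE DE /iint -!RintZ// -RintegralD; [|by []|exact: itgZ|exact: itgZ].
  apply: le_Rintegral => //; first by apply: itgD => //; exact: itgZ.
  move=> z _; have := sqr_ge0 ((uN z.1 z.2 - gd z.2) + (us z.1 z.2 - gd z.2)).
  by move: (uN z.1 z.2) (us z.1 z.2) (gd z.2) => w y g'; clear; nra.
have Z3 : Z <= 3 * B.
  pose f t x := phi t x ^+ 2 + dphi t x ^+ 2 + divphi t x ^+ 2.
  have fi : itg (lebesgue_measure \x lebesgue_measure)%E (`](T - sigma), T[ `*` `]0, l[)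
    (fun z : R * R => f z.1 z.2) by apply: itgD => //; apply: itgD.
  have fM : iint (fun z => f z.1 z.2) <= `|M|.
    apply: le_trans (ler_norm M); rewrite -lee_fin /iint Rint_EFin//.
    rewrite -(@rect_tonelli _ _ _ _ _ lebesgue_measure lebesgue_measure _ _ (mI _) (mI _) f)//.
      exact: itg_meas fi.
    by move=> t x; rewrite !addr_ge0 ?sqr_ge0.
  have b21 : 0 <= 3 * (1 + beta ^+ 2) by rewrite mulr_ge0 ?addr_ge0 ?sqr_ge0.
  rewrite /B mulrA; apply: le_trans (ler_wpM2l b21 fM).
  rewrite ZE /iint -RintZ//; apply: le_Rintegral => //; first exact: itgZ.
  move=> z Qz; rewrite /zf /f.
  have qb2 : (qN z.2 * phi z.1 z.2) ^+ 2 <= beta ^+ 2 * phi z.1 z.2 ^+ 2.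
    rewrite exprMn ler_wpM2r ?sqr_ge0//.
    by rewrite -(real_normK (num_real (qN _))) lerXn2r ?nnegrE ?(ltW beta_gt0)// bnd.
  move: qb2 (sqr_ge0 beta); move: (qN z.2 * phi z.1 z.2) => x1.
  move: (dphi z.1 z.2) (divphi z.1 z.2) (phi z.1 z.2) (beta ^+ 2) => x2 x3 x4 b h h'.
  (* The three terms of the residual cost a factor 3, the one in 3 B. *)
  have hh : (x2 + x3 - x1) ^+ 2 <= 3 * (x2 ^+ 2 + x3 ^+ 2 + x1 ^+ 2).
    by have := sqr_ge0 (x2 - x3); have := sqr_ge0 (x2 + x1); have := sqr_ge0 (x3 + x1);
      clear; nra.
  apply: le_trans hh _.
  have h2 := mulr_ge0 h' (sqr_ge0 x2); have h3 := mulr_ge0 h' (sqr_ge0 x3).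
  have h4 := sqr_ge0 x4.
  have -> : 3 * (1 + b) * (x4 ^+ 2 + x2 ^+ 2 + x3 ^+ 2) = 3 * (x2 ^+ 2 + x3 ^+ 2)
    + 3 * (b * x4 ^+ 2) + 3 * (x4 ^+ 2) + 3 * (b * x2 ^+ 2) + 3 * (b * x3 ^+ 2) by ring.
  move: h h2 h3 h4; move: (b * x4 ^+ 2) (b * x2 ^+ 2) (b * x3 ^+ 2) (x4 ^+ 2) (x1 ^+ 2)
    (x2 ^+ 2) (x3 ^+ 2); clear; move=> *; lra.
have wd := weak_derivB qNL2 qsL2 gqNL2 gqsL2 wqN wqs.
have E : \int[@lebesgue_measure R]_(x in `]0, l[) ((grad l qN x - grad l qstar x) ^+ 2) =
    G - 2 * P + Gs.
  have iP : itg lebesgue_measure `]0, l[ (fun x => grad l qstar x * grad l qN x) by apply: itgM2.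
  rewrite GE PE GsE -RintZ// -RintegralB//; last exact: itgZ.
  rewrite -RintegralD//; last by apply: itgB => //; exact: itgZ.
  by apply: eq_Rintegral => x _; ring.
have E0 : 0 <= G - 2 * P + Gs.
  by rewrite -E; apply: Rintegral_ge0 => x _; exact: sqr_ge0.
have A0 : 0 <= A by rewrite AE; apply: Rintegral_ge0 => z _; exact: sqr_ge0.
have [F1 F2] := final_estimate s0 A0 E0 B0 de0 c1_gt0 c2_gt0 Nlo Nhi J1 GI Y W2 D1 Z3.
rewrite -/C0 in F1 F2.
split; last first.
  rewrite mNs -EFinM lee_fin; apply: le_trans F2 _.
  by rewrite ler_wpM2r ?sqr_ge0// lerDr ltW.
rewrite -Rint_EFin//; last exact: itgB2.
rewrite lee_fin; apply: (@le_trans _ _ (Ca * de)); last by rewrite ler_pM2r// lerDl ltW.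
have cd : {within `[0, l], continuous (fun x => qN x - qstar x)}.
  by move=> x; apply: cvgB; [exact: cqN|exact: cqs].
have v0 : qN 0 - qstar 0 = 0 by rewrite qN0 subrr.
have gB2 : itg lebesgue_measure `]0, l[ (fun x => (grad l qN x - grad l qstar x) ^+ 2).
  exact: itgB2.
apply: le_trans (poincare l_gt0 cd v0 wd (measurable_funB mgN mgs) gB2) _.
by rewrite E /Ca -[leRHS]mulrA ler_wpM2l// mulr_ge0 ?sqr_ge0.
Qed.
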